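(* Let $\Theta=(\kappa_0,\kappa_1,\kappa_\infty)$ be generic, let $\pi:\overline{\mathfrak{Con}^V_\Theta}\to\mathbb P^1_t$ be the compactified moduli space of PV connections described in the context, and let $\mathcal F^V$ be the isomonodromic foliation induced on it by the fifth Painlevé equation. The boundary components $\pi^{-1}(0)$ and $\pi^{-1}(\infty)$ are invariant for $\mathcal F^V$. The foliation restricted to each $\mathbb F_1$ component of $\pi^{-1}(0)$ and of $\pi^{-1}(\infty)$ is a pencil of conics, while restricted to the $\mathbb F_0$ component of $\pi^{-1}(\infty)$ it is a pencil of genus-one curves.
   Context: Put $\rho=\frac{(\kappa_0+\kappa_1-1)^2-\kappa_\infty^2}{4}$. PV connections are rank-two meromorphic connections on $\mathbb P^1$ with simple poles at $0,\infty$ and a double irregular pole at $1$, up to meromorphic gauge equivalence. $\Theta$ is their fixed residual spectral data. A generic class is determined by three parameters $(t,q,\hat p)$, where $t\in\mathbb C^*$ is the nonzero eigenvalue of the leading coefficient at $x=1$, $q\in\mathbb C\setminus\{0,1\}$ is the position of an apparent singularity, and $\hat p\in\mathbb C$. Foliation. Put $\hat p=-pq(q-1)^2$. On the open set of points $(t,q,p)$ with $t\in\mathbb C^*$, $q\in\mathbb C\setminus\{0,1\}$, $p\in\mathbb C$, let $$H^V=\frac{q(q-1)^2p^2-\big(\kappa_0(q-1)^2+(\kappa_1-1)q(q-1)-tq\big)p+\rho(q-1)}{t},\qquad X^V=\partial_t+\frac{\partial H^V}{\partial p}\partial_q-\frac{\partial H^V}{\partial q}\partial_p .$$ The integral curves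 of $X^V$ are the solutions of the fifth Painlevé equation. $\mathcal F^V$ is the one-dimensional singular foliation on $\overline{\mathfrak{Con}^V_\Theta}$ extending the one generated by $X^V$. Base. $\widetilde{\mathcal M}$ is the blow-up of $\mathbb P^1_t\times\mathbb P^1_q$ at $(t,q)=(0,1),(\infty,0),(\infty,\infty)$, with exceptional curves $B^1_0,B^0_\infty,B^\infty_\infty$ respectively. $A_0,A_\infty,Q^0,Q^1,Q^\infty$ are the strict transforms of $\{t=0\},\{t=\infty\},\{q=0\},\{q=1\},\{q=\infty\}$. Line bundle. Put $T=1/t$, $Q=1/q$, $\tilde q=q-1$, $A=t/(q-1)=1/a$, $R=q/T=1/r$, $S=Q/T=1/s$, and $$P^0=P^\infty=-\frac{\hat p}{(q-1)^2},\qquad P^1=-\frac{\hat p}{qt},\qquad P^1_0=-\frac{\hat p}{q-1}.$$ Take the line bundle $\mathcal O_{\widetilde{\mathcal M}}(D)$ with $D=A_0+2Q^1+2B^1_0-B^0_\infty-B^\infty_\infty$, and add the section at infinity to obtain a $\mathbb P^1$-bundle over $\widetilde{\mathcal M}$. Its charts (base coordinates; affine fibre coordinate) are: $(t,q;P^0)$ for $t\neq\infty$, $q\ne1,\infty$; $(t,Q;P^\infty)$ near $Q^\infty$, $t\ne\infty$; $(t,q;P^1)$ for $t\in\mathbb C^*$ and $(T,q;P^1)$ near $T=0$, both for $q\neq0,\infty$; $(A,\tilde q;P^1_0)$ and $(t,a;P^1)$ near $B^1_0$; $(T,R;P^0)$ and $(r,q;P^1)$ near $B^0_\infty$; $(T,S;P^\infty)$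 and $(s,Q;P^1)$ near $B^\infty_\infty$. Denote by $\mathcal A_0,\mathcal A_\infty,\mathcal B^1_0,\mathcal B^0_\infty,\mathcal B^\infty_\infty,\mathcal Q^0,\mathcal Q^1,\mathcal Q^\infty$ the restrictions of this $\mathbb P^1$-bundle to the corresponding curves of $\widetilde{\mathcal M}$. The threefold. $\overline{\mathfrak{Con}^V_\Theta}$ is obtained from this $\mathbb P^1$-bundle by blowing up special sections over $Q^0,Q^1,Q^\infty,A_\infty$: in $\mathcal Q^0$ the sections $P^0=0$ and $P^0=\kappa_0$; in $\mathcal Q^\infty$ the two sections $P^\infty=\frac{\kappa_0+\kappa_1-1\pm\kappa_\infty}{2}$, corresponding to those in $\mathcal Q^0$ under the symmetry exchanging $0$ and $\infty$; in $\mathcal Q^1$ the sections $P^1=0$ and $P^1=-1$, each followed by a second blow-up, along $\beta_-=0$ and $\beta_+=\kappa_1/t$ respectively, where $\beta_-=P^1/(q-1)$ and $\beta_+=(P^1+1)/(q-1)$ are coordinates on the first exceptional divisors; in $\mathcal A_\infty$ the sections $P^1=0$ and $P^1=-1$, with coordinates $\frac{P^1q}{T(q-1)^2}$ and $\frac{(P^1+1)q}{T(q-1)^2}-\frac{\kappa_1}{q-1}$ on the exceptional divisors. For $t_0\in\mathbb C^*$ the fibre $\pi^{-1}(t_0)$ of the map $\pi$ given by $t$ is the Okamoto space of initial conditions. Components. The components of the boundary fibres meant in the statement are (the strict transforms, denoted by the same letters, of) $\mathcal A_0,\mathcal B^1_0$ for $\pi^{-1}(0)$, both $\mathbb F_1$,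 and $\mathcal B^0_\infty,\mathcal A_\infty,\mathcal B^\infty_\infty$ for $\pi^{-1}(\infty)$, where $\mathcal B^0_\infty,\mathcal B^\infty_\infty$ are $\mathbb F_1$ and the middle one $\mathcal A_\infty$ is $\mathbb F_0=\mathbb P^1\times\mathbb P^1$. The two exceptional divisors over the sections blown up in $\mathcal A_\infty$ also lie over $t=\infty$; they are not among the components to which the second sentence of the statement refers. Here $\mathbb F_n$ is the $n$-th Hirzebruch surface. Terminology. ''Is a pencil of conics'' (respectively ''of genus-one curves'') means that the leaves are contained in the level sets of a rational first integral of the restricted vector field, and that these level sets form a pencil of conics (genus-zero curves), respectively of curves of genus one. *)

(* Defs.v *)
From HB Require Import structures.
From mathcomp Require Import all_boot all_order all_algebra.
From mathcomp Require Import fraction generic_quotient.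
From mathcomp Require Import mpoly.

Set Implicit Arguments.
Unset Strict Implicit.
Unset Printing Implicit Defensive.

Import Order.TTheory GRing.Theory Num.Theory.
Local Open Scope ring_scope.

(* [C : numClosedFieldType] plays the role of the complex
   numbers (instances: [R[i]] for R real closed, and [algC]).

   A variety is handled through the local rings of its points, seen as subsets
   of its function field.  A subset of a field L is a predicate [L -> Prop]. *)

Section LocalRings.
Variable L : fieldType.
Implicit Type O : L -> Prop.

Definition unit_of O (f : L) : Prop := [/\ f != 0, O f & O f^-1].

Definition max_of O (f : L) : Prop := O f /\ ~ unit_of O f.

Definition radical_of O (s f : L) : Prop :=
  O f /\ exists (n : nat) (h : L), O h /\ f ^+ n = s * h.

End LocalRings.

(* ------------------------------------------------------------------------ *)
(* Geometric genus of an irreducible plane curve: the dimension of the space *)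
(* of everywhere regular differential forms on its function field.           *)
Section Genus.
Variables (C L : fieldType) (iota : {rmorphism C -> L}).

Definition derivation (D : L -> L) : Prop :=
  [/\ forall x y, D (x + y) = D x + D y,
      forall x y, D (x * y) = D x * y + x * D y
    & forall c, D (iota c) = 0].

(* A place, i.e. a nontrivial valuation ring of L over C. *)
Definition place (O : L -> Prop) : Prop :=
  [/\ forall c, O (iota c),
      forall x y, O x -> O y -> O (x - y) /\ O (x * y),
      forall x, x != 0 -> O x \/ O x^-1
    & exists x, ~ O x].

(* The derivations preserving O form the O-module generated by d/ds, for s a
   uniformizer: f dx is regular at O iff it is O-valued on all of them. *)
Definition regular_form (x f : L) : Prop :=
  forall O, place O ->
  forall D, derivation D -> (forall h, O h -> O (D h)) -> O (f * D x).

(* In characteristic 0, with C algebraically closed and L of transcendence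
   degree 1, dx is a basis of the differentials as soon as x is not constant. *)
Definition genus (g : nat) : Prop :=
  exists x : L, (forall c, x <> iota c) /\
  exists b : g.-tuple L,
    (forall f, regular_form x f <->
       exists c : 'I_g -> C, f = \sum_(i < g) iota (c i) * tnth b i) /\
    (forall c : 'I_g -> C, \sum_(i < g) iota (c i) * tnth b i = 0 ->
       forall i, c i = 0).

(* L is the function field of the plane curve f = 0, with generic point v. *)
Definition function_field (f : {mpoly C[2]}) (v : 'I_2 -> L) : Prop :=
  (forall a, mmap iota v a = 0 <-> exists b, a = b * f) /\
  (forall h, exists a b,
     mmap iota v b != 0 /\ h = mmap iota v a / mmap iota v b).

End Genus.

Definition irreducible_mpoly (C : fieldType) n (f : {mpoly C[n]}) : Prop :=
  (1 < msize f)%N /\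
  forall a b, f = a * b -> (msize a <= 1)%N || (msize b <= 1)%N.

Definition irreducible_curve_of_genus (C : fieldType) (g : nat)
    (f : {mpoly C[2]}) : Prop :=
  irreducible_mpoly f /\
  exists (L : fieldType) (iota : {rmorphism C -> L}) (v : 'I_2 -> L),
    function_field iota f v /\ genus iota g.

(* ------------------------------------------------------------------------ *)
Section PainleveV.
Variable C : numClosedFieldType.

(* The function field C(t,q,p) of the threefold. *)
Definition KV : fieldType := {fraction {mpoly C[3]}}.

Definition const (c : C) : KV := tofrac (c%:MP).
Definition var (i : nat) : KV := tofrac 'X_(inord i : 'I_3).
Definition vt : KV := var 0.
Definition vq : KV := var 1.
Definition vp : KV := var 2.

(* Partial derivative by the quotient rule on a representing fraction. *)
Definition pder (i : nat) (f : KV) : KV :=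
  let n := \n_(repr f) in let d := \d_(repr f) in
  tofrac (n^`M(inord i) * d - n * d^`M(inord i)) / tofrac d ^+ 2.

(* A coordinate system is a triple of generators of KV; [eval u a]
   is the polynomial a in these coordinates. *)
Definition coords := 3.-tuple KV.
Definition eval n (u : n.-tuple KV) (a : {mpoly C[n]}) : KV :=
  mmap const (tnth u) a.

(* The local ring in KV of the point with coordinates x. *)
Definition local_ring (u : coords) (x : 'I_3 -> C) (f : KV) : Prop :=
  exists a b : {mpoly C[3]}, b.@[x] != 0 /\ f = eval u a / eval u b.

(* The local ring in KV of the surface where the first coordinate vanishes. *)
Definition surface_ring (u : coords) (f : KV) : Prop :=
  exists x : 'I_3 -> C, x ord0 = 0 /\ local_ring u x f.

(* An affine chart: coordinates, with the open set of those points of affine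
   3-space at which the listed functions are regular and do not vanish. *)
Definition chart : Type := (coords * seq KV)%type.

Definition in_chart (c : chart) (x : 'I_3 -> C) : Prop :=
  forall f, f \in c.2 -> unit_of (local_ring c.1 x) f.

(* Blow-up of the curve x = 0, z = f, where f is a regular function of y. *)
Definition blowup (x y z f : KV) (us : seq KV) : seq chart :=
  [:: ([tuple x; y; (z - f) / x], us);
      ([tuple x / (z - f); y; z - f], us)].

(* The same, followed by the blow-up of the curve x = 0, (z - f) / x = f'. *)
Definition blowup2 (x y z f f' : KV) (us : seq KV) : seq chart :=
  ([tuple x / (z - f); y; z - f], us) :: blowup x y ((z - f) / x) f' us.

(* Neighbourhood of the section at infinity of the P^1-bundle with affine
   fibre coordinate z.  The sections f1, f2 to be blown up are removed: they
   are covered by the other charts. *)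
Definition infinity (x y z f1 f2 : KV) (us : seq KV) : seq chart :=
  [:: ([tuple x; y; z^-1], [:: 1 - f1 / z, 1 - f2 / z & us])].

(* P^1-bundle over a base chart (x,y), blown up along the two disjoint sections
   z = f1 and z = f2 over x = 0.  Each blow-up is done on the complement of the
   other section z = f2 (resp. f1) of the whole bundle; together with
   [infinity] these open sets cover. *)
Definition blowup_sections (x y z f1 f2 : KV) (us : seq KV) : seq chart :=
  blowup x y z f1 (z - f2 :: us) ++ blowup x y z f2 (z - f1 :: us)
  ++ infinity x y z f1 f2 us.

Definition blowup2_sections (x y z f1 f1' f2 f2' : KV) (us : seq KV) :
    seq chart :=
  blowup2 x y z f1 f1' (z - f2 :: us) ++ blowup2 x y z f2 f2' (z - f1 :: us)
  ++ infinity x y z f1 f2 us.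

(* The names of the coordinates t, q, p, T, Q, q - 1, A, a, R, r, S, s are
   prefixed by v. *)
Definition phat : KV := - vp * vq * (vq - 1) ^+ 2.
Definition vT : KV := vt^-1.
Definition vQ : KV := vq^-1.
Definition vq1 : KV := vq - 1.
Definition vA : KV := vt / (vq - 1).
Definition va : KV := vA^-1.
Definition vR : KV := vq / vT.
Definition vr : KV := vR^-1.
Definition vS : KV := vQ / vT.
Definition vs : KV := vS^-1.
Definition P0 : KV := - phat / (vq - 1) ^+ 2.
Definition Pinf : KV := - phat / (vq - 1) ^+ 2.
Definition P1 : KV := - phat / (vq * vt).
Definition P10 : KV := - phat / (vq - 1).

Section Kappa.
Variables k0 k1 kinf : C.

Definition rho : C := ((k0 + k1 - 1) ^+ 2 - kinf ^+ 2) / 4%:R.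

Definition HV : KV :=
  (vq * (vq - 1) ^+ 2 * vp ^+ 2
   - (const k0 * (vq - 1) ^+ 2 + const (k1 - 1) * vq * (vq - 1) - vt * vq) * vp
   + const rho * (vq - 1)) / vt.

Definition XV (f : KV) : KV :=
  pder 0 f + pder 2 HV * pder 1 f - pder 1 HV * pder 2 f.

Definition charts_Q0 : seq chart :=
  blowup_sections vq vt P0 0 (const k0) [:: vq - 1] ++
  blowup_sections vR vT P0 0 (const k0) [:: vq - 1].

Definition charts_Qinf : seq chart :=
  let sp := const ((k0 + k1 - 1 + kinf) / 2%:R) in
  let sm := const ((k0 + k1 - 1 - kinf) / 2%:R) in
  blowup_sections vQ vt Pinf sp sm [:: vQ - 1] ++
  blowup_sections vS vT Pinf sp sm [:: vQ - 1].

(* The second centre beta_+ = k1 / t reads (P1 + 1) / a = k1 when q - 1 = a t. *)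
Definition charts_Q1 : seq chart :=
  blowup2_sections vq1 vt P1 0 0 (-1) (const k1 / vt) [:: vq; vt] ++
  blowup2_sections va vt P1 0 0 (-1) (const k1) [:: vq].

Definition charts_Ainf : seq chart :=
  blowup_sections vT vq P1 0 (-1) [:: vq; vq - 1] ++
  blowup_sections vr vq P1 0 (-1) [:: vq - 1] ++
  blowup_sections vs vQ P1 0 (-1) [:: vQ - 1].

(* Near the intersection of Q^1 and A_infinity: as in [blowup2_sections], then
   the blow-up of the strict transforms of the sections over T = 0, which only
   meet the charts (q - 1, T, gm) and (q - 1, T, gp), along T = gm = 0 and
   T = gp = 0. *)
Definition charts_Q1_Ainf : seq chart :=
  let bm := P1 / vq1 in let gm := bm / vq1 in
  let bp := (P1 + 1) / vq1 in let gp := (bp - const k1 * vT) / vq1 in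
  let um := [:: P1 + 1; vq] in let up := [:: P1; vq] in
  [:: ([tuple vq1 / P1; vT; P1], um);
      ([tuple vq1 / bm; vT; bm], um);
      ([tuple vq1 / (P1 + 1); vT; P1 + 1], up);
      ([tuple vq1 / (bp - const k1 * vT); vT; bp - const k1 * vT], up)]
  ++ blowup vT vq1 gm 0 um ++ blowup vT vq1 gp 0 up
  ++ infinity vq1 vT P1 0 (-1) [:: vq].

Definition charts_A0_B10 : seq chart :=
  [:: ([tuple vA; vq1; P10], [:: vq]); ([tuple vA; vq1; P10^-1], [:: vq])].

(* The compactified moduli space: its points are the local rings of the points
   of these charts, two points of different charts being identified when their
   local rings are equal. *)
Definition ConV : seq chart :=
  charts_Q0 ++ charts_Qinf ++ charts_Q1 ++ charts_Ainf ++ charts_Q1_Ainf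
  ++ charts_A0_B10.

Definition is_point (O : KV -> Prop) : Prop :=
  exists (c : chart) (x : 'I_3 -> C),
    [/\ c \in ConV, in_chart c x & O = local_ring c.1 x].

(* The tangent sheaf of the foliation is the intersection of the line KV * XV with
   the tangent sheaf of the threefold: the germ g XV belongs to it at O when it
   preserves O.  This is the saturated extension of the foliation of XV. *)
Definition tangent (O : KV -> Prop) (g : KV) : Prop :=
  forall f, O f -> O (g * XV f).

Definition tangent_generator (O : KV -> Prop) (g : KV) : Prop :=
  tangent O g /\
  forall g', tangent O g' -> exists h, O h /\ g' = h * g.

(* The zero set of sigma (here sigma = t or 1 / t, a local equation of a fibre
   of the projection) is invariant: at each of its points the ideal of its
   reduced structure is preserved by the foliation. *)
Definition invariant_zero_set (sigma : KV) : Prop :=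
  forall O, is_point O -> max_of O sigma ->
  forall g, tangent O g ->
  forall f, radical_of O sigma f -> radical_of O sigma (g * XV f).

(* E = {x = 0}, for coordinates (x,y,z) of the P^1-bundle, has function field
   C(y,z), the residue field of its local ring OE, which is not changed by
   strict transforms.  There is a first integral N(y,z) / M(y,z) of the
   restriction to E of the foliation -- a nonzero vector field on E -- all but
   finitely many level sets N = c M of which are irreducible curves of genus g.
   (N / M being nonconstant, this irreducibility makes N and M coprime.) *)
Definition pencil_of_genus (g : nat) (E : coords) : Prop :=
  let OE := surface_ring E in
  let yz := [tuple E`_1; E`_2] in
  (exists theta : KV,
    [/\ tangent_generator OE theta,
        forall f, max_of OE f -> max_of OE (theta * XV f),
        exists f, OE f /\ ~ max_of OE (theta * XV f)
      & exists N M : {mpoly C[2]},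
        [/\ M != 0,
            forall c : C, N != c *: M,
            max_of OE (theta * XV (eval yz N / eval yz M))
          & exists bad : seq C, forall c : C, c \notin bad ->
              irreducible_curve_of_genus g (N - c *: M)]]).

Definition pencil_of_conics := pencil_of_genus 0.
Definition pencil_of_genus_one_curves := pencil_of_genus 1.

End Kappa.

(* The surfaces are given over A_0, B^1_0 (where t = 0) and B^0_infinity,
   A_infinity, B^infinity_infinity (where t = infinity). *)
Definition surf_A0 : coords := [tuple vt; vq; P0].
Definition surf_B10 : coords := [tuple vq1; vA; P10].
Definition surf_B0inf : coords := [tuple vT; vR; P0].
Definition surf_Ainf : coords := [tuple vT; vq; P1].
Definition surf_Binfinf : coords := [tuple vT; vS; Pinf].

(* The sections blown up over Q^0, and those over Q^infinity, are distinct;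
   nothing else is needed from the genericity of the parameters. *)
Definition generic_parameters (k0 k1 kinf : C) : Prop :=
  k0 != 0 /\ kinf != 0.

End PainleveV.

(* Main.v *)
(** Near a point over t = 0 (or t = infinity) the local equation sigma of the
    fibre is a product of coordinates, and no component of the fibre is a
    component of the zeros of t X.  Hence if g X is regular, then so is g / t,
    and g X maps sigma to a multiple of itself.

    On the boundary surfaces the first integrals are limits of the Hamiltonian:
    t H, or t H - q (q - 1) p on B^1_0, over t = 0; H, or H / t on A_infinity,
    over t = infinity.  All their level sets are quadratic in the fibre
    coordinate z, hence are double covers w^2 = g(y), where g has two simple
    zeros on the projective line, or four on A_infinity.  With E the derivation
    such that E y = w, a form f dy is regular at finite distance iff f w is a
    polynomial in y and w, and the condition at y = infinity leaves f = 0 for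
    the conics, and f proportional to 1 / w for four zeros. *)

Require Import Defs.
From HB Require Import structures.
From mathcomp Require Import all_boot all_order all_algebra.
From mathcomp Require Import all_field fraction generic_quotient ring mpoly.

Set Implicit Arguments.
Unset Strict Implicit.
Unset Printing Implicit Defensive.

Import Order.TTheory GRing.Theory Num.Theory.
Local Open Scope ring_scope.
Local Open Scope quotient_scope.

(** Invariance is proved without computing the tangent sheaf and at singular points of the foliation
    as well. Since $X\sigma=\pm\sigma/t$, tangency makes $\sigma\cdot g/t$ regular, and the
    difficulty is to cancel $\sigma$. A coordinate $u_i$ dividing $\sigma$ cancels once some regular
    $a$ has $tXa$ not identically zero on $u_i=0$; a single point of the divisor decides this. On
    exceptional divisors the test function comes from the base: its speed is affine in the fibre
    coordinate, so only its value at the blown-up centre counts, namely $\pm\kappa_0$,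
    $\pm\kappa_\infty$ or $\pm1$. This is where invariance uses genericity.

    The genus quantifies over all places of the function field. Bounding the regular forms from
    above only takes the places centred at points of the two affine curves in $(y,w)$ and
    $(1/y,w/y^m)$, whose local rings must be shown to be valuation rings. Conversely $dy/w$ must be
    regular at an arbitrary place, which follows from a Bezout relation between $g$ and $g'$. *)

Local Notation "x %:F" := (tofrac x).

(** * Derivations of fraction fields *)

(* Stated over an abstract field, where [field] does not try to unfold the
   operations of a fraction field. *)
Fact quotient_rule_add (F : fieldType) (a a' b b' c c' e e' : F) :
  b != 0 -> e != 0 ->
  ((a' * e + a * e' + (c' * b + c * b')) * (b * e) -
     (a * e + c * b) * (b' * e + b * e')) / (b * e) ^+ 2 =
  (a' * b - a * b') / b ^+ 2 + (c' * e - c * e') / e ^+ 2.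
Proof. by move=> b0 e0; field; rewrite b0 e0. Qed.

Fact quotient_rule_mul (F : fieldType) (a a' b b' c c' e e' : F) :
  b != 0 -> e != 0 ->
  ((a' * c + a * c') * (b * e) - a * c * (b' * e + b * e')) / (b * e) ^+ 2 =
  (a' * b - a * b') / b ^+ 2 * (c / e) + a / b * ((c' * e - c * e') / e ^+ 2).
Proof. by move=> b0 e0; field; rewrite b0 e0. Qed.

Section FractionField.
Variable R : idomainType.
Implicit Types (a b : R) (x y : {fraction R}).

Lemma frac_numden x : x = (\n_(repr x))%:F / (\d_(repr x))%:F.
Proof.
have dn0 : (\d_(repr x))%:F != 0 :> {fraction R}.
  by rewrite tofrac_eq0 denom_ratioP.
apply: (canRL (mulfK dn0)).
suff h (r : {ratio R}) : \pi_(FracField.type R) r * (\d_r)%:F = (\n_r)%:F.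
  by rewrite -{1}[x]reprK h.
unlock FracField.tofrac; rewrite -[LHS]FracField.pi_mul; apply/eqmodP => /=.
by rewrite FracField.equivfE /FracField.mulf !numden_Ratio ?mulf_neq0
  ?oner_eq0 ?denom_ratioP //= !mulr1 mulrC.
Qed.
Lemma frac_exP x : exists a b, b != 0 /\ x = a%:F / b%:F.
Proof.
by exists \n_(repr x), \d_(repr x); rewrite -frac_numden denom_ratioP.
Qed.

Variable d : R -> R.
Hypothesis dD : forall a b, d (a + b) = d a + d b.
Hypothesis dM : forall a b, d (a * b) = d a * b + a * d b.

(** The same expression as [pder], so that the laws below apply to [pder] by conversion. *)
Definition fracder x : {fraction R} :=
  let n := \n_(repr x) in let m := \d_(repr x) in
  (d n * m - n * d m)%:F / m%:F ^+ 2.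

(** Independence of the representative: if $a/b=n/m$, the two quotient rules differ, after clearing
    denominators, by a combination of $am-nb=0$ and of its derivative. *)
Lemma fracderE a b : b != 0 ->
  fracder (a%:F / b%:F) = (d a * b - a * d b)%:F / b%:F ^+ 2.
Proof.
move=> b0; rewrite /fracder; set x := a%:F / b%:F.
have m0 : \d_(repr x) != 0 := denom_ratioP _.
have ex := frac_numden x.
have : a%:F / b%:F = (\n_(repr x))%:F / (\d_(repr x))%:F := ex.
move: (\n_(repr x)) (\d_(repr x)) m0 {ex} => n m m0 /eqP.
rewrite eqr_div ?tofrac_eq0 // -!tofracM tofrac_eq => /eqP e.
have ed := congr1 d e; rewrite !dM in ed.
apply/eqP; rewrite eqr_div ?expf_neq0 ?tofrac_eq0 // -!tofracXn -!tofracM.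
rewrite tofrac_eq eq_sym -subr_eq0; apply/eqP.
have -> : (d a * b - a * d b) * m ^+ 2 - (d n * m - n * d m) * b ^+ 2 =
  b * m * ((d a * m + a * d m) - (d n * b + n * d b))
  - (m * d b + b * d m) * (a * m - n * b) by ring.
by rewrite ed e !subrr !mulr0 subr0.
Qed.

Lemma fracder_tofrac a : fracder a%:F = (d a)%:F.
Proof.
have d1 : d 1 = 0.
  by have := dM 1 1; rewrite !mulr1 mul1r -{1}[d 1]addr0 => /addrI.
have e : a%:F = a%:F / 1%:F :> {fraction R} by rewrite tofrac1 divr1.
by rewrite {1}e fracderE ?oner_eq0 // d1 mulr0 subr0 mulr1 tofrac1 expr1n divr1.
Qed.

Lemma fracderD x y : fracder (x + y) = fracder x + fracder y.
Proof.
have [a [b [b0 ->]]] := frac_exP x; have [c [e [e0 ->]]] := frac_exP y.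
have bF : b%:F != 0 :> {fraction R} by rewrite tofrac_eq0.
have eF : e%:F != 0 :> {fraction R} by rewrite tofrac_eq0.
have -> : a%:F / b%:F + c%:F / e%:F = (a * e + c * b)%:F / (b * e)%:F.
  by rewrite addf_div // -!tofracM -tofracD.
rewrite !fracderE ?mulf_neq0 // !dD !dM.
rewrite !(tofracM, tofracB, tofracD).
exact: quotient_rule_add.
Qed.

Lemma fracderM x y : fracder (x * y) = fracder x * y + x * fracder y.
Proof.
have [a [b [b0 ->]]] := frac_exP x; have [c [e [e0 ->]]] := frac_exP y.
have bF : b%:F != 0 :> {fraction R} by rewrite tofrac_eq0.
have eF : e%:F != 0 :> {fraction R} by rewrite tofrac_eq0.
have -> : a%:F / b%:F * (c%:F / e%:F) = (a * c)%:F / (b * e)%:F.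
  by rewrite mulf_div -!tofracM.
rewrite !fracderE ?mulf_neq0 // !dM.
rewrite !(tofracM, tofracB, tofracD).
exact: quotient_rule_mul.
Qed.

End FractionField.

Section Derivation.
Variables (C L : fieldType) (iota : {rmorphism C -> L}) (D : L -> L).
Hypothesis hD : derivation iota D.

Lemma derD x y : D (x + y) = D x + D y. Proof. by case: hD. Qed.
Lemma derM x y : D (x * y) = D x * y + x * D y. Proof. by case: hD. Qed.
Lemma derC c : D (iota c) = 0. Proof. by case: hD. Qed.
Lemma der0 : D 0 = 0. Proof. by rewrite -{1}(rmorph0 iota) derC. Qed.
Lemma der1 : D 1 = 0. Proof. by rewrite -{1}(rmorph1 iota) derC. Qed.
Lemma derN x : D (- x) = - D x.
Proof. by apply/eqP; rewrite -addr_eq0 -derD addNr der0. Qed.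
Lemma derB x y : D (x - y) = D x - D y. Proof. by rewrite derD derN. Qed.
Lemma derX2 x : D (x ^+ 2) = 2%:R * x * D x.
Proof. by rewrite expr2 derM; ring. Qed.
Lemma derV x : D x^-1 = - D x / x ^+ 2.
Proof.
have [->|x0] := eqVneq x 0; first by rewrite invr0 der0 oppr0 mul0r.
have e : D x * x^-1 + x * D x^-1 = 0 by rewrite -derM divff // der1.
have -> : D x^-1 = x^-1 * (x * D x^-1) by rewrite mulKf.
by rewrite (_ : x * D x^-1 = - (D x * x^-1)); [field | apply/eqP; rewrite -addr_eq0 addrC e eqxx].
Qed.
Lemma derXn x n : D (x ^+ n) = n%:R * x ^+ n.-1 * D x.
Proof.
elim: n => [|[|n] IH]; first by rewrite expr0 der1; ring.
  by rewrite expr1 expr0; ring.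
by rewrite exprS derM IH /= [x ^+ n.+1]exprS -[n.+2%:R]natr1; ring.
Qed.

End Derivation.

Lemma derivation_scale (C L : fieldType) (iota : {rmorphism C -> L}) D u :
  derivation iota D -> derivation iota (fun x => u * D x).
Proof.
by move=> h; split=> [x y|x y|c]; rewrite ?(derD h) ?(derM h) ?(derC h); ring.
Qed.

Lemma derivation_add (C L : fieldType) (iota : {rmorphism C -> L}) D D' :
  derivation iota D -> derivation iota D' ->
  derivation iota (fun x => D x + D' x).
Proof.
move=> h h'; split=> [x y|x y|c];
 by rewrite ?(derD h) ?(derM h) ?(derC h) ?(derD h') ?(derM h') ?(derC h'); ring.
Qed.

Section KVField.
Variable C : numClosedFieldType.
Implicit Types (f g : KV C) (a b : {mpoly C[3]}).

HB.instance Definition _ :=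
  GRing.RMorphism.copy (@const C)
    ((@tofrac {mpoly C[3]}) \o (@mpolyC 3 C)).

Lemma pder_derivation i : derivation (@const C) (pder i).
Proof.
have dD a b : (a + b)^`M(inord i) = a^`M(inord i) + b^`M(inord i) by exact: mderivD.
have dM a b : (a * b)^`M(inord i) = a^`M(inord i) * b + a * b^`M(inord i) by exact: mderivM.
split=> [x y|x y|c].
- exact: (fracderD dD dM).
- exact: (fracderM dM).
- by have := fracder_tofrac dM c%:MP; rewrite mderivC tofrac0.
Qed.

Lemma pder_var i j : (i < 3)%N -> (j < 3)%N -> pder i (var C j) = (i == j)%:R.
Proof.
move=> hi hj.
have dM a b : (a * b)^`M(inord i) = a^`M(inord i) * b + a * b^`M(inord i) by exact: mderivM.
have -> : pder i (var C j) = (('X_(inord j : 'I_3))^`M(inord i))%:F.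
  exact: (fracder_tofrac dM).
rewrite mderivX mnm1E.
have -> : (inord j == inord i :> 'I_3) = (i == j).
  by rewrite eq_sym -val_eqE /= !inordK.
case: eqP => [->|_]; last by rewrite scale0r tofrac0.
by rewrite scale1r -[X in (X - _)%MM]add0m addmK mpolyX0 tofrac1.
Qed.

End KVField.

(** * Polynomials over the ground field *)

Section Polynomials.
Variables (C : numClosedFieldType) (n : nat).
Implicit Types (p q : {mpoly C[n]}).

Lemma mpoly_ring_ind (P : {mpoly C[n]} -> Prop) :
  (forall c, P c%:MP) -> (forall i, P 'X_i) ->
  (forall p q, P p -> P q -> P (p + q)) ->
  (forall p q, P p -> P q -> P (p * q)) -> forall p, P p.
Proof.
move=> hC hX hD hM; elim/mpolyind=> [|c m p _ _ hp]; first by rewrite -mpolyC0.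
apply: (hD) => //; rewrite -mul_mpolyC; apply: (hM) => //.
rewrite mpolyXE_id; elim/big_rec: _ => [|i q _ hq]; first by rewrite -mpolyC1.
apply: (hM) => //; elim: (m i) => [|k IH]; first by rewrite expr0 -mpolyC1.
by rewrite exprS; apply: hM.
Qed.

(* A nonzero polynomial of least degree in Z would have vanishing derivatives,
   hence be constant. *)
Lemma deriv_closed_eq0 (Z : {mpoly C[n]} -> Prop) :
  (forall p i, Z p -> Z p^`M(i)) -> (forall c, Z c%:MP -> c = 0) ->
  forall p, Z p -> p = 0.
Proof.
move=> hder hconst p; have [k] := ubnP (msize p); elim: k p => // k IH p hk Zp.
have [//|p0] := eqVneq p 0.
have [s e] : exists s, msize p = s.+1.
  by exists (msize p).-1; rewrite prednK // lt0n msize_poly_eq0.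
have der0 i : p^`M(i) = 0.
  apply: IH; last exact: hder.
  apply: leq_trans _ (hk : (msize p <= k)%N); rewrite e.
  rewrite ltnS [msize p^`M(i)]msizeE; apply/bigmax_leqP_seq => m hm _.
  have : (m + U_(i))%MM \in msupp p.
    rewrite mcoeff_msupp; apply: contraTneq hm => e0.
    by rewrite mcoeff_msupp mcoeff_deriv e0 mul0rn eqxx.
  by move/msize_mdeg_lt; rewrite mdegD mdeg1 addn1 e.
have ep : p = (p@_0)%:MP.
  apply/mpolyP=> m; rewrite mcoeffC.
  have [->|m0] := eqVneq m 0%MM; first by rewrite mulr1.
  have [i hi] : exists i, m i != 0%N.
    apply/existsP; apply: contraNT m0 => /existsPn h.
    by apply/eqP/mnmP=> i; rewrite mnm0E; apply/eqP; move: (h i); rewrite negbK.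
  have := congr1 (mcoeff (m - U_(i))%MM) (der0 i).
  rewrite mcoeff_deriv mcoeff0 submK ?lep1mP // => /eqP.
  by rewrite mulrn_eq0 /= mulr0 => /eqP.
by rewrite ep (hconst (p@_0)) ?mpolyC0 // -ep.
Qed.

(** The nonconstant polynomial $Xp-1$ has a root $x$, and $x\,p(x)=1$. *)
Lemma poly_nonroot (p : {poly C}) : p != 0 -> exists x, p.[x] != 0.
Proof.
move=> p0; have sz : (1 < size ('X * p - 1)%R)%N.
  by rewrite mulrC size_polyDl ?size_polyN ?size_poly1 ?size_mulX //; rewrite ?ltnS ?size_poly_gt0.
have [|x] := closed_rootP ('X * p - 1) _; first by rewrite neq_ltn sz orbT.
rewrite /root !hornerE subr_eq0 => /eqP e; exists x.
by apply: contra_eqN e => /eqP->; rewrite mulr0 eq_sym oner_eq0.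
Qed.

Definition mline (x y : 'I_n -> C) p : {poly C} :=
  mmap (@polyC C) (fun i => (x i)%:P + (y i - x i) *: 'X) p.

Lemma horner_mline x y p s :
  (mline x y p).[s] = p.@[fun i => x i + (y i - x i) * s].
Proof.
rewrite /mline; elim/mpoly_ring_ind: p => [c|i|p q ep eq|p q ep eq].
- by rewrite mmapC mevalC hornerC.
- by rewrite mmapX mmap1U mevalXU !hornerE.
- by rewrite mmapD mevalD hornerD ep eq.
- by rewrite rmorphM mevalM hornerM ep eq.
Qed.

(* Restrict to the line joining the two points. *)
Lemma common_nonvanishing (i : 'I_n) (x y : 'I_n -> C) p q :
  x i = 0 -> y i = 0 -> p.@[x] != 0 -> q.@[y] != 0 ->
  exists z, z i = 0 /\ (p * q).@[z] != 0.
Proof.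
move=> xi yi hp hq.
have [|s] := @poly_nonroot (mline x y p * mline x y q).
  rewrite mulf_neq0 //.
    apply: contraNneq hp => e; have := horner_mline x y p 0.
    rewrite e horner0 => e0; rewrite {1}e0; apply/eqP/meval_eq=> j.
    by rewrite mulr0 addr0.
  apply: contraNneq hq => e; have := horner_mline x y q 1.
  rewrite e horner0 => e0; rewrite {1}e0; apply/eqP/meval_eq=> j.
  by rewrite mulr1 addrC subrK.
rewrite hornerM !horner_mline -mevalM => h.
exists (fun j => x j + (y j - x j) * s); split => //.
by rewrite xi yi subrr mul0r addr0.
Qed.

(** Vanishing everywhere is stable under $\partial_i$: on a line directed by the $i$-th axis,
    $\partial_i p$ restricts to the derivative of the restriction of $p$, which is zero as a
    univariate polynomial. *)
Lemma meval_eq0 p : (forall x, p.@[x] = 0) -> p = 0.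
Proof.
apply: (deriv_closed_eq0 (Z := fun p => forall x, p.@[x] = 0)) => {p}; last first.
  by move=> c /(_ (fun _ => 0)); rewrite mevalC.
move=> p i hp x; pose l := fun q => mline x (fun j => x j + (j == i)%:R) q.
have lder q : (l q)^`() = l q^`M(i).
  rewrite /l /mline; elim/mpoly_ring_ind: q => [c|j|q r eq er|q r eq er].
  - by rewrite mderivC mmap0 mmapC derivC.
  - rewrite mmapX mmap1U derivD derivC derivZ derivX add0r mderivX mnm1E.
    rewrite [_ + _ - _]addrAC subrr add0r.
    case: eqP => [->|_]; last by rewrite !scale0r mmap0.
    by rewrite -[X in (X - _)%MM]add0m addmK mpolyX0 !scale1r rmorph1.
  - by rewrite mmapD mderivD mmapD derivD eq er.
  - by rewrite mderivM mmapD !rmorphM derivM eq er.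
have l0 : l p = 0.
  apply/eqP; apply: contraT => /poly_nonroot [s].
  by rewrite horner_mline hp eqxx.
have := horner_mline x (fun j => x j + (j == i)%:R) p^`M(i) 0.
rewrite -/(l _) -lder l0 derivC horner0 => e; rewrite [RHS]e.
by apply/meval_eq => j; rewrite mulr0 addr0.
Qed.

(** Modulo ['X_i] every polynomial equals its substitution at ['X_i = 0], and here this substitution
    vanishes everywhere. *)
Lemma dvdX_vanish (i : 'I_n) p :
  (forall x, x i = 0 -> p.@[x] = 0) -> exists q, p = 'X_i * q.
Proof.
pose s : n.-tuple {mpoly C[n]} := [tuple if j == i then 0 else 'X_j | j < n].
have hs q : exists r, q = 'X_i * r + (q \mPo s).
  elim/mpoly_ring_ind: q => [c|j|q q' [r er] [r' er']|q q' [r er] [r' er']].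
  - by exists 0; rewrite mulr0 add0r comp_mpolyC.
  - rewrite comp_mpolyXU -tnth_nth tnth_mktuple; case: eqP => [->|_].
      by exists 1; rewrite mulr1 addr0.
    by exists 0; rewrite mulr0 add0r.
  - by exists (r + r'); rewrite comp_mpolyD {1}er {1}er'; ring.
  - exists (r * q' + (q \mPo s) * r').
    by rewrite rmorphM /= {1}er {2}er' {1}er'; ring.
move=> hp; have [q e] := hs p; exists q.
suff h : p \mPo s = 0 by rewrite {1}e h addr0.
apply: meval_eq0 => x; rewrite comp_mpoly_meval; apply: hp.
by rewrite tnth_mktuple eqxx meval0.
Qed.

End Polynomials.

(** * Coordinate systems and local rings *)

Definition o0 : 'I_3 := @Ordinal 3 0 isT.
Definition o1 : 'I_3 := @Ordinal 3 1 isT.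
Definition o2 : 'I_3 := @Ordinal 3 2 isT.

Section Jacobian.
Variables (C L : fieldType) (iota : {rmorphism C -> L}) (D0 D1 D2 : L -> L).
Hypotheses (h0 : derivation iota D0) (h1 : derivation iota D1)
           (h2 : derivation iota D2).

(** Its nonvanishing serves as the criterion of algebraic independence, and it is easily followed
    through blow-ups. *)
Definition jacobian (x y z : L) : L :=
  D0 x * (D1 y * D2 z - D1 z * D2 y) - D0 y * (D1 x * D2 z - D1 z * D2 x)
  + D0 z * (D1 x * D2 y - D1 y * D2 x).

Lemma jacobian_swap x y z : jacobian y x z = - jacobian x y z.
Proof. by rewrite /jacobian; ring. Qed.

Lemma jacobian_neq_const x y z c : jacobian x y z != 0 -> z - iota c != 0.
Proof.
apply: contraNneq => /subr0_eq->.
by rewrite /jacobian (derC h0) (derC h1) (derC h2); apply/eqP; ring.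
Qed.

Lemma jacobian_neq0 x y z : jacobian x y z != 0 -> x != 0.
Proof.
apply: contraNneq => ->; rewrite /jacobian (der0 h0) (der0 h1) (der0 h2).
by apply/eqP; ring.
Qed.

Lemma jacobian_shift x y z c : jacobian x y (z - iota c * y) = jacobian x y z.
Proof.
rewrite /jacobian !(derB h0, derB h1, derB h2) !(derM h0, derM h1, derM h2).
by rewrite !(derC h0, derC h1, derC h2); ring.
Qed.

Lemma jacobian_sub x y z c : jacobian x y (z - iota c) = jacobian x y z.
Proof.
rewrite /jacobian !(derB h0, derB h1, derB h2).
by rewrite !(derC h0, derC h1, derC h2); ring.
Qed.

Lemma jacobian_divr x y z : x != 0 -> jacobian x y (z / x) = jacobian x y z / x.
Proof.
move=> x0; rewrite /jacobian !(derM h0, derM h1, derM h2).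
by rewrite (derV h0) (derV h1) (derV h2); field.
Qed.

Lemma jacobian_divl x y z : z != 0 -> jacobian (x / z) y z = jacobian x y z / z.
Proof.
move=> z0; rewrite /jacobian !(derM h0, derM h1, derM h2).
by rewrite (derV h0) (derV h1) (derV h2); field.
Qed.

Lemma jacobian_inv x y z : z != 0 ->
  jacobian x y z^-1 = - jacobian x y z / z ^+ 2.
Proof.
move=> z0; rewrite /jacobian (derV h0) (derV h1) (derV h2).
by field.
Qed.

Lemma jacobian_blowup x y z c :
  jacobian x y z != 0 -> jacobian x y ((z - iota c) / x) != 0.
Proof.
move=> J; have x0 := jacobian_neq0 J.
by rewrite jacobian_divr // jacobian_sub mulf_neq0 ?invr_neq0.
Qed.

Lemma jacobian_blowup_exc x y z c :
  jacobian x y z != 0 -> jacobian (x / (z - iota c)) y (z - iota c) != 0.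
Proof.
move=> J; have z0 := jacobian_neq_const c J.
by rewrite jacobian_divl // jacobian_sub mulf_neq0 ?invr_neq0.
Qed.

Lemma jacobian_inv_neq0 x y z : jacobian x y z != 0 -> jacobian x y z^-1 != 0.
Proof.
move=> J; have z0 := jacobian_neq_const 0 J; rewrite rmorph0 subr0 in z0.
by rewrite jacobian_inv // mulf_neq0 ?oppr_eq0 ?invr_neq0 ?expf_neq0.
Qed.

Lemma jacobian_elim x y z e0 e1 e2 : jacobian x y z != 0 ->
  e0 * D0 x + e1 * D0 y + e2 * D0 z = 0 ->
  e0 * D1 x + e1 * D1 y + e2 * D1 z = 0 ->
  e0 * D2 x + e1 * D2 y + e2 * D2 z = 0 -> [/\ e0 = 0, e1 = 0 & e2 = 0].
Proof.
move=> J E0 E1 E2.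
have cramer e a b c : e * jacobian x y z =
    a * (e0 * D0 x + e1 * D0 y + e2 * D0 z)
    + b * (e0 * D1 x + e1 * D1 y + e2 * D1 z)
    + c * (e0 * D2 x + e1 * D2 y + e2 * D2 z) -> e = 0.
  by rewrite E0 E1 E2 !mulr0 !addr0 => /eqP; rewrite mulf_eq0 (negbTE J) orbF => /eqP.
split.
- apply: (cramer _ (D1 y * D2 z - D1 z * D2 y) (D0 z * D2 y - D0 y * D2 z)
    (D0 y * D1 z - D0 z * D1 y)); rewrite /jacobian; ring.
- apply: (cramer _ (D1 z * D2 x - D1 x * D2 z) (D0 x * D2 z - D0 z * D2 x)
    (D0 z * D1 x - D0 x * D1 z)); rewrite /jacobian; ring.
- apply: (cramer _ (D1 x * D2 y - D1 y * D2 x) (D0 y * D2 x - D0 x * D2 y)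
    (D0 x * D1 y - D0 y * D1 x)); rewrite /jacobian; ring.
Qed.

End Jacobian.

Section Coordinates.
Variable C : numClosedFieldType.
Implicit Types (f g : KV C) (a b : {mpoly C[3]}) (u : coords C).

Section Eval.
Variables (n : nat) (u : n.-tuple (KV C)).
Lemma evalC c : eval u c%:MP = const c. Proof. exact: mmapC. Qed.
Lemma eval0 : eval u 0 = 0. Proof. exact: mmap0. Qed.
Lemma eval1 : eval u 1 = 1. Proof. exact: rmorph1. Qed.
Lemma evalX i : eval u 'X_i = tnth u i.
Proof. by rewrite /eval mmapX mmap1U. Qed.
Lemma evalD (a b : {mpoly C[n]}) : eval u (a + b) = eval u a + eval u b.
Proof. exact: mmapD. Qed.
Lemma evalN (a : {mpoly C[n]}) : eval u (- a) = - eval u a.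
Proof. exact: mmapN. Qed.
Lemma evalM (a b : {mpoly C[n]}) : eval u (a * b) = eval u a * eval u b.
Proof. exact: rmorphM. Qed.

Lemma derivation_eval D (a : {mpoly C[n]}) : derivation (@const C) D ->
  D (eval u a) = \sum_i eval u a^`M(i) * D (tnth u i).
Proof.
move=> h; elim/mpoly_ring_ind: a => [c|i|a b ea eb|a b ea eb].
- by rewrite evalC (derC h) big1 // => i _; rewrite mderivC eval0 mul0r.
- rewrite evalX (bigD1 i) //= big1 ?addr0 => [|j ji].
    rewrite mderivX mnm1E eqxx scale1r -[X in (X - _)%MM]add0m addmK mpolyX0.
    by rewrite eval1 mul1r.
  by rewrite mderivX mnm1E eq_sym (negbTE ji) scale0r eval0 mul0r.
- rewrite evalD (derD h) ea eb -big_split; apply: eq_bigr => i _ /=.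
  by rewrite mderivD evalD mulrDl.
- rewrite evalM (derM h) ea eb mulr_suml mulr_sumr -big_split.
  apply: eq_bigr => i _ /=; rewrite mderivM evalD !evalM mulrDl.
  by rewrite [_ * D _ * _]mulrAC mulrA.
Qed.
End Eval.

Definition jac f g h := jacobian (@pder C 0) (pder 1) (pder 2) f g h.
Definition jac_of u := jac (tnth u o0) (tnth u o1) (tnth u o2).

Lemma tnth3_0 (x y z : KV C) : tnth [tuple x; y; z] o0 = x. Proof. by []. Qed.
Lemma tnth3_1 (x y z : KV C) : tnth [tuple x; y; z] o1 = y. Proof. by []. Qed.
Lemma tnth3_2 (x y z : KV C) : tnth [tuple x; y; z] o2 = z. Proof. by []. Qed.
Definition tnth3 := (tnth3_0, tnth3_1, tnth3_2).

Section JacKV.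
Variables x y z : KV C.
Let pd0 := pder_derivation C 0.
Let pd1 := pder_derivation C 1.
Let pd2 := pder_derivation C 2.
Lemma jac_tuple : jac_of [tuple x; y; z] = jac x y z.
Proof. by rewrite /jac_of !tnth3. Qed.
Lemma jac_swap : jac y x z = - jac x y z.
Proof. exact: jacobian_swap. Qed.
Lemma jac_neq_const c : jac x y z != 0 -> z - const c != 0.
Proof. exact: (jacobian_neq_const pd0 pd1 pd2). Qed.
Lemma jac_neq0l : jac x y z != 0 -> x != 0.
Proof. exact: (jacobian_neq0 pd0 pd1 pd2). Qed.
Lemma jac_shift c : jac x y (z - const c * y) = jac x y z.
Proof. exact: (jacobian_shift pd0 pd1 pd2). Qed.
Lemma jac_blowup c : jac x y z != 0 -> jac x y ((z - const c) / x) != 0.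
Proof. exact: (jacobian_blowup pd0 pd1 pd2). Qed.
Lemma jac_blowup_exc c :
  jac x y z != 0 -> jac (x / (z - const c)) y (z - const c) != 0.
Proof. exact: (jacobian_blowup_exc pd0 pd1 pd2). Qed.
Lemma jac_inv_neq0 : jac x y z != 0 -> jac x y z^-1 != 0.
Proof. exact: (jacobian_inv_neq0 pd0 pd1 pd2). Qed.
End JacKV.

(** Applying the three partial derivatives to $a(u)=0$ gives a linear system of determinant
    [jac_of u] for the values $(\partial_i a)(u)$. The relations are thus stable under derivation,
    and a constant relation is zero. *)
Lemma eval_inj0 u a : jac_of u != 0 -> eval u a = 0 -> a = 0.
Proof.
move=> J; apply: (@deriv_closed_eq0 _ _ (fun a => eval u a = 0)); last first.
  by move=> c; rewrite evalC => /eqP; rewrite fmorph_eq0 => /eqP.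
move=> {}a i e.
have E k : eval u a^`M(o0) * pder k (tnth u o0) +
    eval u a^`M(o1) * pder k (tnth u o1) +
    eval u a^`M(o2) * pder k (tnth u o2) = 0.
  have hk := pder_derivation C k.
  have := derivation_eval u a hk; rewrite e (der0 hk) !big_ord_recl big_ord0 addr0.
  rewrite addrA => /esym.
  by congr (eval u a^`M(_) * pder k (tnth u _) +
    eval u a^`M(_) * pder k (tnth u _) + eval u a^`M(_) * pder k (tnth u _) = _);
   apply: val_inj.
have [e0 e1 e2] := jacobian_elim J (E 0%N) (E 1%N) (E 2).
case: i => [[|[|[|//]]] hi].
- by rewrite (_ : Ordinal hi = o0) //; apply: val_inj.
- by rewrite (_ : Ordinal hi = o1) //; apply: val_inj.
- by rewrite (_ : Ordinal hi = o2) //; apply: val_inj.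
Qed.

Lemma eval_eq u a b : jac_of u != 0 -> eval u a = eval u b -> a = b.
Proof.
move=> J e; apply: subr0_eq; apply: (eval_inj0 J).
by rewrite evalD evalN e subrr.
Qed.

Lemma eval_neq0 u a : jac_of u != 0 -> a != 0 -> eval u a != 0.
Proof. by move=> J; apply: contra_neq; apply: eval_inj0. Qed.

(** The value is attached to a polynomial representative, so that it can be computed by following
    the expression of [f]. *)
Definition polyval u (x : 'I_3 -> C) f (v : C) :=
  exists a, f = eval u a /\ a.@[x] = v.

Section Val.
Variables (u : coords C) (x : 'I_3 -> C).
Local Notation polyval := (polyval u x).
Lemma polyval_const c : polyval (const c) c.
Proof. by exists c%:MP; rewrite evalC mevalC. Qed.
Lemma polyval_coord i : polyval (tnth u i) (x i).
Proof. by exists 'X_i; rewrite evalX mevalXU. Qed.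
Lemma polyval_add f g v w : polyval f v -> polyval g w -> polyval (f + g) (v + w).
Proof.
by case=> a [-> <-] [b [-> <-]]; exists (a + b); rewrite evalD mevalD.
Qed.
Lemma polyval_mul f g v w : polyval f v -> polyval g w -> polyval (f * g) (v * w).
Proof.
by case=> a [-> <-] [b [-> <-]]; exists (a * b); rewrite evalM mevalM.
Qed.
Lemma polyval_opp f v : polyval f v -> polyval (- f) (- v).
Proof. by case=> a [-> <-]; exists (- a); rewrite evalN mevalN. Qed.
Lemma polyval_nat n : polyval n%:R n%:R.
Proof. by rewrite -(rmorph_nat (@const C)); apply: polyval_const. Qed.
Lemma polyval_eq f v v' : polyval f v -> v = v' -> polyval f v'.
Proof. by move=> h <-. Qed.
Lemma polyval_1 : polyval 1 1. Proof. exact: (polyval_nat 1). Qed.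
Lemma polyval_exp f v n : polyval f v -> polyval (f ^+ n) (v ^+ n).
Proof.
move=> h; elim: n => [|n IH]; last by rewrite !exprS; apply: polyval_mul.
by rewrite !expr0; apply: (polyval_nat 1).
Qed.
End Val.

(** Covers both the local ring of a point, with [S] nonvanishing at that point, and that of a
    surface, with [S] not vanishing identically on it. *)
Definition loc u (S : {mpoly C[3]} -> Prop) f :=
  exists a b, S b /\ f = eval u a / eval u b.

Section Localization.
Variables (u : coords C) (S : {mpoly C[3]} -> Prop).
Hypotheses (J : jac_of u != 0) (S1 : S 1).
Hypotheses (SM : forall a b, S a -> S b -> S (a * b)) (S0 : ~ S 0).

Lemma denominator_neq0 b : S b -> eval u b != 0.
Proof. by move=> h; apply: eval_neq0 => //; apply/eqP => b0; rewrite b0 in h. Qed.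

Lemma loc_eval a : loc u S (eval u a).
Proof. by exists a, 1; rewrite eval1 divr1. Qed.
Lemma loc_coord i : loc u S (tnth u i).
Proof. by rewrite -evalX; apply: loc_eval. Qed.
Lemma loc_const c : loc u S (const c).
Proof. by rewrite -(evalC u); apply: loc_eval. Qed.
Lemma locD f g : loc u S f -> loc u S g -> loc u S (f + g).
Proof.
case=> a [b [Sb ->]] [c [d [Sd ->]]].
exists (a * d + c * b), (b * d); split; first exact: SM.
by rewrite addf_div ?denominator_neq0 // evalD !evalM.
Qed.
Lemma locM f g : loc u S f -> loc u S g -> loc u S (f * g).
Proof.
case=> a [b [Sb ->]] [c [d [Sd ->]]].
exists (a * c), (b * d); split; first exact: SM.
by rewrite mulf_div !evalM.
Qed.
Lemma locN f : loc u S f -> loc u S (- f).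
Proof.
by case=> a [b [Sb ->]]; exists (- a), b; rewrite evalN mulNr.
Qed.
Lemma loc_inv b : S b -> loc u S (eval u b)^-1.
Proof. by move=> Sb; exists 1, b; rewrite eval1 div1r. Qed.
Lemma loc1 : loc u S 1. Proof. by rewrite -(eval1 u); apply: loc_eval. Qed.
Lemma locX f n : loc u S f -> loc u S (f ^+ n).
Proof.
move=> hf; elim: n => [|n IH]; first by rewrite expr0; apply: loc1.
by rewrite exprS; apply: locM.
Qed.

Lemma loc_derivation D : derivation (@const C) D ->
  (forall i, loc u S (D (tnth u i))) -> forall f, loc u S f -> loc u S (D f).
Proof.
move=> h hD.
have hev a : loc u S (D (eval u a)).
  rewrite derivation_eval //; elim/big_rec: _ => [|i f _ hf].
    by rewrite -(eval0 u); apply: loc_eval.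
  by apply: locD => //; apply: locM => //; apply: loc_eval.
move=> f [a [b [Sb ->]]]; rewrite (derM h) (derV h).
have hb := loc_inv Sb; apply: locD; first exact: locM.
rewrite -exprVn; apply: locM; first exact: loc_eval.
by apply: locM; [exact: locN | exact: locX].
Qed.

End Localization.

Lemma local_mul (x : 'I_3 -> C) a b : a.@[x] != 0 -> b.@[x] != 0 -> (a * b).@[x] != 0.
Proof. by rewrite mevalM mulf_eq0 => /negbTE-> /negbTE->. Qed.
Lemma local_1 (x : 'I_3 -> C) : (1 : {mpoly C[3]}).@[x] != 0.
Proof. by rewrite meval1 oner_eq0. Qed.
Lemma local_0 (x : 'I_3 -> C) : ~ ((0 : {mpoly C[3]}).@[x] != 0).
Proof. by rewrite meval0 eqxx. Qed.

(* The hyperplane u_i = 0 does not divide A, so it divides the numerator of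
   u_i f. *)
Lemma local_divide u x y i f h (A B : {mpoly C[3]}) : jac_of u != 0 ->
  local_ring u x (tnth u i * f) -> y i = 0 -> A.@[y] != 0 ->
  local_ring u x h -> f * eval u A = h * eval u B -> local_ring u x f.
Proof.
move=> J [n [d [dx e]]] yi Ay [m [k [kx eh]]] E.
have ui0 : tnth u i != 0.
  rewrite -evalX eval_neq0 //; apply/eqP => X0.
  have := congr1 (meval (fun _ => 1)) X0; rewrite mevalXU meval0.
  by move/eqP; rewrite oner_eq0.
have d0 : eval u d != 0 := denominator_neq0 (S := fun b => b.@[x] != 0) J (@local_0 x) dx.
have k0 : eval u k != 0 := denominator_neq0 (S := fun b => b.@[x] != 0) J (@local_0 x) kx.
(* Away from the hyperplane the coordinate is a unit and can simply be moved to the denominator. *)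
have [xi|xi] := eqVneq (x i) 0; last first.
  exists n, ('X_i * d); split; first by rewrite mevalM mevalXU mulf_neq0.
  by rewrite evalM evalX invfM mulrCA -e mulrA mulVf // mul1r.
have E' : n * A * k = 'X_i * (m * B * d).
  apply: (eval_eq J); rewrite !evalM evalX.
  have -> : eval u n = tnth u i * f * eval u d by rewrite e divfK.
  have -> : eval u m = h * eval u k by rewrite eh divfK.
  transitivity (tnth u i * (f * eval u A) * (eval u d * eval u k)).
    by rewrite !mulrA; congr (_ * _); rewrite -!mulrA; congr (_ * (_ * _)); rewrite mulrC.
  rewrite E -!mulrA; congr (_ * (_ * _)).
  by rewrite [RHS]mulrCA; congr (_ * _); rewrite mulrC.
have [q eq] : exists q, n = 'X_i * q.
  apply: dvdX_vanish => z zi; apply/eqP; apply: contraT => nz.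
  (* A point of the hyperplane where [n], [A] and [k] are all nonzero contradicts [E'], whose
     right-hand side vanishes there. *)
  have [z' [zi' h1]] := common_nonvanishing zi yi nz Ay.
  have [z'' [zi'' h2]] := common_nonvanishing zi' xi h1 kx.
  by move: h2; rewrite E' mevalM mevalXU zi'' mul0r eqxx.
exists q, d; split => //.
by apply: (mulfI ui0); rewrite e eq evalM evalX mulrA.
Qed.

End Coordinates.

(* Purely syntactic: unifying two fractions is far too expensive. *)
Ltac polyval_compute :=
  lazymatch goal with
  | |- polyval _ _ (_ + _) _ => eapply polyval_add; polyval_compute
  | |- polyval _ _ (- _) _ => eapply polyval_opp; polyval_compute
  | |- polyval _ _ (_ * _) _ => eapply polyval_mul; polyval_compute
  | |- polyval _ _ (_ ^+ _) _ => eapply polyval_exp; polyval_compute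
  | |- polyval _ _ (const _) _ => eapply polyval_const
  | |- polyval _ _ 1 _ => eapply polyval_1
  | |- polyval _ _ (_%:R) _ => eapply polyval_nat
  | |- polyval _ _ ?f _ =>
      match goal with h : polyval _ _ f _ |- _ => exact h end
  end.

(** * The vector field in the coordinates of the charts *)

Section HamiltonianIdentities.
Variables (C L : fieldType) (iota : {rmorphism C -> L}).
Variables (t q p : L) (k0 k1 r : C).
Hypotheses (t0 : t != 0) (q0 : q != 0) (q1 : q - 1 != 0).

Definition hamiltonian : L :=
  (q * (q - 1) ^+ 2 * p ^+ 2
   - (iota k0 * (q - 1) ^+ 2 + iota (k1 - 1) * q * (q - 1) - t * q) * p
   + iota r * (q - 1)) / t.

Definition Hp : L :=
  (2%:R * q * (q - 1) ^+ 2 * p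
   - (iota k0 * (q - 1) ^+ 2 + iota (k1 - 1) * q * (q - 1) - t * q)) / t.
Definition Hq : L :=
  ((q - 1) * (3%:R * q - 1) * p ^+ 2
   - (2%:R * iota k0 * (q - 1) + iota (k1 - 1) * (2%:R * q - 1) - t) * p
   + iota r) / t.

Section Partial.
Variables (D : L -> L) (hD : derivation iota D).
Hypothesis (Dt : D t = 0).

Lemma der_hamiltonian : D hamiltonian = Hp * D p + Hq * D q.
Proof.
rewrite /hamiltonian /Hp /Hq !(derM hD, derV hD, derD hD, derN hD, derX2 hD).
rewrite !(derC hD) Dt (der1 hD).
by field.
Qed.
End Partial.

Variables (X : L -> L) (hX : derivation iota X).
Hypotheses (Xt : X t = 1) (Xq : X q = Hp) (Xp : X p = - Hq).

Local Notation T := (t^-1).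
Local Notation Q := (q^-1).
Local Notation phat := (- p * q * (q - 1) ^+ 2).
Local Notation P0 := (- phat / (q - 1) ^+ 2).
Local Notation P1 := (- phat / (q * t)).
Local Notation P10 := (- phat / (q - 1)).
Local Notation R := (q / T).
Local Notation S := (Q / T).
Local Notation A := (t / (q - 1)).
Local Notation c0 := (iota k0).
Local Notation c1 := (iota (k1 - 1)).

Ltac X_field :=
  rewrite ?(derM hX, derV hX, derD hX, derB hX, derN hX, derX2 hX);
  rewrite ?Xq ?Xt ?Xp ?(derC hX) ?(der1 hX) ?(der0 hX) /Hp /Hq;
  by field; rewrite ?t0 ?q0 ?q1 ?oner_eq0.

Lemma X_q_P0 : t * X q =
  2%:R * (q - 1) ^+ 2 * P0 - (c0 * (q - 1) ^+ 2 + c1 * q * (q - 1) - t * q).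
Proof. X_field. Qed.

Lemma X_R : T * (t * X R) = R * T - c0 * (R * T - 1) ^+ 2
  - c1 * (R * T) * (R * T - 1) + R + 2%:R * (R * T - 1) ^+ 2 * P0.
Proof. X_field. Qed.

Lemma X_Q : t * X Q = c0 * (1 - Q) ^+ 2 + c1 * (1 - Q) - t * Q
  - 2%:R * (1 - Q) ^+ 2 * P0.
Proof. X_field. Qed.

Lemma X_S : T * (t * X S) = S * T + c0 * (1 - S * T) ^+ 2 + c1 * (1 - S * T) - S
  - 2%:R * (1 - S * T) ^+ 2 * P0.
Proof. X_field. Qed.

Lemma X_a : t * X A^-1 = - A^-1 + (1 + A^-1 * t) - c0 * t * A^-1 ^+ 2
  - c1 * (1 + A^-1 * t) * A^-1 + 2%:R * (1 + A^-1 * t) * P1.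
Proof. X_field. Qed.

Lemma X_q_P1 : T * (t * X q) =
  q - T * (c0 * (q - 1) ^+ 2 + c1 * q * (q - 1)) + 2%:R * q * P1.
Proof. X_field. Qed.

Lemma X_r : q * (t * X R^-1) = - R^-1 * q - 1
  + R^-1 * (c0 * (q - 1) ^+ 2 + c1 * q * (q - 1)) - 2%:R * P1.
Proof. X_field. Qed.

Lemma X_s : Q * (t * X S^-1) = - S^-1 * Q + 1
  - S^-1 * (c0 * (1 - Q) ^+ 2 + c1 * (1 - Q)) + 2%:R * P1.
Proof. X_field. Qed.

Lemma X_A : t * X A = A * (1 + c0 * (q - 1) + c1 * q - A * q - 2%:R * P10).
Proof. X_field. Qed.

Lemma X_q1 : t * X (q - 1) =
  (q - 1) * (2%:R * P10 - c0 * (q - 1) - c1 * q + A * q).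
Proof. X_field. Qed.

Local Notation k := (iota k1).
Local Notation r' := (iota r).

Lemma X_P0 : t * X P0 = (- (q ^+ 2 - 1) * P0 ^+ 2
  + (c0 * (q ^+ 2 - 1) + c1 * q ^+ 2) * P0 - r' * q ^+ 2) / q.
Proof. X_field. Qed.

(** The function is $tH-tqp$ written with $P^0=qp$: only a term vanishing on $t=0$ has been dropped
    from $tH$. *)
Lemma X_integral_A0 :
  t * X (((q - 1) * (q - 1) * P0 ^+ 2
    + (- ((q - 1) * (c0 * (q - 1) + c1 * q))) * P0 + r' * q * (q - 1)) / q) =
  t * (((q ^+ 2 - 1) * P0 ^+ 2
    - (c0 * (q ^+ 2 - 1) + c1 * q ^+ 2) * P0 + r' * q ^+ 2) / q).
Proof. X_field. Qed.

Lemma X_P10 : t * X P10 = (A * P10 * q + (q - 1) *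
  (P10 ^+ 2 + c0 * P10 - r' * q ^+ 2 + A * P10 * q)) / q.
Proof. X_field. Qed.

(** Why $tH$ must be corrected: $tX(tH)=tqp=A P^1_0$ does not vanish on $q=1$, but by [X_P10] the
    function $P^1_0=q(q-1)p$ has the same derivative there. *)
Lemma X_integral_B10 :
  t * X ((1 * P10 ^+ 2 + (A - k) * P10 + 0) / 1) =
  (q - 1) * (((2%:R * P10 + A - k) *
    (P10 ^+ 2 + c0 * P10 - r' * q ^+ 2 + A * P10 * q)
    + P10 * A * (c0 + c1 - A) * q) / q).
Proof. X_field. Qed.

Lemma X_T : X T = T * - T.
Proof. X_field. Qed.

(** The factor 1 is the multiplier [theta] of the criterion for pencils: over $t=\infty$ the field
    $X$ itself restricts to a nonzero field, while over $t=0$ the multiplier is $t$. *)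
Lemma X_R' : 1 * X R = R * T - c0 * (R * T - 1) ^+ 2
  - c1 * (R * T) * (R * T - 1) + R + 2%:R * (R * T - 1) ^+ 2 * P0.
Proof. X_field. Qed.

Lemma X_P0_R : 1 * X P0 = (- ((R * T) ^+ 2 - 1) * P0 ^+ 2
  + (c0 * ((R * T) ^+ 2 - 1) + c1 * (R * T) ^+ 2) * P0 - r' * (R * T) ^+ 2) / R.
Proof. X_field. Qed.

Lemma X_integral_B0inf :
  1 * X ((1 * P0 ^+ 2 + (R - c0) * P0 + 0) / R) =
  T * ((R * T * (- P0 ^+ 2 + (c0 + c1) * P0 - r') * (2%:R * P0 - c0 + R)
    - (1 - c0 * (R * T - 2%:R) - c1 * (R * T - 1)
       + 2%:R * (R * T - 2%:R) * P0) * (P0 ^+ 2 - c0 * P0)) / R).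
Proof. X_field. Qed.

Lemma X_S' : 1 * X S = S * T + c0 * (1 - S * T) ^+ 2 + c1 * (1 - S * T) - S
  - 2%:R * (1 - S * T) ^+ 2 * P0.
Proof. X_field. Qed.

Lemma X_P0_S : 1 * X P0 = (- (1 - (S * T) ^+ 2) * P0 ^+ 2
  + (c0 * (1 - (S * T) ^+ 2) + c1) * P0 - r') / S.
Proof. X_field. Qed.

Lemma X_integral_Binf :
  1 * X ((1 * P0 ^+ 2 + (S - (c0 + c1)) * P0 + r') / S) =
  T * ((S * T * (P0 ^+ 2 - c0 * P0) * (2%:R * P0 - (c0 + c1) + S)
    - (1 + c0 * (S * T - 2%:R) - c1 - 2%:R * (S * T - 2%:R) * P0)
      * (P0 ^+ 2 - (c0 + c1) * P0 + r')) / S).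
Proof. X_field. Qed.

Lemma X_q_P1' : 1 * X q =
  q - T * (c0 * (q - 1) ^+ 2 + c1 * q * (q - 1)) + 2%:R * q * P1.
Proof. X_field. Qed.

Lemma X_P1 : 1 * X P1 = ((q + 1) * (P1 ^+ 2 + P1) - (q - 1) * T * k * P1
  - r' * T ^+ 2 * (q - 1) ^+ 3) / (q - 1).
Proof. X_field. Qed.

(** Here $p=tP^1/(q-1)^2$ has order $t$, hence so has $H$; in the limit of $H/t$ only $q(q-1)^2p^2$
    and $tqp$ survive. *)
Lemma X_integral_Ainf :
  1 * X ((q * P1 ^+ 2 + q * P1 + 0) / ((q - 1) * (q - 1))) =
  T * (((P1 ^+ 2 + P1) * (q + 1) * (c0 * (q - 1) + c1 * q)
    - q * (2%:R * P1 + 1) * (k * P1 + r' * T * (q - 1) ^+ 2)) /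
       ((q - 1) * (q - 1))).
Proof. X_field. Qed.

End HamiltonianIdentities.

Fact cancel_t (F : fieldType) (s g t b z : F) :
  t != 0 -> s * (g / t) * (b * (t * z)) = g * z * (s * b).
Proof. by move=> t0; field. Qed.

Fact monomial_iter (F : fieldType) (x y : F) (e e' : bool) :
  x ^+ e * y ^+ e' = iter e ( *%R x) 1 * iter e' ( *%R y) 1.
Proof. by case: e; case: e' => /=; ring. Qed.

Fact exc_monomial (F : fieldType) (x y w : F) (e e' : bool) : w != 0 ->
  x ^+ e * y ^+ e' =
  iter e ( *%R (x / w)) 1 * (iter e ( *%R w) 1 * iter e' ( *%R y) 1).
Proof. by move=> w0; case: e; case: e' => /=; field. Qed.

Section VectorField.
Variables (C : numClosedFieldType) (k0 k1 kinf : C).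
Local Notation K := (KV C).
Local Notation t := (vt C).
Local Notation q := (vq C).
Local Notation p := (vp C).
Local Notation X := (XV k0 k1 kinf).
Local Notation c0 := (const k0).
Local Notation c1 := (const (k1 - 1)).
Implicit Types (g : K) (u : coords C).

Lemma var_neq0 i : (i < 3)%N -> var C i != 0.
Proof.
move=> hi; apply/eqP=> e; have := pder_var C hi hi.
by rewrite e (der0 (pder_derivation C i)) eqxx => /esym/eqP; rewrite oner_eq0.
Qed.
Lemma vt_neq0 : t != 0. Proof. exact: var_neq0. Qed.
Lemma vq_neq0 : q != 0. Proof. exact: var_neq0. Qed.
Lemma vq1_neq0 : q - 1 != 0.
Proof.
apply/eqP=> /subr0_eq e; have := pder_var C (isT : 1 < 3)%N (isT : 1 < 3)%N.
rewrite -/q e (der1 (pder_derivation C 1)) => /esym/eqP; by rewrite oner_eq0.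
Qed.

Local Notation Hp := (Hp (@const C) t q p k0 k1).
Local Notation Hq := (Hq (@const C) t q p k0 k1 (rho k0 k1 kinf)).

Lemma pder2_HV : pder 2 (HV k0 k1 kinf) = Hp.
Proof.
rewrite (der_hamiltonian _ _ _ _ _ vt_neq0 (pder_derivation C 2)) ?pder_var //.
by rewrite mulr1 mulr0 addr0.
Qed.

Lemma pder1_HV : pder 1 (HV k0 k1 kinf) = Hq.
Proof.
rewrite (der_hamiltonian _ _ _ _ _ vt_neq0 (pder_derivation C 1)) ?pder_var //.
by rewrite mulr1 mulr0 add0r.
Qed.

Lemma XV_derivation : derivation (@const C) X.
Proof.
have h2 := derivation_scale (pder 2 (HV k0 k1 kinf)) (pder_derivation C 1).
have h3 := derivation_scale (- pder 1 (HV k0 k1 kinf)) (pder_derivation C 2).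
have := derivation_add (derivation_add (pder_derivation C 0) h2) h3.
case=> hD hM hC; rewrite /XV; split=> [x y|x y|c].
- by have := hD x y; rewrite !mulNr.
- by have := hM x y; rewrite !mulNr.
- by have := hC c; rewrite !mulNr.
Qed.

Lemma XV_t : X t = 1.
Proof. by rewrite /XV !pder_var // !mulr0 subr0 addr0. Qed.
Lemma XV_q : X q = Hp.
Proof. by rewrite /XV !pder_var // pder2_HV mulr0 mulr1 subr0 add0r. Qed.
Lemma XV_p : X p = - Hq.
Proof. by rewrite /XV !pder_var // pder1_HV mulr0 mulr1 addr0 sub0r. Qed.

(** [B] clears the denominators of $tXa$ and may vanish on the divisor: what is excluded is a zero
    of $tXa$ along it, and a pole does no harm. *)
Definition transverse u (i : 'I_3) : Prop :=
  exists (y : 'I_3 -> C) (a A B : {mpoly C[3]}),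
  [/\ y i = 0, A.@[y] != 0 & eval u A = eval u B * (t * X (eval u a))].

(** [S] lists the components of the fibre visible in the chart, exceptional divisors included. *)
Definition good (sigma : K) u : Prop :=
  jac_of u != 0 /\ exists S : seq 'I_3,
  sigma = \prod_(i <- S) tnth u i /\ forall i, i \in S -> transverse u i.

(* t X f has no zero along u_i = 0 for a suitable regular f, so that g / t
   cannot have a pole there. *)
Lemma tangent_divisible sigma u x g : good sigma u ->
  tangent k0 k1 kinf (local_ring u x) g ->
  local_ring u x (sigma * (g / t)) -> local_ring u x (g / t).
Proof.
case=> J [S [-> hS]] hg; elim: S hS => [|i S IH] hS.
  by rewrite big_nil mul1r.
rewrite big_cons -mulrA => h; apply: IH => [j jS|].
  by apply: hS; rewrite inE jS orbT.
have [y [a [A [B [yi Ay e]]]]] := hS i (mem_head _ _).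
have ha : local_ring u x (g * X (eval u a)).
  by apply: hg; apply: (@loc_eval _ u (fun b => b.@[x] != 0)); apply: local_1.
apply: (local_divide J h yi Ay (B := (\prod_(j <- S) 'X_j) * B)).
  exact: ha.
rewrite evalM e.
have -> : eval u (\prod_(j <- S) 'X_j) = \prod_(j <- S) tnth u j.
  elim: (S) => [|j S' IH']; first by rewrite !big_nil eval1.
  by rewrite !big_cons evalM evalX IH'.
exact: cancel_t vt_neq0.
Qed.

(* The vector field moves the function phi of x and y transversally to
   x = 0, y = y0 as soon as alpha + beta z does not vanish. *)
Definition base x y z y0 a0 b0 : Prop := exists phi B alpha beta : K,
  B * (t * X phi) = alpha + beta * z /\
  forall u w, polyval u w x 0 -> polyval u w y y0 ->
  [/\ exists v, polyval u w phi v, exists v, polyval u w B v, polyval u w alpha a0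
    & polyval u w beta b0].

Definition pt (y0 : C) (i : 'I_3) : C := if i == o1 then y0 else 0.

Lemma base_transverse x y z y0 a0 b0 z0 u i : base x y z y0 a0 b0 ->
  polyval u (pt y0) x 0 -> polyval u (pt y0) y y0 -> polyval u (pt y0) z z0 ->
  a0 + b0 * z0 != 0 -> pt y0 i = 0 -> transverse u i.
Proof.
case=> phi [B [al [be [e h]]]] hx hy hz n0 hi.
have [[v [a [ea _]]] [v' [b [eb _]]] hal hbe] := h u (pt y0) hx hy.
have [A [eA vA]] := polyval_add hal (polyval_mul hbe hz).
by exists (pt y0), a, A, b; rewrite vA -eA -ea -eb.
Qed.

(** Multiplying by $z^{-1}$ turns $\alpha+\beta z$ into $\alpha z^{-1}+\beta$, so that only $\beta$
    is left on the section at infinity. *)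
Lemma base_transverse_inf x y z y0 a0 b0 u i : base x y z y0 a0 b0 ->
  polyval u (pt y0) x 0 -> polyval u (pt y0) y y0 -> polyval u (pt y0) z^-1 0 -> z != 0 ->
  b0 != 0 -> pt y0 i = 0 -> transverse u i.
Proof.
case=> phi [B [al [be [e h]]]] hx hy hz z0 n0 hi.
have [[v [a [ea _]]] hB hal hbe] := h u (pt y0) hx hy.
case: hB => v' hB; have [b [eb _]] := polyval_mul hz hB.
have [A [eA vA]] := polyval_add (polyval_mul hz hal) hbe.
exists (pt y0), a, A, b; rewrite vA -eA -ea -eb mul0r add0r; split=> //.
by rewrite -mulrA e mulrDr; congr (_ + _); rewrite mulrCA mulVf ?mulr1.
Qed.

Lemma base_swap x y z a0 b0 : base x y z 0 a0 b0 -> base y x z 0 a0 b0.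
Proof.
case=> phi [B [al [be [e h]]]]; exists phi, B, al, be; split=> // u w hx hy.
exact: h.
Qed.

Lemma base_shift x y z a0 b0 (c : C) :
  base x y z 0 a0 b0 -> base x y (z - const c * y) 0 a0 b0.
Proof.
case=> phi [B [al [be [e h]]]].
exists phi, B, (al + be * (const c * y)), be; split.
  by rewrite e -addrA -mulrDr [const c * y + _]addrC subrK.
move=> u w hx hy; have [h1 h2 h3 h4] := h u w hx hy; split=> //.
have := polyval_add h3 (polyval_mul h4 (polyval_mul (polyval_const u w c) hy)).
by rewrite !mulr0 addr0.
Qed.

(** Substituting $z=f_0+xz'$ puts the new fibre coordinate in the term $\beta xz'$, which vanishes
    on $x=0$: the speed becomes the constant $a_0+b_0f_0$, and further blow-ups leave it
    unchanged. *)
Lemma base_blowup x y z y0 a0 b0 (f0 : C) : x != 0 -> base x y z y0 a0 b0 ->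
  base x y ((z - const f0) / x) y0 (a0 + b0 * f0) 0.
Proof.
move=> x0 [phi [B [al [be [e h]]]]].
exists phi, B, (al + be * const f0), (be * x); split.
  rewrite e -addrA -mulrA -mulrDr; congr (_ + _ * _).
  by rewrite [x * _]mulrC divfK // addrC subrK.
move=> u w hx hy; have [h1 h2 h3 h4] := h u w hx hy; split=> //.
  exact: polyval_add h3 (polyval_mul h4 (polyval_const u w f0)).
by have := polyval_mul h4 hx; rewrite mulr0.
Qed.

Section BlowUp.
Variables (sigma x y z : K) (y0 a0 b0 : C) (e e' : bool).
Hypotheses (hb : base x y z y0 a0 b0) (J : jac x y z != 0).
Hypotheses (hsigma : sigma = x ^+ e * y ^+ e') (hy0 : e' -> y0 = 0).

Let S0 : seq 'I_3 := nseq e o0 ++ nseq e' o1.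

(** In this chart $x=\frac{x}{z-f_0}\cdot(z-f_0)$: if $x$ divides [sigma], the exceptional divisor,
    given by the third coordinate, is a further component of the fibre. *)
Lemma good_blowup_exc f0 : a0 + b0 * f0 != 0 ->
  good sigma [tuple x / (z - const f0); y; z - const f0].
Proof.
move=> n0; set u := [tuple _; _; _].
have zf : z - const f0 != 0 := jac_neq_const f0 J.
split.
  by rewrite jac_tuple; apply: jac_blowup_exc.
have u0 := polyval_coord u (pt y0) o0; have u2 := polyval_coord u (pt y0) o2.
exists (nseq e o0 ++ nseq e o2 ++ nseq e' o1); split.
  rewrite !big_cat !big_nseq hsigma !tnth3; exact: exc_monomial.
move=> i hi; apply: (base_transverse hb (z0 := f0)) => //.
- have -> : x = tnth u o0 * tnth u o2 by rewrite !tnth3 divfK.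
  by have := polyval_mul u0 u2; rewrite mulr0.
- exact: (polyval_coord u (pt y0) o1).
- have -> : z = tnth u o2 + const f0 by rewrite !tnth3 subrK.
  by have := polyval_add u2 (polyval_const u (pt y0) f0); rewrite add0r.
- move: hi; rewrite !mem_cat !mem_nseq /pt; case: (i =P o1) => // -> /=.
  by rewrite !andbF /= andbT; case: (e') hy0 => // ->.
Qed.

Lemma good_blowup f0 us c : a0 + b0 * f0 != 0 ->
  c \in blowup x y z (const f0) us -> good sigma c.1.
Proof.
move=> n0; rewrite !inE => /orP [] /eqP-> /=; last exact: good_blowup_exc.
set u := [tuple _; _; _].
have x0 : x != 0 := jac_neq0l J.
split.
  by rewrite jac_tuple; apply: jac_blowup.
have u0 := polyval_coord u (pt y0) o0; have u2 := polyval_coord u (pt y0) o2.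
exists S0; split.
  rewrite !big_cat !big_nseq hsigma !tnth3; exact: monomial_iter.
move=> i hi; apply: (base_transverse hb (z0 := f0)) => //.
- exact: (polyval_coord u (pt y0) o1).
- have -> : z = const f0 + tnth u o0 * tnth u o2.
    by rewrite !tnth3 mulrC divfK // addrC subrK.
  by have := polyval_add (polyval_const u (pt y0) f0) (polyval_mul u0 u2); rewrite mulr0 addr0.
- move: hi; rewrite !mem_cat !mem_nseq /pt; case: (i =P o1) => // -> /=.
  by rewrite !andbF /= andbT; case: (e') hy0 => // ->.
Qed.

Lemma good_infinity f1 f2 us c : b0 != 0 ->
  c \in infinity x y z f1 f2 us -> good sigma c.1.
Proof.
move=> n0; rewrite !inE => /eqP-> /=; set u := [tuple _; _; _].
have z0 : z != 0.
  have := jac_neq_const 0 J.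
  by rewrite rmorph0 subr0.
split.
  by rewrite jac_tuple; apply: jac_inv_neq0.
exists S0; split.
  rewrite !big_cat !big_nseq hsigma !tnth3; exact: monomial_iter.
move=> i hi; apply: (base_transverse_inf hb) => //.
- exact: (polyval_coord u (pt y0) o0).
- exact: (polyval_coord u (pt y0) o1).
- exact: (polyval_coord u (pt y0) o2).
- move: hi; rewrite !mem_cat !mem_nseq /pt; case: (i =P o1) => // -> /=.
  by rewrite !andbF /= andbT; case: (e') hy0 => // ->.
Qed.

Lemma good_blowup_sections g1 g2 f1 f2 us c :
  g1 = const f1 -> g2 = const f2 ->
  a0 + b0 * f1 != 0 -> a0 + b0 * f2 != 0 -> b0 != 0 ->
  c \in blowup_sections x y z g1 g2 us -> good sigma c.1.
Proof.
move=> -> -> n1 n2 nb; rewrite !mem_cat => /or3P [].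
- exact: good_blowup.
- exact: good_blowup.
- exact: good_infinity.
Qed.

End BlowUp.

Lemma good_blowup2 sigma x y z y0 a0 b0 (e e' : bool) g g' f f' us c :
  base x y z y0 a0 b0 -> jac x y z != 0 -> sigma = x ^+ e * y ^+ e' ->
  (e' -> y0 = 0) -> g = const f -> g' = const f' -> a0 + b0 * f != 0 ->
  c \in blowup2 x y z g g' us -> good sigma c.1.
Proof.
move=> hb J hs hy -> -> n0; rewrite inE => /orP [/eqP->|].
  exact: (good_blowup_exc hb J hs hy n0).
have x0 : x != 0 := jac_neq0l J.
apply: (good_blowup (base_blowup f x0 hb) _ hs hy); last by rewrite mul0r addr0.
exact: jac_blowup.
Qed.

End VectorField.

(** * Jacobian determinants of the charts *)

Section ChartJacobians.
Variables (C L : fieldType) (iota : {rmorphism C -> L}) (D0 D1 D2 : L -> L).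
Hypotheses (h0 : derivation iota D0) (h1 : derivation iota D1)
           (h2 : derivation iota D2).
Variables t q p : L.
Hypotheses (t0 : t != 0) (q0 : q != 0) (q1 : q - 1 != 0).
Hypotheses (D0t : D0 t = 1) (D0q : D0 q = 0) (D0p : D0 p = 0).
Hypotheses (D1t : D1 t = 0) (D1q : D1 q = 1) (D1p : D1 p = 0).
Hypotheses (D2t : D2 t = 0) (D2q : D2 q = 0) (D2p : D2 p = 1).

Local Notation T := (t^-1).
Local Notation Q := (q^-1).
Local Notation phat := (- p * q * (q - 1) ^+ 2).
Local Notation P0 := (- phat / (q - 1) ^+ 2).
Local Notation P1 := (- phat / (q * t)).
Local Notation P10 := (- phat / (q - 1)).
Local Notation R := (q / T).
Local Notation S := (Q / T).
Local Notation A := (t / (q - 1)).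
Local Notation J := (jacobian D0 D1 D2).

Ltac jac_compute e :=
  rewrite (_ : J _ _ _ = e); [by rewrite ?(oppr_eq0, mulf_neq0, invr_neq0, expf_neq0) |
  rewrite /jacobian ?(derM h0, derV h0, derB h0, derN h0, derX2 h0, der1 h0);
  rewrite ?(derM h1, derV h1, derB h1, derN h1, derX2 h1, der1 h1);
  rewrite ?(derM h2, derV h2, derB h2, derN h2, derX2 h2, der1 h2);
  rewrite ?D0t ?D0q ?D0p ?D1t ?D1q ?D1p ?D2t ?D2q ?D2p;
  by field; rewrite ?t0 ?q0 ?q1 ?oner_eq0].

Lemma jac_q_t : J q t P0 != 0. Proof. jac_compute (- q). Qed.
Lemma jac_R_T : J R T P0 != 0. Proof. jac_compute (q / t). Qed.
Lemma jac_Q_t : J Q t P0 != 0. Proof. jac_compute (q^-1). Qed.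
Lemma jac_S_T : J S T P0 != 0. Proof. jac_compute (- (t^-1 * q^-1)). Qed.
Lemma jac_a_t : J A^-1 t P1 != 0. Proof. jac_compute (- ((q - 1) ^+ 2 / t ^+ 2)). Qed.
Lemma jac_T_q : J T q P1 != 0. Proof. jac_compute (- ((q - 1) ^+ 2 / t ^+ 3)). Qed.
Lemma jac_r_q : J R^-1 q P1 != 0.
Proof. jac_compute (- ((q - 1) ^+ 2 / t ^+ 3 / q)). Qed.
Lemma jac_s_Q : J S^-1 Q P1 != 0. Proof. jac_compute ((q - 1) ^+ 2 / t ^+ 3 / q). Qed.
Lemma jac_A_q1 : J A (q - 1) P10 != 0. Proof. jac_compute q. Qed.

End ChartJacobians.

(* If the ideal (s) is stable under D, then so is its radical: differentiating
   f^(n-k) (D f)^(2k) in (s) trades one factor f for two factors D f. *)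
Lemma radical_derivation (C L : fieldType) (iota : {rmorphism C -> L})
    (O : L -> Prop) (D : L -> L) s e f :
  (forall n : nat, (n.+1%:R : C) != 0) ->
  (forall c, O (iota c)) -> (forall x y, O x -> O y -> O (x + y)) ->
  (forall x y, O x -> O y -> O (x * y)) ->
  derivation iota D -> (forall x, O x -> O (D x)) ->
  D s = e * s -> O s -> O e -> radical_of O s f -> radical_of O s (D f).
Proof.
move=> char0 OC OA OM hD OD Ds Os Oe [Of [n [h [Oh eh]]]].
have ON x : O x -> O (- x).
  by move=> Ox; rewrite -mulN1r; apply: OM => //; rewrite -(rmorphN1 iota); apply: OC.
have OX x m : O x -> O (x ^+ m).
  move=> Ox; elim: m => [|m IH]; first by rewrite expr0 -(rmorph1 iota); apply: OC.
  by rewrite exprS; apply: OM.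
have On m : O m%:R by rewrite -(rmorph_nat iota); apply: OC.
have ODf := OD f Of; have ODDf := OD _ ODf.
split => //; exists (2 * n)%N.
suff H k : (k <= n)%N -> exists h', O h' /\ f ^+ (n - k) * D f ^+ (2 * k) = s * h'.
  have [h' [Oh' e']] := H n (leqnn n); exists h'; split=> //.
  by rewrite -e' subnn expr0 mul1r.
elim: k => [_|k IH lt_kn].
  by exists h; split=> //; rewrite subn0 muln0 expr0 mulr1.
have [h' [Oh' e']] := IH (ltnW lt_kn).
have [m em] : exists m, (n - k)%N = m.+1.
  by exists (n - k).-1; rewrite prednK // subn_gt0.
have -> : (n - k.+1)%N = m by rewrite subnS em.
rewrite em in e'.
have m0 : (iota m.+1%:R) != 0 by rewrite fmorph_eq0.
(* Multiplying the derived relation by [D f] turns its unwanted term into a multiple of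
   $f^{m+1}(Df)^{2k}$, which lies in $(s)$ by [e']; hence two factors [D f] for each factor [f]. *)
have e2 := congr1 (fun x => D x * D f) e'.
move: e2; rewrite /= !(derM hD) Ds !(derXn hD) [m.+1.-1]/=.
rewrite -(rmorph_nat iota m.+1) exprS => e2.
(* For $k=0$ the truncated exponent [(2 * k).-1] is harmless, its coefficient being zero. *)
have hk : (2 * k)%:R * D f ^+ (2 * k).-1 * D f = (2 * k)%:R * D f ^+ (2 * k).
  case: (k) => [|k']; first by rewrite muln0 !mul0r.
  by rewrite mulnS add2n /= -mulrA -exprSr.
exists ((iota m.+1%:R)^-1 *
  ((e * h' + D h') * D f - (2 * k)%:R * h' * D (D f))); split.
  apply: (OM); first by rewrite -fmorphV; apply: OC.
  apply: (OA); last by apply: (ON); apply: (OM) => //; apply: (OM).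
  by apply: (OM) => //; apply: (OA); [apply: (OM) | apply: (OD)].
rewrite mulnS add2n exprS exprS; rewrite exprS in e'.
move: (D f) (D (D f)) (D h') ((2 * k)%:R) (f ^+ m) (iota _) m0 (D f ^+ (2 * k)) (D f ^+ (2 * k).-1) e' e2 hk.
move=> b b' h1 N F M M0 B B' e1 e2 hk; apply: (mulfI M0).
have -> : M * (F * (b * (b * B))) =
  (M * F * b * B + f * F * (N * B' * b')) * b - f * F * b' * (N * B' * b - N * B)
  - N * b' * (f * F * B) by ring.
by rewrite e2 hk e1 subrr mulr0 subr0; field.
Qed.

Fact fiber_at_infinity (F : fieldType) (x y z k k' y' x' : F) : y * z = 1 ->
  x * (2%:R + y * (- k * x - k' * x' + y' * x')) =
  y * (x * (2%:R * z - k * x - k' * x' + y' * x')).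
Proof.
move=> e; have e2 : 2%:R = 2%:R * (y * z) :> F by rewrite e mulr1.
by rewrite {1}e2; ring.
Qed.

Fact fiber_at_infinity' (F : fieldType) (x y z k k' y' x' : F) : y * z = 1 ->
  y' * (y * (1 + k * x + k' * x' - y' * x') - 2%:R) =
  y * (y' * (1 + k * x + k' * x' - y' * x' - 2%:R * z)).
Proof.
move=> e; have e2 : 2%:R = 2%:R * (y * z) :> F by rewrite e mulr1.
by rewrite {1}e2; ring.
Qed.

(** * Transversality in the charts of the threefold *)

Section Charts.
Variables (C : numClosedFieldType) (k0 k1 kinf : C).
Hypothesis hgen : generic_parameters k0 k1 kinf.
Local Notation K := (KV C).
Local Notation t := (vt C).
Local Notation q := (vq C).
Local Notation p := (vp C).
Local Notation X := (XV k0 k1 kinf).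
Local Notation c0 := (const k0).
Local Notation c1 := (const (k1 - 1)).
Local Notation base := (base k0 k1 kinf).
Local Notation good := (good k0 k1 kinf).

Let hX := XV_derivation k0 k1 kinf.
Let Xt := XV_t k0 k1 kinf.
Let Xq := XV_q k0 k1 kinf.
Let Xp := XV_p k0 k1 kinf.
Let t0 := vt_neq0 C.
Let q0 := vq_neq0 C.
Let q1 := vq1_neq0 C.

Ltac base_by phi B al be :=
  exists phi, B, al, be; split; [ |
    move=> u w hx hy; split; [eexists; polyval_compute | eexists; polyval_compute
      | eapply polyval_eq; [polyval_compute | ring]
      | eapply polyval_eq; [polyval_compute | ring]]].

Local Notation R := (vR C).
Local Notation T := (vT C).
Local Notation Q := (vQ C).
Local Notation S := (vS C).
Local Notation A := (vA C).
Local Notation a := (va C).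
Local Notation r := (vr C).
Local Notation s := (vs C).
Local Notation P1 := (P1 C).
Local Notation P0 := (P0 C).
Local Notation P10 := (P10 C).
Local Notation two := (2%:R : K).

Lemma base_q_t : base q t P0 0 (- k0) 2%:R.
Proof.
base_by (q : K) (1 : K) (- (c0 * (q - 1) ^+ 2 + c1 * q * (q - 1) - t * q))
  (two * (q - 1) ^+ 2).
by rewrite mul1r addrC; apply: (X_q_P0 t0 q1 Xq).
Qed.

Lemma base_R_T : base R T P0 0 (- k0) 2%:R.
Proof.
base_by (R : K) (T : K) (R * T - c0 * (R * T - 1) ^+ 2 - c1 * (R * T) * (R * T - 1) + R)
  (two * (R * T - 1) ^+ 2).
exact: (X_R t0 q1 hX Xt Xq).
Qed.

Lemma base_Q_t : base Q t (Pinf C) 0 (k0 + (k1 - 1)) (- 2%:R).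
Proof.
base_by (Q : K) (1 : K) (c0 * (1 - Q) ^+ 2 + c1 * (1 - Q) - t * Q)
  (- (two * (1 - Q) ^+ 2)).
by rewrite mul1r mulNr; apply: (X_Q t0 q0 q1 hX Xq).
Qed.

Lemma base_S_T : base S T (Pinf C) 0 (k0 + (k1 - 1)) (- 2%:R).
Proof.
base_by (S : K) (T : K) (S * T + c0 * (1 - S * T) ^+ 2 + c1 * (1 - S * T) - S)
  (- (two * (1 - S * T) ^+ 2)).
by rewrite mulNr; apply: (X_S t0 q0 q1 hX Xt Xq).
Qed.

Lemma base_a_t : base a t P1 0 1 2%:R.
Proof.
base_by (a : K) (1 : K) (- a + (1 + a * t) - c0 * t * a ^+ 2 - c1 * (1 + a * t) * a)
  (two * (1 + a * t)).
by rewrite mul1r; apply: (X_a t0 q0 q1 hX Xt Xq).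
Qed.

Lemma base_T_q : base T q P1 1 1 2%:R.
Proof.
base_by (q : K) (T : K) (q - T * (c0 * (q - 1) ^+ 2 + c1 * q * (q - 1))) (two * q).
exact: (X_q_P1 t0 q0 Xq).
Qed.

Lemma base_q1_T : base (vq1 C) T P1 0 1 2%:R.
Proof.
have eq : q = 1 + vq1 C by rewrite addrC subrK.
exists (q : K), (T : K), (1 + vq1 C - T * (c0 * vq1 C ^+ 2 + c1 * (1 + vq1 C) * vq1 C)),
  (two * (1 + vq1 C)); split.
  by rewrite -eq; apply: (X_q_P1 t0 q0 Xq).
move=> u w hx hy; split.
- by rewrite eq; eexists; polyval_compute.
- by eexists; polyval_compute.
- by eapply polyval_eq; [polyval_compute | ring].
- by eapply polyval_eq; [polyval_compute | ring].
Qed.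

Lemma base_r_q : base r q P1 0 (- 1) (- 2%:R).
Proof.
base_by (r : K) (q : K) (- r * q - 1 + r * (c0 * (q - 1) ^+ 2 + c1 * q * (q - 1))) (- two).
by rewrite [X in _ = _ + X]mulNr; apply: (X_r t0 q0 hX Xt Xq).
Qed.

Lemma base_s_Q : base s Q P1 0 1 2%:R.
Proof.
base_by (s : K) (Q : K) (- s * Q + 1 - s * (c0 * (1 - Q) ^+ 2 + c1 * (1 - Q))) (two : K).
exact: (X_s t0 q0 hX Xt Xq).
Qed.

Let pd0 := pder_derivation C 0.
Let pd1 := pder_derivation C 1.
Let pd2 := pder_derivation C 2.
Ltac chart_jac lem :=
  apply: (@lem _ _ _ _ _ _ pd0 pd1 pd2 t q p) => //; exact: pder_var.

Lemma jacV_q_t : jac q t P0 != 0. Proof. chart_jac jac_q_t. Qed.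
Lemma jacV_R_T : jac R T P0 != 0. Proof. chart_jac jac_R_T. Qed.
Lemma jacV_Q_t : jac Q t (Pinf C) != 0. Proof. chart_jac jac_Q_t. Qed.
Lemma jacV_S_T : jac S T (Pinf C) != 0. Proof. chart_jac jac_S_T. Qed.
Lemma jacV_a_t : jac a t P1 != 0. Proof. chart_jac jac_a_t. Qed.
Lemma jacV_T_q : jac T q P1 != 0. Proof. chart_jac jac_T_q. Qed.
Lemma jacV_r_q : jac r q P1 != 0. Proof. chart_jac jac_r_q. Qed.
Lemma jacV_s_Q : jac s Q P1 != 0. Proof. chart_jac jac_s_Q. Qed.
Lemma jacV_A_q1 : jac A (vq1 C) P10 != 0. Proof. chart_jac jac_A_q1. Qed.

Lemma jacV_q1_T : jac (vq1 C) T P1 != 0.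
Proof.
rewrite jac_swap oppr_eq0.
have -> : jac T (vq1 C) P1 = jac T q P1.
  have e i : pder i (vq1 C) = pder i q.
    by rewrite (derB (pder_derivation C i)) (der1 (pder_derivation C i)) subr0.
  by rewrite /jac /jacobian !e.
exact: jacV_T_q.
Qed.

Lemma two_neq0 : (2%:R : C) != 0. Proof. by rewrite pnatr_eq0. Qed.

Lemma transverse_of (u : coords C) (w : 'I_3 -> C) i f v B v' (e : K) v'' :
  w i = 0 -> polyval u w f v -> polyval u w B v' -> polyval u w e v'' ->
  v'' != 0 -> e = B * (t * X f) -> transverse k0 k1 kinf u i.
Proof.
move=> wi [b [-> _]] [b' [-> _]] [d [-> <-]] n0 E.
by exists w, b, d, b'.
Qed.

Definition pt3 (x y z : C) (i : 'I_3) : C :=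
  if i == o0 then x else if i == o1 then y else z.

Lemma vq_vq1 : q = 1 + vq1 C. Proof. by rewrite addrC subrK. Qed.

Lemma good_A_q1 : good t [tuple A; vq1 C; P10].
Proof.
set u := [tuple _; _; _]; split; first by rewrite jac_tuple jacV_A_q1.
exists [:: o0; o1]; split.
  by rewrite !big_cons big_nil !tnth3 mulr1 divfK.
have eA : t * X A = A * (1 + c0 * vq1 C + c1 * q - A * q - two * P10) :=
  X_A t0 q1 hX Xt Xq.
have eq : t * X (vq1 C) = vq1 C * (two * P10 - c0 * vq1 C - c1 * q + A * q) :=
  X_q1 t0 q1 hX Xq.
move=> i; rewrite !inE => /orP [] /eqP->.
  (* On $A=0$ the test function is $q-1$. Its speed at $q-1=1$ is $2P^1_0-\kappa_0-2(\kappa_1-1)$,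
     and $P^1_0$ is chosen to make it 1. *)
  pose w := pt3 0 1 ((k0 + 2%:R * (k1 - 1) + 1) / 2%:R).
  have h0 : polyval u w A 0 := polyval_coord u w o0.
  have h1 : polyval u w (vq1 C) 1 := polyval_coord u w o1.
  have h2 : polyval u w P10 ((k0 + 2%:R * (k1 - 1) + 1) / 2%:R) := polyval_coord u w o2.
  apply: (@transverse_of u w _ (vq1 C) 1 1 1 (vq1 C * (two * P10 - c0 * vq1 C - c1 * (1 + vq1 C) + A * (1 + vq1 C))) 1) => //.
  - exact: polyval_1.
  - eapply polyval_eq; [polyval_compute | by field].
  - exact: oner_neq0.
  - by rewrite mul1r -vq_vq1; symmetry; apply: eq.
(* On $q=1$ the test function is $A$. Its speed at $A=1$ is $\kappa_1-1-2P^1_0$, again made equal to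
   1. *)
pose w := pt3 1 0 ((k1 - 2%:R) / 2%:R).
have h0 : polyval u w A 1 := polyval_coord u w o0.
have h1 : polyval u w (vq1 C) 0 := polyval_coord u w o1.
have h2 : polyval u w P10 ((k1 - 2%:R) / 2%:R) := polyval_coord u w o2.
apply: (@transverse_of u w _ A 1 1 1 (A * (1 + c0 * vq1 C + c1 * (1 + vq1 C) - A * (1 + vq1 C) - two * P10)) 1) => //.
- exact: polyval_1.
- eapply polyval_eq; [polyval_compute | by field].
- exact: oner_neq0.
- by rewrite mul1r -vq_vq1; symmetry; apply: eA.
Qed.

Lemma P10_neq0 : P10 != 0.
Proof. by have := jac_neq_const 0 jacV_A_q1; rewrite rmorph0 subr0. Qed.

(** Along $P^1_0=\infty$ the two speeds have a simple pole. Multiplying by [P10^-1] leaves the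
    coefficients $2$ and $-2$ of $P^1_0$, nonzero for all parameters. *)
Lemma good_A_q1_inf : good t [tuple A; vq1 C; P10^-1].
Proof.
set u := [tuple _; _; _].
split; first by rewrite jac_tuple jac_inv_neq0 ?jacV_A_q1.
exists [:: o0; o1]; split.
  by rewrite !big_cons big_nil !tnth3 mulr1 divfK.
have eA : t * X A = A * (1 + c0 * vq1 C + c1 * q - A * q - two * P10) :=
  X_A t0 q1 hX Xt Xq.
have eq : t * X (vq1 C) = vq1 C * (two * P10 - c0 * vq1 C - c1 * q + A * q) :=
  X_q1 t0 q1 hX Xq.
have eP : P10^-1 * P10 = 1 := mulVf P10_neq0.
move=> i; rewrite !inE => /orP [] /eqP->.
  pose w := pt3 0 1 0.
  have h0 : polyval u w A 0 := polyval_coord u w o0.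
  have h1 : polyval u w (vq1 C) 1 := polyval_coord u w o1.
  have h2 : polyval u w P10^-1 0 := polyval_coord u w o2.
  apply: (@transverse_of u w _ (vq1 C) 1 P10^-1 0 (vq1 C * (two + P10^-1 * (- c0 * vq1 C - c1 * (1 + vq1 C) + A * (1 + vq1 C)))) 2%:R) => //.
  - eapply polyval_eq; [polyval_compute | ring].
  - exact: two_neq0.
  - rewrite -vq_vq1 eq; move: eP.
    move: (vq1 C) P10^-1 P10 c0 c1 A (q) => x y z k k' y' x' eP.
    exact: fiber_at_infinity.
pose w := pt3 1 0 0.
have h0 : polyval u w A 1 := polyval_coord u w o0.
have h1 : polyval u w (vq1 C) 0 := polyval_coord u w o1.
have h2 : polyval u w P10^-1 0 := polyval_coord u w o2.
apply: (@transverse_of u w _ A 1 P10^-1 0 (A * (P10^-1 * (1 + c0 * vq1 C + c1 * (1 + vq1 C) - A * (1 + vq1 C)) - two)) (- 2%:R)) => //.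
- eapply polyval_eq; [polyval_compute | ring].
- by rewrite oppr_eq0 two_neq0.
- rewrite -vq_vq1 eA; move: eP.
  move: (vq1 C) P10^-1 P10 c0 c1 A (q) => x y z k k' y' x' eP.
  exact: fiber_at_infinity'.
Qed.

End Charts.

(** * Invariance of the fibres t = 0 and t = infinity *)

Fact inv_derivative (F : fieldType) (t : F) : - 1 / t ^+ 2 = -1 * (t^-1 / t).
Proof. by rewrite !mulN1r expr2 invfM. Qed.

Fact scaled_derivative (F : fieldType) (g e s t : F) :
  g * (e * (s / t)) = e * (g / t) * s.
Proof. ring. Qed.

Fact sign_cancel (F : fieldType) (e g s t : F) (n : bool) : e = (-1) ^+ n ->
  e * (g * (e * (s / t))) = s * (g / t).
Proof. by case: n => ->; ring. Qed.

Section Invariance.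
Variables (C : numClosedFieldType) (k0 k1 kinf : C).
Hypothesis hgen : generic_parameters k0 k1 kinf.
Local Notation K := (KV C).
Local Notation t := (vt C).
Local Notation q := (vq C).
Local Notation T := (vT C).
Local Notation X := (XV k0 k1 kinf).
Local Notation good := (good k0 k1 kinf).

Lemma const0 : (0 : K) = const 0.
Proof. by rewrite rmorph0. Qed.
Lemma constN1 : (-1 : K) = const (-1).
Proof. by rewrite rmorphN1. Qed.

Lemma monomial_y (x y : K) : y = x ^+ false * y ^+ true.
Proof. by rewrite expr0 expr1 mul1r. Qed.
Lemma monomial_x (x y : K) : x = x ^+ true * y ^+ false.
Proof. by rewrite expr0 expr1 mulr1. Qed.
Lemma monomial_xy (x y : K) : x * y = x ^+ true * y ^+ true.
Proof. by rewrite !expr1. Qed.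

Let two0 : (2%:R : C) != 0. Proof. by rewrite pnatr_eq0. Qed.
Let zero0 (b : bool) : b -> (0 : C) = 0. Proof. by []. Qed.

Lemma good_Q0 c : c \in charts_Q0 k0 -> good t c.1 \/ good T c.1.
Proof.
have [k00 _] := hgen.
(* On $q=0$, $t=0$ the speed of $q$ is $2P^0-\kappa_0$, and likewise for $R$ on $R=T=0$: at the two
   centres it equals $-\kappa_0$ and $\kappa_0$. *)
have n0 : - k0 + 2%:R * 0 != 0 by rewrite mulr0 addr0 oppr_eq0.
have n1 : - k0 + 2%:R * k0 != 0 by rewrite (_ : _ + _ = k0) //; ring.
rewrite mem_cat => /orP [] hc; [left|right].
- have h := good_blowup_sections (base_q_t k0 k1 kinf) (jacV_q_t C)
    (monomial_y q t).
  have h' := h (@zero0 _) _ _ _ _ _ _ const0 (erefl _) n0 n1 two0.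
  exact: h' hc.
- have h := good_blowup_sections (base_R_T k0 k1 kinf) (jacV_R_T C)
    (monomial_y (vR C) T).
  have h' := h (@zero0 _) _ _ _ _ _ _ const0 (erefl _) n0 n1 two0.
  exact: h' hc.
Qed.

Lemma good_Qinf c : c \in charts_Qinf k0 k1 kinf -> good t c.1 \/ good T c.1.
Proof.
have [_ kinf0] := hgen.
(* The speed $\kappa_0+\kappa_1-1-2P^\infty$ equals $\mp\kappa_\infty$ at the two centres. *)
have np : k0 + (k1 - 1) + - 2%:R * ((k0 + k1 - 1 + kinf) / 2%:R) != 0.
  by rewrite (_ : _ + _ = - kinf) ?oppr_eq0 //; field.
have nm : k0 + (k1 - 1) + - 2%:R * ((k0 + k1 - 1 - kinf) / 2%:R) != 0.
  by rewrite (_ : _ + _ = kinf) //; field.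
have nb : - 2%:R != 0 :> C by rewrite oppr_eq0.
rewrite mem_cat => /orP [] hc; [left|right].
- have h := good_blowup_sections (base_Q_t k0 k1 kinf) (jacV_Q_t C)
    (monomial_y (vQ C) t).
  have h' := h (@zero0 _) _ _ _ _ _ _ (erefl _) (erefl _) np nm nb.
  exact: h' hc.
- have h := good_blowup_sections (base_S_T k0 k1 kinf) (jacV_S_T C)
    (monomial_y (vS C) T).
  have h' := h (@zero0 _) _ _ _ _ _ _ (erefl _) (erefl _) np nm nb.
  exact: h' hc.
Qed.

(** The base speed is $1+2P^1$, up to sign, in all charts with fibre coordinate $P^1$; at the
    centres $P^1=0$ and $P^1=-1$ it is therefore $\pm1$. *)
Lemma sections_P1_neq0 : (1 + 2%:R * 0 != 0 :> C) /\ (1 + 2%:R * (- 1) != 0 :> C).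
Proof.
split; first by rewrite mulr0 addr0 oner_eq0.
by rewrite (_ : _ + _ = -1) ?oppr_eq0 ?oner_eq0 //; ring.
Qed.

Lemma blowup_loci (x y z f : K) us c v :
  c \in blowup x y z f us -> v \in us -> v \in c.2.
Proof. by move=> h hv; move: h; rewrite 2!inE => /orP [] /eqP->. Qed.

Lemma blowup2_loci (x y z f f' : K) us c v :
  c \in blowup2 x y z f f' us -> v \in us -> v \in c.2.
Proof.
move=> h hv; move: h; rewrite in_cons => /orP [/eqP-> //|h].
exact: blowup_loci h hv.
Qed.

Lemma mem_listed (f v : K) us : v \in us -> v \in f :: us.
Proof. by move=> h; rewrite in_cons h orbT. Qed.

Lemma infinity_loci (x y z f f' : K) us c v :
  c \in infinity x y z f f' us -> v \in us -> v \in c.2.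
Proof.
rewrite mem_seq1 => /eqP-> hv.
exact: mem_listed (mem_listed _ hv).
Qed.

Lemma t_listed : t \in [:: q; t].
Proof. by rewrite in_cons mem_head orbT. Qed.

(** The charts with coordinate $q-1$ list $t$ as a unit and hence meet neither boundary fibre; those
    with coordinate $a=(q-1)/t$ reach $t=0$. *)
Lemma good_Q1 c : c \in charts_Q1 k1 -> good t c.1 \/ t \in c.2.
Proof.
rewrite mem_cat => /orP [] hc; [right|left].
  move: hc; rewrite 2!mem_cat => /orP [h|/orP [h|h]].
  - exact: (blowup2_loci h (mem_listed _ t_listed)).
  - exact: (blowup2_loci h (mem_listed _ t_listed)).
  - exact: (infinity_loci h t_listed).
have hb := base_a_t k0 k1 kinf; have J := jacV_a_t C.
have [n0 n1] := sections_P1_neq0.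
move: hc; rewrite 2!mem_cat => /orP [h|/orP [h|h]].
- have h1 := good_blowup2 hb J (monomial_y (va C) t).
  have h2 := h1 _ _ _ _ _ _ (@zero0 _) const0 const0 n0.
  exact: h2 h.
- have h1 := good_blowup2 hb J (monomial_y (va C) t).
  have h2 := h1 _ _ _ _ _ _ (@zero0 _) constN1 (erefl _) n1.
  exact: h2 h.
- have h1 := good_infinity hb J (monomial_y (va C) t).
  exact: h1 (@zero0 _) _ _ _ _ two0 h.
Qed.

(** The fibre has two components in this chart: $r=0$ is $\mathcal A_\infty$ and $q=0$ is $\mathcal
    B^0_\infty$. *)
Lemma vT_rq : T = vr C * q.
Proof. by rewrite /vr /vR invf_div divfK // vq_neq0. Qed.

Lemma vT_sQ : T = vs C * vQ C.
Proof. by rewrite /vs /vS invf_div divfK // invr_neq0 ?vq_neq0. Qed.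

Let falseE (x y : C) : false -> x = y. Proof. by []. Qed.

Lemma good_Ainf c : c \in charts_Ainf C -> good T c.1.
Proof.
have [n0 n1] := sections_P1_neq0.
have m0 : -1 + - 2%:R * 0 != 0 :> C by rewrite mulr0 addr0 oppr_eq0 oner_eq0.
have m1 : -1 + - 2%:R * -1 != 0 :> C.
  by rewrite (_ : _ + _ = 1) ?oner_eq0 //; ring.
have m2 : - 2%:R != 0 :> C by rewrite oppr_eq0.
rewrite mem_cat => /orP [hc|]; last (rewrite mem_cat => /orP [] hc).
- have h := good_blowup_sections (base_T_q k0 k1 kinf) (jacV_T_q C)
    (monomial_x T q).
  have h' := h (@falseE _ _) _ _ _ _ _ _ const0 constN1 n0 n1 two0.
  exact: h' hc.
- have h := good_blowup_sections (base_r_q k0 k1 kinf) (jacV_r_q C)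
    (etrans vT_rq (monomial_xy (vr C) q)).
  have h' := h (@zero0 _) _ _ _ _ _ _ const0 constN1 m0 m1 m2.
  exact: h' hc.
- have h := good_blowup_sections (base_s_Q k0 k1 kinf) (jacV_s_Q C)
    (etrans vT_sQ (monomial_xy (vs C) (vQ C))).
  have h' := h (@zero0 _) _ _ _ _ _ _ const0 constN1 n0 n1 two0.
  exact: h' hc.
Qed.

Lemma good_Q1_Ainf c : c \in charts_Q1_Ainf k1 -> good T c.1.
Proof.
have [n0 n1] := sections_P1_neq0.
have hb := base_q1_T k0 k1 kinf; have J := jacV_q1_T C.
have x0 := jac_neq0l J.
have e0 z : z - const 0 = z :> K by rewrite -const0 subr0.
have e1 z : z - const (-1) = z + 1 :> K by rewrite -constN1 opprK.
have hbm := base_blowup 0 x0 hb; have Jm := jac_blowup 0 J.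
(* The second centre $\beta_+=\kappa_1T$ varies with $T$; subtracting $\kappa_1T$ from the
   coordinate makes it constant. *)
have hbp := base_shift k1 (base_blowup (-1) x0 hb).
have Jp := jac_blowup (-1) J; rewrite -(jac_shift _ _ _ k1) in Jp.
rewrite e0 in hbm Jm; rewrite e1 in hbp Jp.
(* The last blow-ups have their centres over $T=0$, so $T$ takes the role of the first
   coordinate. *)
have hgm := base_swap (base_blowup 0 x0 hbm).
have Jgm := jac_blowup 0 Jm; rewrite jac_swap oppr_eq0 in Jgm.
have hgp := base_swap (base_blowup 0 x0 hbp).
have Jgp := jac_blowup 0 Jp; rewrite jac_swap oppr_eq0 in Jgp.
rewrite e0 in hgm Jgm; rewrite e0 in hgp Jgp.
have m0 : 1 + 2%:R * 0 + 0 * 0 != 0 :> C by rewrite [0 * 0]mulr0 addr0.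
have m1 : 1 + 2%:R * -1 + 0 * 0 != 0 :> C by rewrite mulr0 addr0.
have m0' : 1 + 2%:R * 0 + 0 * 0 + 0 * 0 != 0 :> C by rewrite [0 * 0]mulr0 addr0 -[X in _ + X](mulr0 (0 : C)).
have m1' : 1 + 2%:R * -1 + 0 * 0 + 0 * 0 != 0 :> C by rewrite mulr0 !addr0.
have sT := monomial_y (vq1 C) T; have sT' := monomial_x T (vq1 C).
rewrite mem_cat => /orP [|].
  rewrite in_cons => /orP [/eqP->|].
    have := good_blowup_exc hb J sT (@zero0 _) n0; rewrite e0; exact.
  rewrite in_cons => /orP [/eqP->|].
    have := good_blowup_exc hbm Jm sT (@zero0 _) m0; rewrite e0; exact.
  rewrite in_cons => /orP [/eqP->|].
    have := good_blowup_exc hb J sT (@zero0 _) n1; rewrite e1; exact.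
  rewrite mem_seq1 => /eqP->.
  have := good_blowup_exc hbp Jp sT (@zero0 _) m1; rewrite e0; exact.
rewrite mem_cat => /orP [hc|].
  have h := good_blowup hgm Jgm sT' (@zero0 _) m0'; rewrite -const0 in h.
  exact: h hc.
rewrite mem_cat => /orP [hc|hc].
  have h := good_blowup hgp Jgp sT' (@zero0 _) m1'; rewrite -const0 in h.
  exact: h hc.
have h := good_infinity hb J sT; exact: h (@zero0 _) _ _ _ _ two0 hc.
Qed.

Lemma ConV_good c : c \in ConV k0 k1 kinf ->
  [\/ good t c.1, good T c.1 | t \in c.2].
Proof.
rewrite mem_cat => /orP [/good_Q0 [h|h]|]; [by constructor 1|by constructor 2|].
rewrite mem_cat => /orP [/good_Qinf [h|h]|]; [by constructor 1|by constructor 2|].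
rewrite mem_cat => /orP [/good_Q1 [h|h]|]; [by constructor 1|by constructor 3|].
rewrite mem_cat => /orP [/good_Ainf h|]; first by constructor 2.
rewrite mem_cat => /orP [/good_Q1_Ainf h|]; first by constructor 2.
rewrite in_cons => /orP [/eqP->|]; first by constructor 1; apply: good_A_q1.
rewrite mem_seq1 => /eqP->; constructor 1; exact: good_A_q1_inf.
Qed.

Lemma good_regular sigma (u : coords C) x : good sigma u -> local_ring u x sigma.
Proof.
case=> J [S [-> _]].
have -> : \prod_(i <- S) tnth u i = eval u (\prod_(i <- S) 'X_i).
  elim: S => [|i S IH]; first by rewrite !big_nil eval1.
  by rewrite !big_cons evalM evalX IH.
exact: (loc_eval u (S := fun b => b.@[x] != 0) (local_1 x)).
Qed.

Lemma good_invariant sigma (u : coords C) x g f : good sigma u ->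
  (sigma = t \/ sigma = T) -> tangent k0 k1 kinf (local_ring u x) g ->
  radical_of (local_ring u x) sigma f ->
  radical_of (local_ring u x) sigma (g * X f).
Proof.
move=> hg hs htan; have Os := good_regular x hg; have [J _] := hg.
pose O := local_ring u x; pose B b := b.@[x] != 0.
have OA : forall h h', O h -> O h' -> O (h + h') := locD (S := B) J (@local_mul _ x) (@local_0 _ x).
have OM : forall h h', O h -> O h' -> O (h * h') := locM (S := B) (@local_mul _ x).
have OC : forall c, O (const c) := loc_const u (S := B) (@local_1 _ x).
have t0 := vt_neq0 C.
have hX := XV_derivation k0 k1 kinf.
have Xs : exists n : bool, X sigma = const ((-1) ^+ n) * (sigma / t).
  case: hs => ->.
    by exists false; rewrite XV_t divff // rmorph1 mulr1.
  exists true; rewrite (derV hX) XV_t expr1 rmorphN1; exact: inv_derivative.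
have [n eX] := Xs.
(* As [sigma] itself is regular, $gX\sigma=\pm\sigma\cdot g/t$ is regular; transversality then
   cancels [sigma]. *)
have OE : O (g / t).
  apply: (tangent_divisible hg htan).
  have := OM _ _ (OC ((-1) ^+ n)) (htan _ Os); rewrite eX.
  by rewrite (sign_cancel _ _ _ (rmorph_sign (@const C) n)).
have hD := derivation_scale g hX.
apply: (radical_derivation (e := const ((-1) ^+ n) * (g / t)) _ OC OA OM hD) => //.
- by move=> m; rewrite pnatr_eq0.
- by rewrite eX; exact: scaled_derivative.
- exact: OM.
Qed.

Theorem invariant_fibres :
  invariant_zero_set k0 k1 kinf t /\ invariant_zero_set k0 k1 kinf T.
Proof.
have t0 := vt_neq0 C; have T0 : T != 0 := invr_neq0 t0.
have TV : T^-1 = t := invrK t.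
split=> O [c [x [cC hx ->]]] [Os nU] g htan f hf.
  (* In a chart adapted to the other fibre the inverse of [sigma] is regular, so [sigma] cannot lie
     in the maximal ideal; the same holds where $t$ is a listed unit. *)
  have [h|h|h] := ConV_good cC.
  - exact: good_invariant h (or_introl erefl) htan hf.
  - by case: nU; split=> //; apply: good_regular.
  - by case: nU; apply: hx.
have [h|h|h] := ConV_good cC.
- by case: nU; split=> //; rewrite TV; apply: good_regular.
- exact: good_invariant h (or_intror erefl) htan hf.
- have [_ ht _] := hx t h.
  by case: nU; split=> //; rewrite TV.
Qed.

End Invariance.

(** * Double covers of the line and their genus *)

Section PolyEval.
Variables (C : numClosedFieldType) (L : fieldType) (iota : {rmorphism C -> L}).
Implicit Types (p r : {poly C}) (y : L).

Definition evp y p : L := (map_poly iota p).[y].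

Lemma evpD y p r : evp y (p + r) = evp y p + evp y r.
Proof. by rewrite /evp rmorphD hornerD. Qed.
Lemma evpN y p : evp y (- p) = - evp y p.
Proof. by rewrite /evp rmorphN hornerN. Qed.
Lemma evpB y p r : evp y (p - r) = evp y p - evp y r.
Proof. by rewrite evpD evpN. Qed.
Lemma evpM y p r : evp y (p * r) = evp y p * evp y r.
Proof. by rewrite /evp rmorphM hornerM. Qed.
Lemma evpC y c : evp y c%:P = iota c.
Proof. by rewrite /evp map_polyC hornerC. Qed.
Lemma evp0 y : evp y 0 = 0. Proof. by rewrite -(rmorph0 iota) -(evpC y). Qed.
Lemma evp1 y : evp y 1 = 1. Proof. by rewrite -(rmorph1 iota) -(evpC y). Qed.
Lemma evpX y : evp y 'X = y. Proof. by rewrite /evp map_polyX hornerX. Qed.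
Lemma evpXn y n : evp y 'X^n = y ^+ n.
Proof. by rewrite /evp map_polyXn hornerXn. Qed.

Lemma derivation_evp D y p : derivation iota D ->
  D (evp y p) = evp y p^`() * D y.
Proof.
move=> h; elim/poly_ind: p => [|p c IH].
  by rewrite deriv0 evp0 (der0 h) mul0r.
rewrite evpD evpM evpX evpC (derD h) (derM h) (derC h) IH.
rewrite derivD derivM derivX derivC evpD evpD !evpM evpX evp1 evp0; ring.
Qed.

(** The bound [k] is explicit, not the degree: when $\deg p<k$, the reversal vanishes at 0, which
    records the zero of $p$ at infinity. *)
Definition reversal k p : {poly C} := \poly_(i < k.+1) p`_(k - i).

Lemma evp_reversal k p y : y != 0 -> (size p <= k.+1)%N ->
  evp y p = y ^+ k * evp y^-1 (reversal k p).
Proof.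
move=> y0 hp; rewrite /evp (horner_coef_wide _ (n := k.+1)); last first.
  by rewrite size_map_poly.
rewrite (horner_coef_wide _ (n := k.+1)) ?size_map_poly ?size_poly //.
rewrite mulr_sumr (reindex_inj rev_ord_inj) /=; apply: eq_bigr => i _.
rewrite !coef_map coef_poly ltn_ord subSS mulrCA; congr (_ * _).
have hi : (i <= k)%N by rewrite -ltnS.
have -> : y ^+ k = y ^+ (k - i) * y ^+ i by rewrite -exprD subnK.
by rewrite -mulrA exprVn divff ?mulr1 ?expf_neq0.
Qed.

Lemma size_reversal k p : (size (reversal k p) <= k.+1)%N.
Proof. exact: size_poly. Qed.

Lemma reversal_eq0 k p : (size p <= k.+1)%N -> reversal k p = 0 -> p = 0.
Proof.
move=> hp e; apply/polyP => i; rewrite coef0.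
have [hi|hi] := leqP i k; last by rewrite nth_default // (leq_trans hp).
have := congr1 (fun r : {poly C} => r`_(k - i)) e.
by rewrite coef_poly coef0 ltnS leq_subr subKn.
Qed.

End PolyEval.

Section DoubleCover.
Variables (C : numClosedFieldType) (L : fieldType) (iota : {rmorphism C -> L}).
Implicit Types (p r g : {poly C}) (y w : L) (n m d : {poly C} * {poly C}).

(** That is, $L=\mathbb C(y)\oplus\mathbb C(y)w$ with $w^2=g(y)$, stated with polynomials and one
    common denominator. *)
Definition double_cover y w g :=
  [/\ w ^+ 2 = evp iota y g,
      forall p r, evp iota y p + evp iota y r * w = 0 -> p = 0 /\ r = 0
    & forall x, exists p r (d : {poly C}), d != 0 /\
        x = (evp iota y p + evp iota y r * w) / evp iota y d].

Definition simple_roots g := forall a, root g a -> ~~ root g^`() a.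

Section Point.
Variables (y w : L) (g : {poly C}).
Hypothesis hDC : double_cover y w g.
Let ev := evp iota y.

Lemma dc_w2 : w ^+ 2 = ev g. Proof. by case: hDC. Qed.
Lemma dc_free p r : ev p + ev r * w = 0 -> p = 0 /\ r = 0.
Proof. by case: hDC => _ h _; apply: h. Qed.
Lemma dc_span x : exists p r (d : {poly C}), d != 0 /\ x = (ev p + ev r * w) / ev d.
Proof. by case: hDC => _ _ h; apply: h. Qed.
Lemma dc_inj p : ev p = 0 -> p = 0.
Proof.
move=> e; have /dc_free [//] : ev p + ev 0 * w = 0.
by rewrite e /ev evp0 mul0r addr0.
Qed.
Lemma dc_neq0 p : p != 0 -> ev p != 0.
Proof. by apply: contra_neq; apply: dc_inj. Qed.

(** Pairs stand for the elements of $\mathbb C[y,w]$: they have values at the points of the curve,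
    and [el_inj] turns equations in [L] into equations between pairs. *)
Definition el n := ev n.1 + ev n.2 * w.
Definition pmul n m := (n.1 * m.1 + n.2 * m.2 * g, n.1 * m.2 + n.2 * m.1).
Definition pconj n : {poly C} * {poly C} := (n.1, - n.2).
Definition pnorm n := n.1 ^+ 2 - n.2 ^+ 2 * g.

Lemma el_mul n m : el (pmul n m) = el n * el m.
Proof.
have e : ev g = w * w by rewrite -dc_w2 expr2.
by rewrite /el /pmul /ev /= !evpD !evpM -/(ev g) e; ring.
Qed.
Lemma el_add n m : el (n.1 + m.1, n.2 + m.2) = el n + el m.
Proof. by rewrite /el /ev /= !evpD; ring. Qed.
Lemma el_opp n : el (- n.1, - n.2) = - el n.
Proof. by rewrite /el /ev /= !evpN; ring. Qed.
Lemma el_poly p : el (p, 0) = ev p.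
Proof. by rewrite /el /ev /= evp0 mul0r addr0. Qed.
Lemma el_w : el (0, 1) = w.
Proof. by rewrite /el /ev /= evp0 evp1 mul1r add0r. Qed.
Lemma el_inj n m : el n = el m -> n = m.
Proof.
move=> e; have /dc_free [] : ev (n.1 - m.1) + ev (n.2 - m.2) * w = 0.
  have -> : ev (n.1 - m.1) + ev (n.2 - m.2) * w = el n - el m.
    by rewrite /el /ev !evpB; ring.
  by rewrite e subrr.
by move=> /subr0_eq e1 /subr0_eq e2; case: n m e1 e2 {e} => [? ?] [? ?] /= -> ->.
Qed.
Lemma el_neq0 n : n != (0, 0) -> el n != 0.
Proof.
apply: contra_neq => e; apply: el_inj; rewrite e.
by rewrite /el /ev /= !evp0 mul0r addr0.
Qed.
Lemma el_norm n : el n * el (pconj n) = ev (pnorm n).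
Proof.
rewrite -el_mul -el_poly; congr el; rewrite /pmul /pnorm /=; congr pair; ring.
Qed.

Variables (a b : C).
Hypothesis hb : b ^+ 2 = g.[a].

Definition at_pt n := n.1.[a] + n.2.[a] * b.

Lemma at_mul n m : at_pt (pmul n m) = at_pt n * at_pt m.
Proof. by rewrite /at_pt /= !hornerE -hb; ring. Qed.
Lemma at_poly p : at_pt (p, 0) = p.[a].
Proof. by rewrite /at_pt /= horner0 mul0r addr0. Qed.

Lemma el_at_neq0 n : at_pt n != 0 -> el n != 0.
Proof.
move=> h; apply: el_neq0; apply: contraNneq h => ->.
by rewrite at_poly horner0.
Qed.

Definition point_ring (x : L) : Prop :=
  exists n d, at_pt d != 0 /\ x = el n / el d.

Lemma point_el n : point_ring (el n).
Proof.
exists n, (1, 0); rewrite at_poly hornerC oner_eq0; split=> //.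
by rewrite el_poly /ev evp1 divr1.
Qed.
Lemma point_poly p : point_ring (ev p).
Proof. by rewrite -el_poly; apply: point_el. Qed.
Lemma point_const c : point_ring (iota c).
Proof. by rewrite -(evpC iota y); apply: point_poly. Qed.
Lemma point_mul x x' : point_ring x -> point_ring x' -> point_ring (x * x').
Proof.
case=> n [d [hd ->]] [n' [d' [hd' ->]]]; exists (pmul n n'), (pmul d d').
by rewrite at_mul mulf_neq0 // !el_mul mulf_div.
Qed.
Lemma point_add x x' : point_ring x -> point_ring x' -> point_ring (x + x').
Proof.
case=> n [d [hd ->]] [n' [d' [hd' ->]]].
exists ((pmul n d').1 + (pmul n' d).1, (pmul n d').2 + (pmul n' d).2), (pmul d d').
by rewrite at_mul mulf_neq0 // el_add !el_mul addf_div ?el_at_neq0.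
Qed.
Lemma point_opp x : point_ring x -> point_ring (- x).
Proof. by case=> n [d [hd ->]]; exists (- n.1, - n.2), d; rewrite el_opp mulNr. Qed.
Lemma point_inv d : at_pt d != 0 -> point_ring (el d)^-1.
Proof. by move=> hd; exists (1, 0), d; rewrite el_poly /ev evp1 div1r. Qed.

Lemma point_derivation D : derivation iota D ->
  (exists s, D y = el s) -> (exists s, D w = el s) ->
  forall x, point_ring x -> point_ring (D x).
Proof.
move=> h [s es] [s' es'].
have hel n : point_ring (D (el n)).
  rewrite /el (derD h) (derM h) /ev !(derivation_evp _ _ h) es es'.
  apply: point_add; first exact: point_mul (point_poly _) (point_el _).
  apply: point_add; last exact: point_mul (point_poly _) (point_el _).
  apply: point_mul; first exact: point_mul (point_poly _) (point_el _).
  by rewrite -el_w; apply: point_el.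
move=> x [n [d [hd ->]]]; rewrite (derM h) (derV h).
have hi := point_inv hd; apply: point_add; first exact: point_mul.
apply: point_mul; first exact: point_el.
rewrite expr2 invfM; apply: point_mul; last exact: point_mul.
exact: point_opp.
Qed.

Lemma XsubC_factor p : root p a -> exists r, p = ('X - a%:P) * r.
Proof. by case/factor_theorem=> r ->; exists r; rewrite mulrC. Qed.

Lemma pair_strip n : n != (0, 0) -> exists j m,
  ~~ (root m.1 a && root m.2 a) /\
  el n = ev ('X - a%:P) ^+ j * el m.
Proof.
have [k] := ubnP (size n.1 + size n.2); elim: k n => // k IH n hk n0.
have [/andP [/XsubC_factor [r1 e1] /XsubC_factor [r2 e2]]|h] :=
    boolP (root n.1 a && root n.2 a); last first.
  by exists 0%N, n; rewrite mul1r.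
have en : el n = ev ('X - a%:P) * el (r1, r2).
  by rewrite /el e1 e2 /ev !evpM /=; ring.
have r0 : (r1, r2) != (0, 0).
  apply: contra_neq n0 => -[er1 er2].
  by rewrite [n]surjective_pairing e1 e2 er1 er2 !mulr0.
have [|j [m [hm em]]] := IH (r1, r2) _ r0.
  move: hk; rewrite e1 e2 /= !ltnS; apply: leq_trans.
  have sz r : size (('X - a%:P) * r) = (size r + (r != 0%R))%N.
    have [->|r0'] := eqVneq r 0; first by rewrite mulr0 size_poly0.
    by rewrite size_proper_mul ?size_XsubC ?addn1 // lead_coefXsubC mul1r lead_coef_eq0.
  rewrite !sz; move: r0; rewrite xpair_eqE negb_and; case: (r1 != 0) => /= [_|->].
    by rewrite addn1 addSn ltnS leq_add2l leq_addr.
  by rewrite addn0 addn1 addnS.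
by exists j.+1, m; rewrite en em exprS mulrA.
Qed.

Hypothesis hg : simple_roots g.

(** If $b\neq0$ the uniformizer is $y-a$, and orders are read on the norm. At a branch point $b=0$
    it is $w$, since $w^2=(y-a)g_1(y)$ with $g_1(a)\neq0$ because the root is simple. *)
Lemma uniformizer : exists pi, [/\ at_pt pi = 0, el pi != 0 &
  forall n, n != (0, 0) -> exists k u v,
    [/\ at_pt u != 0, at_pt v != 0 & el n * el v = el pi ^+ k * el u]].
Proof.
have evXa : ev ('X - a%:P) = el ('X - a%:P, 0) by rewrite el_poly.
have Xa0 : ev ('X - a%:P) != 0 by rewrite dc_neq0 // polyXsubC_eq0.
have [b0|b0] := eqVneq b 0; last first.
  exists ('X - a%:P, 0); split; first by rewrite at_poly !hornerE subrr.
    by rewrite -evXa.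
  move=> n n0; have [j [m [hm em]]] := pair_strip n0.
  have [hat|hat] := eqVneq (at_pt m) 0; last first.
    by exists j, m, (1, 0); rewrite at_poly hornerC oner_eq0 em evXa !el_poly /ev evp1 mulr1.
  (* If [m] and its conjugate both vanished at $(a,b)$ with $b\neq0$, both components of [m] would
     vanish at $a$, against [hm]. *)
  have hat' : at_pt (pconj m) != 0.
    apply: contraNneq hm => hc; have two0 : (2%:R : C) != 0 by rewrite pnatr_eq0.
    rewrite /at_pt /= hornerN in hat hc.
    have h1 : m.1.[a] = 0.
      apply: (mulfI two0); rewrite mulr0 -[RHS]addr0 -{1}hat -hc; ring.
    rewrite /root h1 eqxx /=; move/eqP: hat; rewrite h1 add0r mulf_eq0.
    by rewrite (negbTE b0) orbF.
  have N0 : pnorm m != 0.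
    have m0 : m != (0, 0) by apply: contraNneq hm => ->; rewrite !root0.
    have := mulf_neq0 (el_neq0 m0) (el_at_neq0 hat').
    by rewrite el_norm; apply: contraNneq => ->; rewrite /ev evp0.
  have [i [r hr er]] := multiplicity_XsubC (pnorm m) a.
  rewrite N0 /= in hr.
  exists (j + i)%N, (r, 0), (pconj m); split => //; first by rewrite at_poly.
  rewrite em -mulrA el_norm er /ev evpM !el_poly exprD -!mulrA; congr (_ * _).
  rewrite mulrC; congr (_ * _); elim: (i) => [|k IH]; first by rewrite !expr0 evp1.
  by rewrite !exprS evpM IH.
have ga : root g a by rewrite /root -hb b0 expr0n.
have [g1 eg] := XsubC_factor ga.
have g1a : g1.[a] != 0.
  have := hg ga; rewrite /root eg derivM derivB derivX derivC !hornerE.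
  by rewrite subrr mul0r addr0 subr0 mul1r.
have w2 : w ^+ 2 = ev ('X - a%:P) * ev g1 by rewrite dc_w2 eg /ev evpM.
have evXn p k : ev (p ^+ k) = ev p ^+ k.
  by elim: k => [|k IH]; rewrite ?expr0 /ev ?evp1 // !exprS evpM -IH.
exists (0, 1); split; first by rewrite /at_pt /= b0 horner0 mulr0 addr0.
  by rewrite el_neq0 // xpair_eqE oner_eq0 andbF.
move=> n n0; have [j [m [hm em]]] := pair_strip n0.
have [hat|hat] := eqVneq (at_pt m) 0; last first.
  exists (2 * j)%N, m, (g1 ^+ j, 0); split=> //.
    by rewrite at_poly horner_exp expf_neq0.
  by rewrite em el_poly evXn el_w exprM w2 exprMn; ring.
have h1 : root m.1 a by rewrite /root -hat /at_pt b0 mulr0 addr0.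
rewrite h1 /= in hm; have [c ec] := XsubC_factor h1.
(* With $m_1=(X-a)c$ and $(y-a)g_1=w^2$, multiplying by $g_1$ extracts one factor:
   $g_1(m_1+m_2w)=w(g_1m_2+cw)$. *)
exists (2 * j).+1, (g1 * m.2, c), (g1 ^+ j.+1, 0); split.
- by rewrite /at_pt /= b0 mulr0 addr0 hornerM mulf_neq0.
- by rewrite at_poly horner_exp expf_neq0.
rewrite em el_poly evXn el_w [w ^+ _.+1]exprS exprM w2 exprMn [_ ^+ j.+1]exprS.
rewrite /el ec /ev !evpM.
have -> : w * (evp iota y ('X - a%:P) ^+ j * evp iota y g1 ^+ j) *
  (evp iota y g1 * evp iota y m.2 + evp iota y c * w) =
  (evp iota y ('X - a%:P) ^+ j * evp iota y g1 ^+ j) *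
  (evp iota y g1 * evp iota y m.2 * w + evp iota y c * w ^+ 2) by ring.
by rewrite w2 /ev; ring.
Qed.

Lemma point_place : place iota point_ring.
Proof.
split.
- exact: point_const.
- move=> x x' hx hx'; split; last exact: point_mul.
  by apply: point_add => //; apply: point_opp.
- move=> x x0; have [p [r [d [d0 ex]]]] := dc_span x.
  have [pi [_ pi0 hpi]] := uniformizer.
  have n0 : (p, r) != (0, 0).
    apply: contraNneq x0 => -[e1 e2].
    by rewrite ex e1 e2 /ev !evp0 mul0r addr0 mul0r.
  have d0' : (d, 0) != (0, 0) :> {poly C} * {poly C}.
    by rewrite xpair_eqE negb_and d0.
  have [k [u [v [hu hv e1]]]] := hpi _ n0.
  have [k' [u' [v' [hu' hv' e2]]]] := hpi _ d0'.
  have := el_at_neq0 hu; have := el_at_neq0 hv.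
  have := el_at_neq0 hu'; have := el_at_neq0 hv' => v'0 u'0 v0 u0.
  have ex' : x = el pi ^+ k * (el u * el v') / (el pi ^+ k' * (el u' * el v)).
    rewrite ex -/(el (p, r)) -(el_poly d) [el (p, r)](canRL (mulfK v0) e1).
    rewrite [el (d, 0)](canRL (mulfK v'0) e2).
    by field; rewrite expf_neq0 // v'0 u'0 v0.
  have key i j s s' : at_pt s != 0 -> at_pt s' != 0 -> (i <= j)%N ->
      point_ring (el pi ^+ j * el s / (el pi ^+ i * el s')).
    move=> hs hs' /subnK ej; rewrite -ej exprD.
    have -> : el pi ^+ (j - i) * el pi ^+ i * el s / (el pi ^+ i * el s') =
              el pi ^+ (j - i) * (el s / el s').
      by field; rewrite expf_neq0 // el_at_neq0.
    apply: point_mul; last by exists s, s'.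
    elim: (j - i)%N => [|i' IH]; first by rewrite expr0 -(rmorph1 iota); apply: point_const.
    by rewrite exprS; apply: point_mul => //; apply: point_el.
  rewrite -!el_mul in ex'; have [le|lt] := leqP k' k.
    by left; rewrite ex'; apply: key; rewrite // at_mul mulf_neq0.
  right; rewrite ex' invf_div; apply: key; rewrite ?at_mul ?mulf_neq0 //.
  exact: ltnW.
have Xa0 : ev ('X - a%:P) != 0 by rewrite dc_neq0 // polyXsubC_eq0.
exists (ev ('X - a%:P))^-1 => -[n [d [hd e]]].
have e2 : el d = el (pmul ('X - a%:P, 0) n).
  rewrite el_mul el_poly; apply: (mulfI (invr_neq0 Xa0)).
  by rewrite mulKf // e divfK // el_at_neq0.
have := el_inj e2 => ed; move: hd; rewrite ed at_mul at_poly !hornerE subrr mul0r.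
by rewrite eqxx.
Qed.

Lemma point_fraction p (d : {poly C}) : root d a -> d != 0 ->
  point_ring (ev p / ev d) -> root p a.
Proof.
move=> da d0 [n [m [hm e]]].
have e2 : el (pmul m (p, 0)) = el (pmul n (d, 0)).
  rewrite !el_mul !el_poly; have m0 := el_at_neq0 hm.
  have ed0 := dc_neq0 d0.
  have -> : el n = ev p / ev d * el m by rewrite e divfK.
  by rewrite mulrAC divfK // mulrC.
have := congr1 at_pt (el_inj e2); rewrite !at_mul !at_poly.
move/eqP: da => ->; rewrite mulr0 => /eqP.
by rewrite mulf_eq0 (negbTE hm).
Qed.

End Point.

(** The involution $w\mapsto-w$ exchanges the points $(a,b)$ and $(a,-b)$; it is carried out on
    pairs. *)
Lemma point_conj y w g a b p r (d : {poly C}) : double_cover y w g -> b ^+ 2 = g.[a] ->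
  d != 0 -> 
  point_ring y w a (- b) ((evp iota y p + evp iota y r * w) / evp iota y d) ->
  point_ring y w a b ((evp iota y p - evp iota y r * w) / evp iota y d).
Proof.
move=> hDC hb d0 [n [m [hm e]]].
have m0 : el y w m != 0 by apply: (el_at_neq0 hDC hm).
have d0' := dc_neq0 hDC d0.
have hm' : at_pt a b (pconj m) != 0.
  by move: hm; rewrite /at_pt /= hornerN mulrN mulNr.
exists (pconj n), (pconj m); split=> //.
have m0' := el_at_neq0 hDC hm'.
have e2 : el y w (pmul g (p, r) m) = el y w (pmul g n (d, 0)).
  rewrite !(el_mul hDC) el_poly.
  have eX : el y w (p, r) = el y w n / el y w m * evp iota y d.
    by rewrite -e divfK.
  by rewrite eX mulrAC divfK.
have e3 := congr1 (@pconj) (el_inj hDC e2).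
have e4 : pmul g (pconj (p, r)) (pconj m) = pmul g (pconj n) (pconj (d, 0)).
  move: e3; rewrite /pmul /pconj /= => -[h1 h2].
  congr pair.
    have -> : p * m.1 + - r * - m.2 * g = p * m.1 + r * m.2 * g by ring.
    by rewrite h1; ring.
  have -> : p * - m.2 + - r * m.1 = - (p * m.2 + r * m.1) by ring.
  by rewrite h2; ring.
have := congr1 (el y w) e4; rewrite !(el_mul hDC) /pconj /= oppr0 el_poly.
have -> : el y w (p, - r) = evp iota y p - evp iota y r * w.
  by rewrite /el /= evpN mulNr.
move=> e5; apply: (canLR (mulfK d0')).
by rewrite mulrAC -e5 mulfK.
Qed.

End DoubleCover.

(** * Regular differential forms on a double cover *)

Section Genus.
Variables (C : numClosedFieldType) (L : fieldType) (iota : {rmorphism C -> L}).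
Implicit Types (p r g : {poly C}) (y w : L).
Local Notation evp := (evp iota).
Local Notation double_cover := (double_cover iota).
Local Notation point_ring := (point_ring iota).

Section Affine.
Variables (y w : L) (g : {poly C}).
Hypotheses (hDC : double_cover y w g) (hg : simple_roots g).

(** Adding the conjugate shows that $2p/d$ is regular, so $p(a)=0$. Subtracting it and squaring
    shows that $4r^2g/d^2$ is regular. If $g(a)=0$, one factor $y-a$ cancels and a pole remains
    unless $r(a)=0$, because the root of $g$ is simple. *)
Lemma regular_root a p r (d : {poly C}) : root d a -> d != 0 ->
  (forall b, b ^+ 2 = g.[a] -> point_ring y w a b ((evp y p + evp y r * w) / evp y d)) ->
  root p a /\ root r a.
Proof.
move=> da d0 hh; pose b := sqrtC g.[a].
have hb : b ^+ 2 = g.[a] by rewrite sqrtCK.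
have hb' : (- b) ^+ 2 = g.[a] by rewrite sqrrN.
have h1 := hh _ hb; have h2 := point_conj hDC hb d0 (hh _ hb').
have ed0 := dc_neq0 hDC d0.
have two0 : (2%:R : C) != 0 by rewrite pnatr_eq0.
have padd := point_add hDC hb; have pmul := point_mul hDC hb.
have popp := point_opp (iota := iota).
have e2 : evp y 2%:R%:P = 2%:R by rewrite evpC rmorph_nat.
split.
  have h3 : point_ring y w a b (evp y (2%:R%:P * p) / evp y d).
    have := padd _ _ h1 h2; congr point_ring.
    by rewrite evpM e2 -mulrDl; congr (_ / _); ring.
  have := point_fraction hDC hb da d0 h3.
  by rewrite rootM rootC (negbTE two0).
have h3 : point_ring y w a b (2%:R * evp y r * w / evp y d).
  have := padd _ _ h1 (popp _ _ _ _ _ h2); congr point_ring.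
  by rewrite -mulrBl; congr (_ / _); ring.
have h4 : point_ring y w a b (evp y (4%:R%:P * r ^+ 2 * g) / evp y (d ^+ 2)).
  have := pmul _ _ h3 h3; congr point_ring.
  rewrite !expr2 !evpM -(dc_w2 hDC) evpC rmorph_nat.
  by field.
have d2a : root (d ^+ 2) a by rewrite expr2 rootM da.
have d20 : d ^+ 2 != 0 by rewrite expf_neq0.
have := point_fraction hDC hb d2a d20 h4.
have four0 : (4%:R : C) != 0 by rewrite pnatr_eq0.
rewrite !expr2 !rootM rootC (negbTE four0) orbb /= => /orP [//|ga].
have [g1 eg] := XsubC_factor ga; have [d1 ed] := XsubC_factor da.
have g1a : ~~ root g1 a.
  have := hg ga; rewrite /root eg derivM derivB derivX derivC !hornerE.
  by rewrite subrr mul0r addr0 subr0 mul1r.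
have h5 : point_ring y w a b (evp y (4%:R%:P * r ^+ 2 * g1) / evp y (d1 * d)).
  move: h4; congr point_ring.
  have Xa0 : evp y ('X - a%:P) != 0 by rewrite (dc_neq0 hDC) // polyXsubC_eq0.
  have d10 : evp y d1 != 0.
    by rewrite (dc_neq0 hDC) //; apply: contraNneq d0 => e; rewrite ed e mulr0.
  rewrite eg ed !expr2 !evpM; field; by rewrite d10 Xa0.
have dd : root (d1 * d) a by rewrite rootM da orbT.
have dd0 : d1 * d != 0.
  by rewrite mulf_neq0 //; apply: contraNneq d0 => e; rewrite ed e mulr0.
have := point_fraction hDC hb dd dd0 h5.
by rewrite !expr2 !rootM rootC (negbTE four0) orbb (negbTE g1a) orbF.
Qed.

(** Normality of the curve $w^2=g(y)$: each root of the denominator is also a root of both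
    numerators and can be cancelled. *)
Lemma integral_everywhere h :
  (forall a b, b ^+ 2 = g.[a] -> point_ring y w a b h) ->
  exists p r, h = evp y p + evp y r * w.
Proof.
have [p [r [d [d0 eh]]]] := dc_span hDC h; move=> hh.
have [k] := ubnP (size d); elim: k p r d d0 eh => // k IH p r d d0 eh hk.
have [sz|sz] := leqP (size d) 1.
  have [c c0 ed] : exists2 c, c != 0 & d = c%:P.
    by apply/size_poly1P; rewrite eqn_leq sz size_poly_gt0.
  exists (c^-1%:P * p), (c^-1%:P * r).
  rewrite eh ed !evpM !evpC fmorphV.
  have c0' : iota c != 0 by rewrite fmorph_eq0.
  by field.
have [a da] : exists a, root d a by apply/closed_rootP; rewrite neq_ltn sz orbT.
have [pa ra] : root p a /\ root r a.
  by apply: (regular_root da d0) => b hb; rewrite -eh; apply: hh.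
have [p' ep] := XsubC_factor pa; have [r' er] := XsubC_factor ra.
have [d' ed] := XsubC_factor da.
have d'0 : d' != 0 by apply: contraNneq d0 => e; rewrite ed e mulr0.
apply: (IH p' r' d' d'0).
  have Xa0 : evp y ('X - a%:P) != 0 by rewrite (dc_neq0 hDC) // polyXsubC_eq0.
  have d10 : evp y d' != 0 by rewrite (dc_neq0 hDC).
  by rewrite eh ep er ed !evpM; field; rewrite d10 Xa0.
move: hk; rewrite ed size_proper_mul ?size_XsubC //.
by rewrite lead_coefXsubC mul1r lead_coef_eq0.
Qed.

(** Used over $y=\infty$, where regularity is known above one value of the coordinate only and a
    pole of high order has to be cancelled. *)
Lemma regular_divides a N p r :
  (forall b, b ^+ 2 = g.[a] -> point_ring y w a b
    ((evp y p + evp y r * w) / evp y (('X - a%:P) ^+ N))) ->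
  exists p' r', p = ('X - a%:P) ^+ N * p' /\ r = ('X - a%:P) ^+ N * r'.
Proof.
elim: N p r => [|N IH] p r hh; first by exists p, r; rewrite expr0 !mul1r.
have [pa ra] : root p a /\ root r a.
  apply: (regular_root _ _ hh); last by rewrite expf_neq0 // polyXsubC_eq0.
  by rewrite exprS rootM root_XsubC eqxx.
have [p1 ep] := XsubC_factor pa; have [r1 er] := XsubC_factor ra.
have [|p' [r' [ep' er']]] := IH p1 r1; last first.
  by exists p', r'; rewrite ep er ep' er' exprS !mulrA.
move=> b hb; have := hh b hb; congr point_ring.
have Xa0 : evp y ('X - a%:P) != 0 by rewrite (dc_neq0 hDC) // polyXsubC_eq0.
have XN0 : evp y (('X - a%:P) ^+ N) != 0.
  by rewrite (dc_neq0 hDC) // expf_neq0 // polyXsubC_eq0.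
by rewrite exprS ep er !evpM; field; rewrite Xa0 XN0.
Qed.

Lemma g_neq0 : g != 0.
Proof.
apply/eqP => e; have ga : root g 0 by rewrite e root0.
by have := hg ga; rewrite e deriv0 root0.
Qed.

Lemma w_neq0 : w != 0.
Proof.
have := dc_neq0 hDC g_neq0; rewrite -(dc_w2 hDC) expr2.
by apply: contraNneq => ->; rewrite mul0r.
Qed.

Lemma derivation_w D : derivation iota D ->
  2%:R * w * D w = evp y g^`() * D y.
Proof. by move=> h; rewrite -(derX2 h) (dc_w2 hDC) (derivation_evp _ _ h). Qed.

Lemma simple_roots_bezout : exists u v, u * g + v * g^`() = 1.
Proof.
have /Bezout_coprimepP [[u v] /=] : coprimep g g^`().
  by apply/Pdiv.ClosedField.coprimepP => x; apply: hg.
rewrite -size_poly_eq1 => /size_poly1P [c c0 e].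
exists (c^-1%:P * u), (c^-1%:P * v).
by rewrite -!mulrA -mulrDr e -polyCM mulVf.
Qed.

(** From $ug+vg'=1$ and $2w\,dw=g'(y)\,dy$ follows $dy/w=uw\,dy+2v\,dw$. The right-hand side is
    regular wherever $y$ is, since $w$ is integral over $\mathbb C[y]$. *)
Lemma holomorphic (O : L -> Prop) D : place iota O -> derivation iota D ->
  (forall h, O h -> O (D h)) -> O y -> O (D y / w).
Proof.
case=> OC OB OV _ hD OD Oy.
have OM x x' : O x -> O x' -> O (x * x') by move=> hx hx'; have [] := OB _ _ hx hx'.
have O0 : O 0 by rewrite -(rmorph0 iota); apply: OC.
have ON x : O x -> O (- x) by move=> hx; rewrite -sub0r; have [] := OB _ _ O0 hx.
have OA x x' : O x -> O x' -> O (x + x').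
  by move=> hx hx'; rewrite -[x']opprK; have [] := OB _ _ hx (ON _ hx').
have Oev p : O (evp y p).
  elim/poly_ind: p => [|p c IH]; first by rewrite evp0.
  by rewrite evpD evpM evpX evpC; apply: (OA) => //; apply: (OM).
have w0 := w_neq0.
have Ow : O w.
  have [//|Ow] := OV w w0.
  have -> : w = w ^+ 2 * w^-1 by rewrite expr2 mulfK.
  by apply: (OM) => //; rewrite (dc_w2 hDC).
have [u [v e]] := simple_roots_bezout.
have e2 : evp y u * w ^+ 2 + evp y v * evp y g^`() = 1.
  by rewrite (dc_w2 hDC) -!evpM -evpD e evp1.
have -> : D y / w = evp y u * w * D y + 2%:R * evp y v * D w.
  have e3 := derivation_w hD; apply: (mulIf w0); rewrite divfK //.
  have -> : (evp y u * w * D y + 2%:R * evp y v * D w) * w =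
    evp y u * w ^+ 2 * D y + evp y v * (2%:R * w * D w) by ring.
  by rewrite e3 mulrA -mulrDl e2 mul1r.
have O2 : O 2%:R by rewrite -(rmorph_nat iota); apply: OC.
by apply: (OA); apply: (OM) => //; try apply: (OD) => //; apply: (OM).
Qed.

End Affine.

Section Infinity.
Variables (y w : L) (g : {poly C}) (m : nat).
Hypotheses (hDC : double_cover y w g) (hg : simple_roots g).
Hypothesis (m_le2 : (m <= 2)%N).
Hypotheses (szg : (size g <= (2 * m).+1)%N).
Let g' := reversal (2 * m) g.
Hypothesis (hg' : simple_roots g').

Lemma y_neq0 : y != 0.
Proof. by have := dc_neq0 hDC (negbT (polyX_eq0 C)); rewrite evpX. Qed.

Let y0 := y_neq0.

(** Reading $g$ as a form of degree $2m$ gives the other affine chart of the same curve. *)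
Lemma double_cover_inf : double_cover y^-1 (w / y ^+ m) g'.
Proof.
split.
- rewrite expr_div_n (dc_w2 hDC) (evp_reversal iota y0 szg) -exprM.
  by rewrite [(m * 2)%N]mulnC [LHS]mulrC mulKf // expf_neq0.
- move=> p r e; pose N := maxn (size p) (size r).
  have hp : (size p <= N.+1)%N by rewrite (leq_trans (leq_maxl _ (size r))).
  have hr : (size r <= N.+1)%N by rewrite (leq_trans (leq_maxr (size p) _)).
  have yV0 := invr_neq0 y0.
  have /(dc_free hDC) [e1 e2] :
      evp y (reversal N p * 'X^m) + evp y (reversal N r) * w = 0.
    have := congr1 (fun x => y ^+ N * y ^+ m * x) e.
    rewrite (evp_reversal iota yV0 hp) (evp_reversal iota yV0 hr) invrK mulr0.
    move=> <-; rewrite evpM evpXn exprVn.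
    by field; rewrite ?y0 ?expf_neq0 ?oner_neq0 ?y0.
  split; last exact: (reversal_eq0 hr e2).
  apply: (reversal_eq0 hp); apply/eqP; move/eqP: e1.
  by rewrite mulf_eq0 expf_eq0 polyX_eq0 andbF orbF.
- move=> x; have [p [r [d [d0 ->]]]] := dc_span hDC x.
  pose N := maxn (size d) (maxn (size p) (size r)).
  have hd : (size d <= N.+1)%N by rewrite leqW // leq_maxl.
  have hp : (size p <= N.+1)%N by rewrite leqW // /N !leq_max leqnn orbT.
  have hr : (size r <= N.+1)%N by rewrite leqW // /N !leq_max leqnn !orbT.
  exists (reversal N p * 'X^m), (reversal N r), (reversal N d * 'X^m).
  have rd0 : reversal N d != 0.
    by apply: contra_neq d0; apply: reversal_eq0.
  split; first by rewrite mulf_neq0 // expf_neq0 // polyX_eq0.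
  have ed0 := dc_neq0 hDC d0.
  move: ed0; rewrite !(evp_reversal iota y0 hp, evp_reversal iota y0 hr,
    evp_reversal iota y0 hd) !evpM !evpXn mulf_eq0 negb_or => /andP [_ ed0].
  by rewrite exprVn; field; rewrite ?ed0 ?expf_neq0.
Qed.

Let hDC' := double_cover_inf.

Variable E : L -> L.
Hypotheses (hE : derivation iota E) (Ey : E y = w).

(** Here $2wDw=g'Dy=g'w$, so $Dw=g'/2$ is a polynomial in $y$; hence $D$ preserves the local rings
    of all points. *)
Lemma derivation_w_el (y1 w1 : L) g1 D : double_cover y1 w1 g1 ->
  simple_roots g1 -> derivation iota D -> D y1 = w1 ->
  exists s, D w1 = el iota y1 w1 s.
Proof.
move=> h1 hg1 hD e; exists (2%:R^-1%:P * g1^`(), 0).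
have w10 := w_neq0 h1 hg1; have := derivation_w h1 hD; rewrite e => e2.
have two0 : (2%:R : L) != 0.
  by rewrite -(rmorph_nat iota) fmorph_eq0 pnatr_eq0.
apply: (mulfI two0); apply: (mulIf w10).
rewrite el_poly evpM evpC fmorphV rmorph_nat mulVKf // -e2; ring.
Qed.

Lemma regular_form_affine f : regular_form iota y f ->
  exists p r, f * w = evp y p + evp y r * w.
Proof.
move=> hf; apply: (integral_everywhere hDC hg) => a b hb.
suff : point_ring y w a b (f * E y) by rewrite Ey.
apply: (hf _ (point_place hDC hb hg) _ hE).
apply: (point_derivation hDC hb hE).
  by exists (0, 1); rewrite el_w.
exact: (derivation_w_el hDC hg hE Ey).
Qed.

(* In the coordinate 1 / y, the derivation - y^(2-m) E plays the role of E. *)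
Lemma regular_form_inf f b : b ^+ 2 = g'.[0] -> regular_form iota y f ->
  point_ring y^-1 (w / y ^+ m) 0 b (y ^+ (2 - m) * (f * w)).
Proof.
move=> hb hf; pose D x := - y ^+ (2 - m) * E x.
have hD : derivation iota D := derivation_scale _ hE.
have Du : D y^-1 = w / y ^+ m.
  rewrite /D (derV hE) Ey.
  have -> : y ^+ 2 = y ^+ (2 - m) * y ^+ m by rewrite -exprD subnK.
  by field; rewrite ?y0 ?expf_neq0 ?oner_neq0 ?y0.
have : point_ring y^-1 (w / y ^+ m) 0 b (f * D y).
  apply: (hf _ (point_place hDC' hb hg') _ hD).
  apply: (point_derivation hDC' hb hD).
    by exists (0, 1); rewrite el_w.
  exact: (derivation_w_el hDC' hg' hD Du).
rewrite /D Ey => /(point_opp (iota := iota)); congr point_ring; ring.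
Qed.

Lemma regular_form_const f : regular_form iota y f ->
  exists c, f * w = iota c /\ (m = 1%N -> c = 0).
Proof.
move=> hf; have [p [r e]] := regular_form_affine hf.
pose k := maxn (size p) (size r).
have hp : (size p <= k.+1)%N by rewrite leqW // leq_maxl.
have hr : (size r <= k.+1)%N by rewrite leqW // leq_maxr.
(* With $u=1/y$, $v=w/y^m$ and $\tilde p,\tilde r$ the reversals,
   $y^{2-m}(p+rw)=u^{-(k+2)}(u^m\tilde p(u)+\tilde r(u)v)$; regularity at $u=0$ cancels the whole
   pole. *)
have [|p' [r' [ep er]]] := @regular_divides _ _ _ hDC' hg' 0 (k + 2)%N
    (reversal k p * 'X^m) (reversal k r).
  move=> b hb; have := regular_form_inf hb hf; congr point_ring.
  rewrite e (evp_reversal iota y0 hp) (evp_reversal iota y0 hr) subr0 evpM !evpXn.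
  have -> : y ^+ (2 - m) = y ^+ 2 / y ^+ m.
    by apply: (canRL (mulfK _)); rewrite ?expf_neq0 // -exprD subnK.
  by rewrite !exprVn exprD; field; rewrite ?y0 ?expf_neq0 ?oner_neq0 ?y0.
rewrite subr0 in ep er.
(* $u^{k+2}$ divides $\tilde r$, of degree at most $k$. *)
have r0 : r = 0.
  apply: (reversal_eq0 hr); apply/eqP; apply: contraT => rr0.
  have r'0 : r' != 0 by apply: contraNneq rr0 => e0; rewrite er e0 mulr0.
  have := size_reversal k r; rewrite er mulrC size_Mmonic ?monicXn // size_polyXn.
  by rewrite addnS -pred_Sn addn2 leqNgt leq_addl.
have pk i : (i + m < k + 2)%N -> (reversal k p)`_i = 0.
  move=> hi; have := congr1 (fun s : {poly C} => s`_(i + m)) ep.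
  by rewrite coefMXn ltnNge leq_addl /= addnK => ->; rewrite coefXnM hi.
(* The coefficient of $y^i$ in $p$ is that of $u^{k-i}$ in $\tilde p$, killed when $i>m-2$: only the
   constant term survives for $m=2$, and nothing for $m=1$. *)
have p0 i : (0 < i)%N || (m == 1%N) -> p`_i = 0.
  move=> hi; have [lik|lki] := leqP i k; last by rewrite nth_default // (leq_trans hp).
  have := pk (k - i)%N; rewrite coef_poly ltnS leq_subr subKn //; apply.
  rewrite addn2 ltnS; case/orP: hi => [i0|/eqP->]; last by rewrite addn1 ltnS leq_subr.
  apply: leq_trans (leq_add (leq_sub2l k i0) m_le2) _.
  by rewrite subn1 addn2 prednK // (leq_trans i0).
exists p`_0; split; last by move=> m1; apply: p0; rewrite m1.
have -> : p`_0 = p.[0] by rewrite horner_coef0.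
have ep0 : p = (p`_0)%:P.
  apply/polyP => -[|i]; first by rewrite coefC.
  by rewrite coefC p0.
by rewrite e r0 evp0 mul0r addr0 {1}ep0 evpC horner_coef0.
Qed.

(** A place contains $y$ or $1/y$. For $m=2$ the form is, up to sign, the same in both charts:
    $d(1/y)/(w/y^2)=-dy/w$. *)
Lemma holomorphic_form c : m = 2%N -> regular_form iota y (iota c / w).
Proof.
move=> m2 O hO D hD OD.
have [OC OB OV _] := hO.
have [_ OM'] := OB _ _ (OC 0) (OC 0).
rewrite mulrAC -mulrA; apply: (proj2 (OB _ _ (OC c) _)).
have [Oy|Oy] := OV y y0; first exact: (holomorphic hDC hg hO hD OD Oy).
have := holomorphic hDC' hg' hO hD OD Oy.
rewrite (derV hD) m2; set z := _ / _ => Oz.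
have w0 := w_neq0 hDC hg.
have -> : D y / w = 0 - z by rewrite /z; field; rewrite w0 y0.
by have [] := OB _ _ (OC 0) Oz; rewrite rmorph0.
Qed.

Lemma y_not_const c : y <> iota c.
Proof.
move=> e; have : evp y ('X - c%:P) != 0 by rewrite (dc_neq0 hDC) // polyXsubC_eq0.
by rewrite evpB evpX evpC e subrr eqxx.
Qed.

Lemma genus0_double_cover : m = 1%N -> genus iota 0.
Proof.
move=> m1; exists y; split; first exact: y_not_const.
exists [tuple]; split=> [f|c _ []] //; split.
  move=> /regular_form_const [c [e /(_ m1) c0]]; exists (fun _ => 0).
  rewrite big_ord0; apply: (mulIf (w_neq0 hDC hg)).
  by rewrite e c0 rmorph0 mul0r.
case=> c ->; rewrite big_ord0 => O [OC _ _ _] D _ _.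
by rewrite mul0r -(rmorph0 iota); apply: OC.
Qed.

Lemma genus1_double_cover : m = 2%N -> genus iota 1.
Proof.
have w0 := w_neq0 hDC hg.
move=> m2; exists y; split; first exact: y_not_const.
exists [tuple w^-1]; split=> [f|c].
  split.
    move=> /regular_form_const [c [e _]]; exists (fun _ => c).
    by rewrite big_ord1 -e tnth0 mulfK.
  by case=> c ->; rewrite big_ord1 tnth0; apply: holomorphic_form.
rewrite big_ord1 tnth0 => /eqP; rewrite mulf_eq0 invr_eq0 (negbTE w0) orbF.
by rewrite fmorph_eq0 => /eqP c0 i; rewrite ord1.
Qed.

End Infinity.

End Genus.

(** * Construction of a double cover with its derivation *)

Lemma quadratic_extension (F : fieldType) (g : F) :
  (forall x, x ^+ 2 <> g) ->
  exists (L : fieldType) (inj : {rmorphism F -> L}) (w : L),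
    w ^+ 2 = inj g /\ forall x, exists a b, x = inj a + inj b * w.
Proof.
move=> hg; pose P : {poly F} := 'X^2 - g%:P.
have sP : size P = 3 by rewrite size_polyDl ?size_polyN size_polyXn // size_polyC; case: eqP.
have irr : irreducible_poly P.
  apply: cubic_irreducible; first by rewrite sP.
  move=> x; apply/negP; rewrite /root !hornerE subr_eq0 => /eqP; exact: hg.
have [L _ [z rz adj]] := irredp_FAdjoin irr.
exists L, (in_alg L), z; split.
  move: rz; rewrite rmorphB /= map_polyXn map_polyC /root !hornerE subr_eq0.
  by move/eqP.
move=> x; have : x \in <<1; z>>%VS by rewrite adj memvf.
case/Fadjoin_polyP => p /polyOver1P [q ->] ->.
have mP : P \is monic by rewrite monicE lead_coefDl ?lead_coefXn // size_polyN size_polyXn size_polyC; case: eqP.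
have -> : q = (divp q P) * P + modp q P by rewrite -divp_eq.
rewrite rmorphD rmorphM hornerD hornerM (eqP rz) mulr0 add0r.
have sz : (size (modp q P) <= 2)%N.
  have : (size (modp q P) < size P)%N by rewrite ltn_modp monic_neq0.
  by rewrite sP.
exists (modp q P)`_0, (modp q P)`_1.
rewrite (horner_coef_wide _ (n := 2)) ?size_map_poly //.
by rewrite !big_ord_recl big_ord0 /= !coef_map /= expr0 mulr1 addr0 expr1.
Qed.

Section Existence.
Variables (C : numClosedFieldType) (g : {poly C}).
Hypotheses (hg : simple_roots g) (sz_g : (1 < size g)%N).
Local Notation F := {fraction {poly C}}.

(** Descent at a simple root $a$ of $g$: $X-a$ divides $n$, then also $d$, and cancelling it lowers
    the degree of $d$. *)
Lemma not_square_poly (n d : {poly C}) : d != 0 -> n ^+ 2 <> g * d ^+ 2.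
Proof.
have [a ga] : exists a, root g a by apply/closed_rootP; rewrite neq_ltn sz_g orbT.
have [g1 eg] := XsubC_factor ga.
have g1a : ~~ root g1 a.
  have := hg ga; rewrite /root eg derivM derivB derivX derivC !hornerE.
  by rewrite subrr mul0r addr0 subr0 mul1r.
have Xa0 : 'X - a%:P != 0 by rewrite polyXsubC_eq0.
have [k] := ubnP (size d); elim: k n d => // k IH n d hk d0 e.
have na : root n a.
  have : root (n ^+ 2) a by rewrite e rootM ga.
  by rewrite expr2 rootM orbb.
have [n1 en] := XsubC_factor na.
have e1 : ('X - a%:P) * n1 ^+ 2 = g1 * d ^+ 2.
  apply: (mulfI Xa0).
  have -> : ('X - a%:P) * (('X - a%:P) * n1 ^+ 2) = (('X - a%:P) * n1) ^+ 2 by ring.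
  by rewrite -en e eg -mulrA.
have da : root d a.
  have : root (g1 * d ^+ 2) a by rewrite -e1 rootM root_XsubC eqxx.
  by rewrite rootM (negbTE g1a) expr2 rootM orbb.
have [d1 ed] := XsubC_factor da.
have d10 : d1 != 0 by apply: contraNneq d0 => e0; rewrite ed e0 mulr0.
apply: (IH n1 d1 _ d10); last first.
  by apply: (mulfI Xa0); rewrite e1 ed eg exprMn expr2; ring.
move: hk; rewrite ed size_proper_mul ?size_XsubC //.
by rewrite lead_coefXsubC mul1r lead_coef_eq0.
Qed.

Lemma not_square (x : F) : x ^+ 2 <> g%:F.
Proof.
have [n [d [d0 ->]]] := frac_exP x; have dF : d%:F != 0 by rewrite tofrac_eq0.
move=> e; apply: (@not_square_poly n d d0); apply/eqP.
rewrite -tofrac_eq (tofracXn 2 n) (tofracM g) (tofracXn 2 d) -e -exprMn.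
by rewrite -[n%:F / d%:F * d%:F]mulrA mulVf // mulr1.
Qed.

Lemma double_cover_exists : exists (L : fieldType) (iota : {rmorphism C -> L})
    (y w : L), double_cover iota y w g /\
  exists E, derivation iota E /\ E y = w.
Proof.
have [L [inj [w [hw span]]]] := quadratic_extension not_square.
pose io : {rmorphism C -> L} := inj \o (@tofrac _) \o (@polyC C).
pose y := inj ('X%:F).
have ev p : evp io y p = inj (p%:F).
  elim/poly_ind: p => [|p c IH]; first by rewrite evp0 tofrac0 rmorph0.
  by rewrite evpD evpM evpX evpC IH tofracD tofracM rmorphD rmorphM.
have free (a b : F) : inj a + inj b * w = 0 -> a = 0 /\ b = 0.
  have [->|b0] := eqVneq b 0.
    by rewrite rmorph0 mul0r addr0 => /eqP; rewrite fmorph_eq0 => /eqP.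
  move=> e; case: (@not_square (- (a / b))).
  have bL : inj b != 0 by rewrite fmorph_eq0.
  apply: (fmorph_inj inj); rewrite -hw rmorphXn rmorphN fmorph_div.
  congr (_ ^+ 2); rewrite -mulNr; apply: (canLR (mulfK bL)).
  by apply: oppr_inj; rewrite opprK; apply/eqP; rewrite -addr_eq0 mulrC e.
have uniq (a b a' b' : F) : inj a + inj b * w = inj a' + inj b' * w ->
    a = a' /\ b = b'.
  move=> e; have [] : a - a' = 0 /\ b - b' = 0.
    apply: free; rewrite !rmorphB.
    have -> : inj a - inj a' + (inj b - inj b') * w =
      (inj a + inj b * w) - (inj a' + inj b' * w) by ring.
    by rewrite e subrr.
  by move=> /subr0_eq-> /subr0_eq->.
exists L, io, y, w; split.
  split.
  - by rewrite ev hw.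
  - move=> p r; rewrite !ev => /free [/eqP + /eqP].
    by rewrite !tofrac_eq0 => /eqP-> /eqP->.
  - move=> x; have [a [b ->]] := span x.
    have [p [d [d0 ->]]] := frac_exP a; have [r [e [e0 ->]]] := frac_exP b.
    exists (p * e), (r * d), (d * e); rewrite mulf_neq0 //; split=> //.
    rewrite !ev !tofracM !rmorphM !fmorphV.
    have : inj d%:F != 0 by rewrite fmorph_eq0 tofrac_eq0.
    have : inj e%:F != 0 by rewrite fmorph_eq0 tofrac_eq0.
    by move=> e0' d0'; field; rewrite e0' d0'.
have coords x : exists ab : F * F, x == inj ab.1 + inj ab.2 * w.
  by have [a [b ->]] := span x; exists (a, b).
pose co x := xchoose (coords x).
have coordsE x : x = inj (co x).1 + inj (co x).2 * w := eqP (xchooseP (coords x)).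
have [d [dD dM dC]] : exists d : F -> F,
    [/\ forall a b, d (a + b) = d a + d b,
      forall a b, d (a * b) = d a * b + a * d b &
      forall p : {poly C}, d p%:F = (p^`())%:F].
  exists (fracder (@deriv C)); split.
  - exact: (fracderD (@derivD C) (@derivM C)).
  - exact: (fracderM (@derivM C)).
  - exact: (fracder_tofrac (@derivM C)).
pose G := inj (g^`()%:F).
have dg : inj (d g%:F) = G by rewrite dC.
(* $E$ is $w\,d/dy$, so $Ew=g'/2$ is forced by $w^2=g$. It is defined on chosen components, which
   [uniq] shows to be the only ones. *)
pose E x := inj (d (co x).1) * w + inj (d (co x).2) * w ^+ 2
   + inj (co x).2 * (G / 2%:R).
have EE (a b : F) : E (inj a + inj b * w) =
    inj (d a) * w + inj (d b) * w ^+ 2 + inj b * (G / 2%:R).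
  by rewrite /E; have [<- <-] := uniq _ _ _ _ (coordsE (inj a + inj b * w)).
have inj1 a : inj a = inj a + inj 0 * w by rewrite rmorph0 mul0r addr0.
have d0 : d 0 = 0 by rewrite -tofrac0 dC deriv0 tofrac0.
exists E; split; last first.
  by rewrite /y inj1 EE dC derivX d0 rmorph0 !mul0r !addr0 tofrac1 rmorph1 mul1r.
split=> [x x'|x x'|c].
- rewrite (coordsE x) (coordsE x'); set a := (co x).1; set b := (co x).2.
  set a' := (co x').1; set b' := (co x').2.
  have -> : inj a + inj b * w + (inj a' + inj b' * w) =
    inj (a + a') + inj (b + b') * w by rewrite !rmorphD; ring.
  by rewrite !EE !dD !rmorphD; ring.
- rewrite (coordsE x) (coordsE x'); set a := (co x).1; set b := (co x).2.
  set a' := (co x').1; set b' := (co x').2.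
  have -> : (inj a + inj b * w) * (inj a' + inj b' * w) =
    inj (a * a' + b * b' * g%:F) + inj (a * b' + b * a') * w.
    by rewrite !rmorphD !rmorphM -hw; ring.
  rewrite !EE !dD !dM !rmorphD !rmorphM dg -hw.
  have two0 : (2%:R : L) != 0.
    by rewrite -(rmorph_nat io) fmorph_eq0 pnatr_eq0.
  by field.
- by rewrite [io c]inj1 EE dC derivC d0 tofrac0 rmorph0 !mul0r !addr0.
Qed.

End Existence.

(** * Plane curves quadratic in one variable *)

Section QuadraticCurve.
Variable C : numClosedFieldType.
Local Notation M := {mpoly C[2]}.
Local Notation PP := {poly {poly C}}.
Implicit Types (p r : {poly C}).

Definition i0 : 'I_2 := @Ordinal 2 0 isT.
Definition i1 : 'I_2 := @Ordinal 2 1 isT.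

Definition emb p : M := (map_poly (@mpolyC 2 C) p).['X_i0].

Lemma embD p r : emb (p + r) = emb p + emb r.
Proof. by rewrite /emb rmorphD hornerD. Qed.
Lemma embM p r : emb (p * r) = emb p * emb r.
Proof. by rewrite /emb rmorphM hornerM. Qed.
Lemma embC c : emb c%:P = c%:MP.
Proof. by rewrite /emb map_polyC hornerC. Qed.
Lemma embX : emb 'X = 'X_i0.
Proof. by rewrite /emb map_polyX hornerX. Qed.

HB.instance Definition _ := GRing.RMorphism.copy emb
  (horner_eval ('X_i0 : M) \o map_poly (@mpolyC 2 C)).

Lemma meval_emb x s p : (emb p).@[fun i => if i == i0 then x else s] = p.[x].
Proof.
elim/poly_ind: p => [|p c IH]; first by rewrite -polyC0 embC mevalC hornerC.
by rewrite embD embM embC embX mevalD mevalM mevalC mevalXU IH !hornerE.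
Qed.

Lemma emb_neq0 p : p != 0 -> emb p != 0.
Proof.
move=> /poly_nonroot [x]; apply: contraNneq => e.
by rewrite -(meval_emb x 0) e meval0.
Qed.

(* Identifies C[y][z] with C[y,z]. *)
Definition psi (P : PP) : M := (map_poly emb P).['X_i1].

Lemma psiD P Q : psi (P + Q) = psi P + psi Q.
Proof. by rewrite /psi rmorphD hornerD. Qed.
Lemma psiM P Q : psi (P * Q) = psi P * psi Q.
Proof. by rewrite /psi rmorphM hornerM. Qed.
Lemma psiC p : psi p%:P = emb p.
Proof. by rewrite /psi map_polyC hornerC. Qed.
Lemma psiX : psi 'X = 'X_i1.
Proof. by rewrite /psi map_polyX hornerX. Qed.

Lemma psi_surj a : exists P, a = psi P.
Proof.
elim/mpoly_ring_ind: a => [c|i|a b [P ->] [Q ->]|a b [P ->] [Q ->]].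
- by exists c%:P%:P; rewrite psiC embC.
- case: i => [[|[|//]] hi].
    by exists 'X%:P; rewrite psiC embX; congr 'X_(_); apply: val_inj.
  by exists 'X; rewrite psiX; congr 'X_(_); apply: val_inj.
- by exists (P + Q); rewrite psiD.
- by exists (P * Q); rewrite psiM.
Qed.

Variables (l m n e g : {poly C}).
Hypotheses (l0 : l != 0) (e0 : e != 0).
Hypothesis disc : m ^+ 2 - 4%:R * l * n = e ^+ 2 * g.
Hypothesis prim : forall a, ~ [/\ root l a, root m a & root n a].

Definition quadratic : PP := l%:P * 'X^2 + m%:P * 'X + n%:P.

Lemma pseudo_division (P : PP) : exists k (Q : PP) (r1 r0 : {poly C}),
  (l ^+ k)%:P * P = Q * quadratic + (r1%:P * 'X + r0%:P).
Proof.
elim/poly_ind: P => [|P c [k [Q [r1 [r0 h]]]]].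
  by exists 0%N, 0, 0, 0; rewrite !polyC0; ring.
exists k.+1, (l%:P * Q * 'X + r1%:P), (l * r0 - r1 * m), (l ^+ k.+1 * c - r1 * n).
have -> : (l ^+ k.+1)%:P * (P * 'X + c%:P) =
   l%:P * 'X * ((l ^+ k)%:P * P) + (l ^+ k.+1 * c)%:P.
  by rewrite exprS !polyCM; ring.
rewrite h /quadratic !(polyCB, polyCM); ring.
Qed.

(** Gauss's lemma. At a root $a$ of $d$ the quadratic stays nonzero by [prim], so evaluating the
    coefficients at $a$ forces $X-a$ to divide $Q$. *)
Lemma quadratic_primitive (d : {poly C}) (P Q : PP) : d != 0 ->
  d%:P * P = Q * quadratic -> exists Q', P = Q' * quadratic.
Proof.
have [k] := ubnP (size d); elim: k d P Q => // k IH d P Q hk d0 h.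
have [sz|sz] := leqP (size d) 1.
  have [c c0 ed] : exists2 c, c != 0 & d = c%:P.
    by apply/size_poly1P; rewrite eqn_leq sz size_poly_gt0.
  exists ((c^-1)%:P%:P * Q); rewrite -mulrA -h mulrA ed -!polyCM mulVf //.
  by rewrite !polyC1 mul1r.
have [a da] : exists a, root d a by apply/closed_rootP; rewrite neq_ltn sz orbT.
have [d1 ed] := XsubC_factor da.
have d10 : d1 != 0 by apply: contraNneq d0 => z; rewrite ed z mulr0.
pose ev := map_poly (horner_eval a).
have evq : ev quadratic != 0.
  apply/eqP => z; case: (@prim a).
  have co i : (ev quadratic)`_i = (quadratic`_i).[a] by rewrite coef_map.
  have q2 : quadratic`_2 = l.
    by rewrite /quadratic !coefD !coefCM coefXn coefX coefC /=; ring.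
  have q1 : quadratic`_1 = m.
    by rewrite /quadratic !coefD !coefCM coefXn coefX coefC /=; ring.
  have q0 : quadratic`_0 = n.
    by rewrite /quadratic !coefD !coefCM coefXn coefX coefC /=; ring.
  by rewrite /root -{1}q2 -q1 -q0 -!co z !coef0 eqxx.
have evQ : ev Q = 0.
  have := congr1 ev h; rewrite /ev !rmorphM /= map_polyC /= /horner_eval (eqP da).
  rewrite polyC0 mul0r => /esym/eqP; rewrite mulf_eq0 (negbTE evq) orbF.
  by move/eqP.
have [Q1 eQ] : exists Q1, Q = ('X - a%:P)%:P * Q1.
  have fac i : exists r, Q`_i == ('X - a%:P) * r.
    have : root Q`_i a.
      have := congr1 (fun s : {poly C} => s`_i) evQ.
      by rewrite coef_map coef0 /= /horner_eval => /eqP.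
    by case/XsubC_factor => r ->; exists r.
  exists (\poly_(i < size Q) xchoose (fac i)); apply/polyP => i.
  rewrite coefCM coef_poly; case: ltnP => hi; last by rewrite mulr0 nth_default.
  exact: (eqP (xchooseP (fac i))).
apply: (IH d1 P Q1 _ d10); last first.
  have Xa0 : ('X - a%:P)%:P != 0 :> PP by rewrite polyC_eq0 polyXsubC_eq0.
  by apply: (mulfI Xa0); rewrite !mulrA -eQ -h ed polyCM.
move: hk; rewrite ed size_proper_mul ?size_XsubC //.
by rewrite lead_coefXsubC mul1r lead_coef_eq0.
Qed.

Variables (L : fieldType) (iota : {rmorphism C -> L}) (y w : L).
Hypotheses (hDC : double_cover iota y w g).
Local Notation ev := (evp iota y).
Let z := (ev e * w - ev m) / (2%:R * ev l).
Let v (i : 'I_2) : L := if i == i0 then y else z.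

Lemma mmap_mul (a b : M) : mmap iota v (a * b) = mmap iota v a * mmap iota v b.
Proof. exact: rmorphM. Qed.
Lemma mmap_var i : mmap iota v 'X_i = v i.
Proof. by rewrite mmapX mmap1U. Qed.

Lemma mmap_emb p : mmap iota v (emb p) = ev p.
Proof.
elim/poly_ind: p => [|p c IH].
  by rewrite -polyC0 embC mmapC evpC.
by rewrite embD embM embC embX mmapD mmap_mul mmapC mmap_var IH evpD evpM evpX evpC.
Qed.

Let two0 : (2%:R : L) != 0.
Proof. by rewrite -(rmorph_nat iota) fmorph_eq0 pnatr_eq0. Qed.
Let el0 : ev l != 0. Proof. exact: (dc_neq0 hDC). Qed.
Let ee0 : ev e != 0. Proof. exact: (dc_neq0 hDC). Qed.

Lemma z_linear : 2%:R * ev l * z = ev e * w - ev m.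
Proof. by rewrite /z mulrC divfK // mulf_neq0. Qed.

Lemma psi_quadratic :
  psi quadratic = emb l * 'X_i1 ^+ 2 + emb m * 'X_i1 + emb n.
Proof.
by rewrite /quadratic (expr2 ('X : PP)) (expr2 ('X_i1 : M)) !psiD !psiM !psiC psiX.
Qed.

Lemma mmap_psi_linear r1 r0 :
  mmap iota v (psi (r1%:P * 'X + r0%:P)) = ev r1 * z + ev r0.
Proof.
by rewrite psiD psiM !psiC psiX mmapD mmap_mul mmap_var !mmap_emb.
Qed.

Lemma mmap_quadratic : mmap iota v (psi quadratic) = 0.
Proof.
rewrite psi_quadratic (expr2 ('X_i1 : M)) !mmapD !mmap_mul !mmap_var !mmap_emb.
have hz := z_linear; have hw := dc_w2 hDC.
have four0 : 4%:R * ev l != 0 :> L.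
  by rewrite (natrM _ 2 2) !mulf_neq0.
apply: (mulfI four0); rewrite mulr0.
have -> : 4%:R * ev l * (ev l * (z * z) + ev m * z + ev n) =
  (2%:R * ev l * z + ev m) ^+ 2 - ev (m ^+ 2 - 4%:R * l * n).
  by rewrite !expr2 evpB !evpM -(rmorph_nat (@polyC C)) evpC rmorph_nat; ring.
rewrite hz subrK disc !expr2 !evpM -hw; ring.
Qed.

(** The remainder $r_1z+r_0$ of a pseudo-division must vanish, whence $r_1=r_0=0$ as $1,w$ are free;
    Gauss's lemma then removes the power of $l$ that the pseudo-division introduced. *)
Lemma kernel_quadratic a :
  mmap iota v a = 0 <-> exists b, a = b * psi quadratic.
Proof.
split; last by case=> b ->; rewrite mmap_mul mmap_quadratic mulr0.
have [P ->] := psi_surj a; have [k [Q [r1 [r0 h]]]] := pseudo_division P.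
move=> hP; have : ev r1 * z + ev r0 = 0.
  rewrite -mmap_psi_linear; have := congr1 (fun R => mmap iota v (psi R)) h.
  by rewrite psiD !psiM mmapD !mmap_mul hP mmap_quadratic !mulr0 add0r => <-.
move=> e1; have : ev (2%:R%:P * l * r0 - r1 * m) + ev (r1 * e) * w = 0.
  have := congr1 (fun x => 2%:R * ev l * x) e1; rewrite mulr0 => <-.
  rewrite evpB !evpM evpC rmorph_nat.
  have -> : 2%:R * ev l * (ev r1 * z + ev r0) =
    ev r1 * (2%:R * ev l * z) + 2%:R * ev l * ev r0 by ring.
  by rewrite z_linear; ring.
case/(dc_free hDC) => h0 /eqP; rewrite mulf_eq0 (negbTE e0) orbF => /eqP r10.
have r00 : r0 = 0.
  apply/eqP; move/eqP: h0; rewrite r10 mul0r subr0 !mulf_eq0 (negbTE l0) orbF.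
  by rewrite polyC_eq0 pnatr_eq0.
rewrite r10 r00 !polyC0 mul0r !addr0 in h.
have lk0 : l ^+ k != 0 by rewrite expf_neq0.
by have [Q' ->] := quadratic_primitive lk0 h; exists (psi Q'); rewrite psiM.
Qed.

Lemma function_field_quadratic : function_field iota (psi quadratic) v.
Proof.
split; first exact: kernel_quadratic.
move=> h; have [p [r [d [d0 ->]]]] := dc_span hDC h.
exists (psi ((2%:R%:P * r * l)%:P * 'X + (p * e + r * m)%:P)), (emb (d * e)).
rewrite mmap_psi_linear mmap_emb; have ed0 : ev d != 0 := dc_neq0 hDC d0.
split; first by rewrite evpM mulf_neq0.
rewrite evpD !evpM evpC rmorph_nat.
have -> : 2%:R * ev r * ev l * z = ev r * (2%:R * ev l * z) by ring.
by rewrite z_linear; field; rewrite ee0 ed0.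
Qed.

Lemma psi_quadratic_neq0 : psi quadratic != 0.
Proof.
have [x lx] := poly_nonroot l0.
apply/eqP => z0.
have val s : l.[x] * s ^+ 2 + m.[x] * s + n.[x] = 0.
  have := congr1 (meval (fun i => if i == i0 then x else s)) z0.
  by rewrite psi_quadratic meval0 expr2 !mevalD !mevalM !mevalXU !meval_emb /= expr2.
(* The second difference at $s=1,0,-1$ isolates the leading coefficient. *)
have : 2%:R * l.[x] == 0.
  have -> : 2%:R * l.[x] = (l.[x] * 1 ^+ 2 + m.[x] * 1 + n.[x]) +
    (l.[x] * (-1) ^+ 2 + m.[x] * -1 + n.[x]) -
    2%:R * (l.[x] * 0 ^+ 2 + m.[x] * 0 + n.[x]) by ring.
  by rewrite !val mulr0 addr0 subr0.
by rewrite mulf_eq0 pnatr_eq0 (negbTE lx).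
Qed.

(** In a factorization one factor vanishes at the generic point, since [L] is a field; that factor
    is then a multiple of the whole polynomial, and the other one is a constant. *)
Lemma irreducible_quadratic : irreducible_mpoly (psi quadratic).
Proof.
have f0 := psi_quadratic_neq0.
split.
  rewrite ltnNge; apply/negP => /msize1_polyC ec.
  have := mmap_quadratic; rewrite ec mmapC => /eqP; rewrite fmorph_eq0 => /eqP c0.
  by move: f0; rewrite ec c0 mpolyC0 eqxx.
have unit_of_factor a b : psi quadratic = a * b -> mmap iota v a = 0 ->
    (msize b <= 1)%N.
  move=> eab /kernel_quadratic [b' ea].
  have : 1 = b' * b.
    apply: (mulfI f0); rewrite mulr1 {1}eab ea; ring.
  move=> e1; have b'0 : b' != 0 by apply: contra_eq_neq e1 => ->; rewrite mul0r oner_eq0.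
  have b0 : b != 0 by apply: contra_eq_neq e1 => ->; rewrite mulr0 oner_eq0.
  have := congr1 (fun s : M => msize s) e1; rewrite msize1 msizeM //.
  have : (0 < msize b')%N by rewrite lt0n msize_poly_eq0.
  by case: (msize b') => // s _; rewrite addSn /= => e1'; apply: (leq_trans (leq_addl s (msize b))); rewrite -e1'.
move=> a b eab; have := mmap_quadratic; rewrite eab mmap_mul => /eqP.
rewrite mulf_eq0 => /orP [/eqP h|/eqP h].
  by rewrite (unit_of_factor _ _ eab h) orbT.
by rewrite mulrC in eab; rewrite (unit_of_factor _ _ eab h).
Qed.

End QuadraticCurve.

(* The curve l z^2 + m z + n = 0 is the double cover w^2 = g(y) of the y-line,
   with e w = 2 l z + m; its genus is k as g has 2k + 2 simple zeros, counting
   infinity. *)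
Theorem quadratic_curve_genus (C : numClosedFieldType) (l m n e g : {poly C}) k
    (f : {mpoly C[2]}) :
  l != 0 -> e != 0 -> m ^+ 2 - 4%:R * l * n = e ^+ 2 * g ->
  (forall a, ~ [/\ root l a, root m a & root n a]) ->
  (1 < size g)%N -> (size g <= (2 * k.+1).+1)%N -> (k < 2)%N ->
  simple_roots g -> simple_roots (reversal (2 * k.+1) g) ->
  f = emb l * 'X_i1 ^+ 2 + emb m * 'X_i1 + emb n ->
  irreducible_curve_of_genus k f.
Proof.
move=> l0 e0 disc prim g1 g2 k2 hg hg' ->; rewrite -psi_quadratic.
have [L [iota [y [w [hDC [E [hE Ey]]]]]]] := double_cover_exists hg g1.
split; first exact: (irreducible_quadratic l0 e0 disc prim hDC).
exists L, iota; eexists; split; first exact: (function_field_quadratic l0 e0 disc prim hDC).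
case: k k2 g2 hg' => [|[|//]] _ g2 hg'.
  exact: (genus0_double_cover hDC hg (m := 1) _ g2 hg' hE Ey (erefl _)).
exact: (genus1_double_cover hDC hg (m := 2) _ g2 hg' hE Ey (erefl _)).
Qed.

(** * First integrals on the boundary surfaces *)

Fact cancel_theta (F : fieldType) (g theta x : F) :
  theta * x != 0 -> g * x * (theta * x)^-1 = g / theta.
Proof.
by rewrite mulf_eq0 negb_or => /andP [t0 x0]; field; rewrite t0 x0.
Qed.

Section Surface.
Variables (C : numClosedFieldType) (E : coords C).
Hypothesis J : jac_of E != 0.
Implicit Types (a b : {mpoly C[3]}) (f h : KV C).

Definition nonvanishing b := exists x : 'I_3 -> C, x o0 = 0 /\ b.@[x] != 0.
Local Notation OE := (loc E nonvanishing).

Lemma nonvanishing_mul a b :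
  nonvanishing a -> nonvanishing b -> nonvanishing (a * b).
Proof.
move=> [x [x0 hx]] [y [y0 hy]].
exact: (common_nonvanishing x0 y0 hx hy).
Qed.
Lemma nonvanishing_1 : nonvanishing 1.
Proof. by exists (fun _ => 0); rewrite meval1 oner_eq0. Qed.
Lemma nonvanishing_0 : ~ nonvanishing 0.
Proof. by case=> x [_]; rewrite meval0 eqxx. Qed.

Lemma surface_ringE f : surface_ring E f <-> OE f.
Proof.
have e : ord0 = o0 by apply: val_inj.
split.
  by case=> x [x0 [a [b [hb ->]]]]; exists a, b; split=> //; exists x; rewrite -e.
case=> a [b [[x [x0 hb]] ->]]; exists x; rewrite e; split=> //.
by exists a, b.
Qed.

Lemma surface_uniformizer_max h :
  surface_ring E h -> max_of (surface_ring E) (tnth E o0 * h).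
Proof.
move=> /surface_ringE Oh; split.
  apply/surface_ringE; apply: (locM nonvanishing_mul) => //.
  exact: (loc_coord _ nonvanishing_1).
case=> n0 _ /surface_ringE Oi.
have [a [b [hb eb]]] := locM nonvanishing_mul Oh Oi.
have b0 := denominator_neq0 J nonvanishing_0 hb.
have e : 'X_o0 * a = b.
  apply: (eval_eq J); rewrite evalM evalX.
  have -> : eval E a = h * (tnth E o0 * h)^-1 * eval E b by rewrite eb divfK.
  by rewrite !mulrA divff // mul1r.
by case: hb => x [x0]; rewrite -e mevalM mevalXU x0 mul0r eqxx.
Qed.

Lemma surface_max_divisible f : max_of (surface_ring E) f ->
  exists h, surface_ring E h /\ f = tnth E o0 * h.
Proof.
case=> /surface_ringE [a [b [hb ef]]] nu.
have b0 := denominator_neq0 J nonvanishing_0 hb.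
have [q eq] : exists q, a = 'X_o0 * q.
  apply: dvdX_vanish => x x0; apply/eqP; apply: contraT => ax; case: nu.
  have ha : nonvanishing a by exists x.
  have a0 := denominator_neq0 J nonvanishing_0 ha.
  split.
  - by rewrite ef; apply: mulf_neq0; [exact: a0 | apply: invr_neq0; exact: b0].
  - by apply/surface_ringE; exists a, b.
  - by apply/surface_ringE; exists b, a; rewrite ef invf_div.
exists (eval E q / eval E b); split.
  by apply/surface_ringE; exists q, b.
by rewrite ef eq evalM evalX mulrA.
Qed.

(** A denominator that is nonzero at one point of the surface suffices; the value of the numerator
    only records that it is a polynomial in the coordinates. *)
Definition regular f := exists num den w v v',
  [/\ polyval E w num v, polyval E w den v', w o0 = 0, v' != 0 & f = num / den].

Lemma regular_surface f : regular f -> surface_ring E f.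
Proof.
case=> num [den [w [v [v' [[a [-> _]] [b [-> <-]] w0 n0 ->]]]]].
by apply/surface_ringE; exists a, b; split=> //; exists w.
Qed.

Lemma not_max_of_value f w v : polyval E w f v -> w o0 = 0 -> v != 0 ->
  unit_of (surface_ring E) f.
Proof.
case=> a [-> <-] w0 n0; have ha : nonvanishing a by exists w.
split.
- exact: (denominator_neq0 J nonvanishing_0 ha).
- by apply/surface_ringE; exact: (loc_eval _ nonvanishing_1).
- by apply/surface_ringE; exact: loc_inv.
Qed.

Definition yz : 2.-tuple (KV C) := [tuple E`_1; E`_2].

Lemma eval_emb p : eval yz (emb p) = evp (@const C) (tnth E o1) p.
Proof.
elim/poly_ind: p => [|p c IH].
  by rewrite -polyC0 embC evalC evpC.
rewrite embD embM embC embX evalD evalM evalC evalX IH evpD evpM evpX evpC.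
by rewrite [tnth E o1](tnth_nth 0).
Qed.

Variables (k0 k1 kinf : C).
Local Notation X := (XV k0 k1 kinf).

(** [theta] generates the tangent sheaf because $\theta Xy$ is a unit of the local ring: for $g'$
    tangent, $g'/\theta=(g'Xy)/(\theta Xy)$ is regular. The unit also shows that the restricted
    field is nonzero. *)
Lemma pencil_criterion genus (theta h0 h w1 lv mv nv dv : KV C)
    (l m n0 n1 : {poly C}) wt v (bad : seq C) :
  let y := tnth E o1 in let z := tnth E o2 in
  theta * X (tnth E o0) = tnth E o0 * h0 -> regular h0 ->
  regular (theta * X y) -> regular (theta * X z) ->
  theta * X y = w1 -> polyval E wt w1 v -> wt o0 = 0 -> v != 0 ->
  evp (@const C) y l = lv -> evp (@const C) y m = mv ->
  evp (@const C) y n0 = nv -> evp (@const C) y n1 = dv ->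
  theta * X ((lv * z ^+ 2 + mv * z + nv) / dv) = tnth E o0 * h -> regular h ->
  l != 0 -> n1 != 0 ->
  (forall c, c \notin bad -> irreducible_curve_of_genus genus
     (emb l * 'X_i1 ^+ 2 + emb m * 'X_i1 + emb (n0 - c%:P * n1))) ->
  pencil_of_genus k0 k1 kinf genus E.
Proof.
move=> y z E0 R0 R1 R2 W1 V1 wt0 v0 lE mE nE dE hJ Rh l0 n10 irr.
have hD := derivation_scale theta (XV_derivation k0 k1 kinf).
have reg i : OE (theta * X (tnth E i)).
  case: i => [[|[|[|//]]] hi].
  - have -> : Ordinal hi = o0 by apply: val_inj.
    apply/surface_ringE; rewrite E0.
    by have [] := surface_uniformizer_max (regular_surface R0).
  - have -> : Ordinal hi = o1 by apply: val_inj.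
    by apply/surface_ringE; apply: regular_surface.
  - have -> : Ordinal hi = o2 by apply: val_inj.
    by apply/surface_ringE; apply: regular_surface.
have tang : tangent k0 k1 kinf (surface_ring E) theta.
  move=> f /surface_ringE hf; apply/surface_ringE.
  exact: (loc_derivation J nonvanishing_1 nonvanishing_mul nonvanishing_0 hD reg hf).
have unitU := not_max_of_value V1 wt0 v0; rewrite -W1 in unitU.
have Oy : surface_ring E y by apply/surface_ringE; apply: (loc_coord _ nonvanishing_1).
have OM (a b : KV C) : surface_ring E a -> surface_ring E b -> surface_ring E (a * b).
  move=> /surface_ringE ha /surface_ringE hb; apply/surface_ringE.
  exact: (locM nonvanishing_mul ha hb).
have [U0 U1 U2] := unitU.
have theta0 : theta != 0.
  by move: U0; apply: contra_neq => ->; rewrite mul0r.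
exists theta; split.
- split=> // g' hg'; exists (g' / theta); split; last by rewrite divfK.
  have := OM _ _ (hg' _ Oy) U2; congr (surface_ring E _).
  exact: (cancel_theta g' U0).
- move=> f /surface_max_divisible [f' [Of' ->]].
  rewrite (derM (XV_derivation k0 k1 kinf)) mulrDr mulrA E0 -mulrA.
  have -> : theta * (tnth E o0 * X f') = tnth E o0 * (theta * X f').
    by rewrite mulrCA.
  rewrite -mulrDr; apply: surface_uniformizer_max; apply/surface_ringE.
  apply: (locD J nonvanishing_mul nonvanishing_0); apply/surface_ringE.
    by apply: OM => //; apply: regular_surface.
  exact: tang.
- by exists y; split=> // -[_]; apply.
exists (emb l * 'X_i1 ^+ 2 + emb m * 'X_i1 + emb n0), (emb n1).
have Nc c : emb l * 'X_i1 ^+ 2 + emb m * 'X_i1 + emb n0 - c *: emb n1 =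
  emb l * 'X_i1 ^+ 2 + emb m * 'X_i1 + emb (n0 - c%:P * n1).
  rewrite -mul_mpolyC -embC -embM -addrA; congr (_ + _).
  by rewrite embD; congr (_ + _); rewrite -[RHS]opprK; congr (- _); rewrite /emb !rmorphN hornerN opprK.
split.
- exact: emb_neq0.
(* $N-cM$ has leading coefficient $l\neq0$ in the fibre coordinate for every $c$. *)
- move=> c; rewrite -subr_eq0 Nc -psi_quadratic; exact: psi_quadratic_neq0.
- have -> : eval [tuple E`_1; E`_2] (emb l * 'X_i1 ^+ 2 + emb m * 'X_i1 + emb n0) =
      lv * z ^+ 2 + mv * z + nv.
    have ez : tnth yz i1 = z := esym (tnth_nth 0 E o2).
    rewrite -/yz (expr2 ('X_i1 : {mpoly C[2]})) (expr2 z) !evalD !evalM evalX.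
    by rewrite !eval_emb lE mE nE ez.
  rewrite -/yz eval_emb dE hJ; apply: surface_uniformizer_max.
  exact: regular_surface.
by exists bad => c hc; rewrite Nc; apply: irr.
Qed.
End Surface.

(** * Level curves of the first integrals *)

Section LevelCurves.
Variable C : numClosedFieldType.
Implicit Types (a b c : C) (l m n e g : {poly C}).

Definition quad a b c : {poly C} := a%:P * 'X^2 + b%:P * 'X + c%:P.

Lemma coef_quad a b c i :
  (quad a b c)`_i = if i is i'.+1 then if i' is i''.+1 then
    if i'' is _.+1 then 0 else a else b else c.
Proof.
rewrite /quad !coefD !coefCM coefXn coefX coefC.
by case: i => [|[|[|i]]] /=; rewrite ?mulr0 ?mulr1 ?addr0 ?add0r.
Qed.

Lemma size_quad a b c : a != 0 -> size (quad a b c) = 3.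
Proof.
move=> a0; apply/eqP; rewrite eqn_leq; apply/andP; split.
  by apply/leq_sizeP => -[|[|[|i]]] // _; rewrite coef_quad.
rewrite ltnNge; apply/negP => /leq_sizeP /(_ 2 (leqnn 2)).
by rewrite coef_quad => /eqP; rewrite (negbTE a0).
Qed.

Lemma reversal_quad a b c : reversal 2 (quad a b c) = quad c b a.
Proof.
apply/polyP => i; rewrite coef_poly !coef_quad.
by case: i => [|[|[|i]]].
Qed.

Lemma horner_quad a b c x : (quad a b c).[x] = a * x ^+ 2 + b * x + c.
Proof. by rewrite /quad !hornerE. Qed.

Lemma deriv_quad a b c : (quad a b c)^`() = (2%:R * a)%:P * 'X + b%:P.
Proof.
rewrite /quad (expr2 'X) !derivD !derivM !derivC !derivX polyCM; ring.
Qed.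

Lemma simple_roots_quad a b c : b ^+ 2 - 4%:R * a * c != 0 ->
  simple_roots (quad a b c).
Proof.
move=> disc x; rewrite /root horner_quad deriv_quad => /eqP h1.
apply: contraNneq disc; rewrite hornerD hornerM hornerX !hornerC => h2; apply/eqP.
have -> : b ^+ 2 - 4%:R * a * c =
  (2%:R * a * x + b) ^+ 2 - 4%:R * a * (a * x ^+ 2 + b * x + c) by ring.
by rewrite h1 h2 expr0n mulr0 subr0.
Qed.

Lemma conic_level a b c l m n e (f : {mpoly C[2]}) :
  a != 0 -> b ^+ 2 - 4%:R * a * c != 0 -> l != 0 -> e != 0 ->
  m ^+ 2 - 4%:R * l * n = e ^+ 2 * quad a b c ->
  (forall x, ~ [/\ root l x, root m x & root n x]) ->
  f = emb l * 'X_i1 ^+ 2 + emb m * 'X_i1 + emb n ->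
  irreducible_curve_of_genus 0 f.
Proof.
move=> a0 disc l0 e0 h prim ef.
apply: (quadratic_curve_genus l0 e0 h prim _ _ _ _ _ ef); rewrite ?size_quad //.
  exact: simple_roots_quad.
rewrite reversal_quad; apply: simple_roots_quad.
by rewrite (_ : _ - _ = b ^+ 2 - 4%:R * a * c) //; ring.
Qed.

Section Conics.
Variables k0 k1 kinf : C.
Hypotheses (k00 : k0 != 0) (kinf0 : kinf != 0).
Let r := rho k0 k1 kinf.
Let s := k0 + (k1 - 1).

Let four0 : (4%:R : C) != 0. Proof. by rewrite pnatr_eq0. Qed.

(** $\rho$ is the product of the two values of $P^\infty$ blown up over $Q^\infty$; their sum is $s$
    and their difference $\kappa_\infty$. *)
Lemma rho_kinf : s ^+ 2 - 4%:R * r = kinf ^+ 2.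
Proof. by rewrite /s /r /rho; field. Qed.

Lemma notin2 (c a b : C) : c \notin [:: a; b] -> c - a != 0 /\ c - b != 0.
Proof. by rewrite !inE negb_or !subr_eq0 => /andP. Qed.

(** At $c=0$ the factor $X-1$ splits off; at the other two values the branch polynomial has a double
    root. *)
Lemma conic_A0 c : c \notin [:: 0;
    (2%:R * kinf * k0 - (4%:R * r - 2%:R * s * k0)) / 4%:R;
    (- 2%:R * kinf * k0 - (4%:R * r - 2%:R * s * k0)) / 4%:R] ->
  irreducible_curve_of_genus 0
    (emb (('X - 1) * ('X - 1)) * 'X_i1 ^+ 2
     + emb (- (('X - 1) * (k0%:P * ('X - 1) + (k1 - 1)%:P * 'X))) * 'X_i1
     + emb (r%:P * 'X * ('X - 1) - c%:P * 'X)).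
Proof.
rewrite in_cons negb_or => /andP [c0 /notin2 [n1 n2]].
have X1 : 'X - 1 != 0 :> {poly C} by rewrite -polyC1 polyXsubC_eq0.
(* After removal of $(X-1)^2$ the discriminant is $(sX-\kappa_0)^2-4\rho X(X-1)+4cX$. *)
pose a := s ^+ 2 - 4%:R * r; pose b := 4%:R * c + 4%:R * r - 2%:R * s * k0.
apply: (@conic_level a b (k0 ^+ 2) _ _ _ ('X - 1)) => //.
- by rewrite /a rho_kinf expf_neq0.
- rewrite /a rho_kinf.
  have -> : b ^+ 2 - 4%:R * kinf ^+ 2 * k0 ^+ 2 = 16%:R *
    ((c - (2%:R * kinf * k0 - (4%:R * r - 2%:R * s * k0)) / 4%:R) *
     (c - (- 2%:R * kinf * k0 - (4%:R * r - 2%:R * s * k0)) / 4%:R)).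
    by rewrite /b; field.
  by rewrite !mulf_neq0 // pnatr_eq0.
- by rewrite mulf_neq0.
- rewrite /quad /a /b /s; ring.
- move=> x [/eqP h1 _ /eqP h2]; move: h1 h2; rewrite !hornerE => /eqP.
  rewrite mulf_eq0 orbb subr_eq0 => /eqP->.
  by rewrite subrr mulr0 add0r mulr1 => /eqP; rewrite oppr_eq0 (negbTE c0).
Qed.

(** The branch polynomial $(y-\kappa_1)^2+4c$ has a double root only at $c=0$. *)
Lemma conic_B10 c : c \notin [:: 0] ->
  irreducible_curve_of_genus 0
    (emb 1 * 'X_i1 ^+ 2 + emb ('X - k1%:P) * 'X_i1 + emb (0 - c%:P * 1)).
Proof.
rewrite inE => c0.
apply: (@conic_level 1 (- 2%:R * k1) (k1 ^+ 2 + 4%:R * c) _ _ _ 1) => //;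
  rewrite ?oner_eq0 //.
- have -> : (- 2%:R * k1) ^+ 2 - 4%:R * 1 * (k1 ^+ 2 + 4%:R * c) = - (16%:R * c) by ring.
  by rewrite oppr_eq0 mulf_neq0 // pnatr_eq0.
- rewrite /quad; ring.
- by move=> x [h _ _]; move: h; rewrite (negbTE (root1 x)).
Qed.

Lemma conic_B0inf c : c \notin [:: 0; k0] ->
  irreducible_curve_of_genus 0
    (emb 1 * 'X_i1 ^+ 2 + emb ('X - k0%:P) * 'X_i1 + emb (0 - c%:P * 'X)).
Proof.
move=> /notin2 [n1 n2].
apply: (@conic_level 1 (4%:R * c - 2%:R * k0) (k0 ^+ 2) _ _ _ 1) => //;
  rewrite ?oner_eq0 //.
- have -> : (4%:R * c - 2%:R * k0) ^+ 2 - 4%:R * 1 * k0 ^+ 2 =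
    16%:R * ((c - 0) * (c - k0)) by ring.
  by rewrite !mulf_neq0 // pnatr_eq0.
- rewrite /quad; ring.
- by move=> x [h _ _]; move: h; rewrite (negbTE (root1 x)).
Qed.

(** The branch polynomial $y^2+(4c-2s)y+\kappa_\infty^2$ has a double root when
    $4c-2s=\pm2\kappa_\infty$. *)
Lemma conic_Binf c : c \notin [:: (s + kinf) / 2%:R; (s - kinf) / 2%:R] ->
  irreducible_curve_of_genus 0
    (emb 1 * 'X_i1 ^+ 2 + emb ('X - s%:P) * 'X_i1 + emb (r%:P - c%:P * 'X)).
Proof.
move=> /notin2 [n1 n2].
apply: (@conic_level 1 (4%:R * c - 2%:R * s) (s ^+ 2 - 4%:R * r) _ _ _ 1) => //;
  rewrite ?oner_eq0 //.
- rewrite rho_kinf.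
  have -> : (4%:R * c - 2%:R * s) ^+ 2 - 4%:R * 1 * kinf ^+ 2 =
    16%:R * ((c - (s + kinf) / 2%:R) * (c - (s - kinf) / 2%:R)) by field.
  by rewrite !mulf_neq0 // pnatr_eq0.
- rewrite /quad; ring.
- by move=> x [h _ _]; move: h; rewrite (negbTE (root1 x)).
Qed.

End Conics.

(** The discriminant is $y(4c(y-1)^2+y)$, a cubic whose fourth branch point is at infinity. Its
    quadratic factor has discriminant $1-16c$, whence the level $1/16$. *)
Lemma cubic_Ainf c : c \notin [:: 0; 16%:R^-1] ->
  irreducible_curve_of_genus 1
    (emb 'X * 'X_i1 ^+ 2 + emb 'X * 'X_i1
     + emb (0 - c%:P * (('X - 1) * ('X - 1)))).
Proof.
move=> /notin2; rewrite subr0 => -[c0 c16].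
have c40 : 4%:R * c != 0 by rewrite mulf_neq0 // pnatr_eq0.
have [h eh] : exists h, h = quad (4%:R * c) (1 - 8%:R * c) (4%:R * c) by eexists.
pose g := 'X * h.
have sg : size g = 4.
  by rewrite /g mulrC size_mulX eh ?size_quad // -size_poly_eq0 size_quad.
have simple : simple_roots g.
  move=> x; rewrite /g /root derivM derivX mul1r hornerM hornerD hornerM hornerX.
  have hE : h.[x] = 4%:R * c * x ^+ 2 + (1 - 8%:R * c) * x + 4%:R * c  by rewrite eh horner_quad.
  rewrite mulf_eq0; case/orP => [/eqP x0|/eqP hx].
    by rewrite hE x0 mul0r addr0 expr0n !mulr0 !add0r.
  rewrite hx add0r mulf_eq0 negb_or; apply/andP; split.
    by apply: contraNneq c40 => x0; rewrite -hx hE x0 expr0n !mulr0 !add0r.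
  rewrite eh; apply: (simple_roots_quad (b := 1 - 8%:R * c)); last by rewrite -eh /root hx.
  have -> : (1 - 8%:R * c) ^+ 2 - 4%:R * (4%:R * c) * (4%:R * c) =
    - 16%:R * (c - 16%:R^-1) by field.
  by rewrite mulf_neq0 // oppr_eq0 pnatr_eq0.
(* [h] is palindromic, and in degree 4 the factor $X$ is exchanged with the branch point at
   infinity. *)
have rev : reversal 4 g = g.
  apply/polyP => i; rewrite coef_poly /g eh !coefXM.
  by case: i => [|[|[|[|[|[|i]]]]]] //=; rewrite !coef_quad.
apply: (@quadratic_curve_genus C 'X 'X _ 1 g 1 _ _ _ _ _ _ _ _ simple _ (erefl _)) => //.
- by rewrite polyX_eq0.
- by rewrite oner_eq0.
- rewrite /g eh /quad; ring.
- move=> x [/eqP + _ /eqP]; rewrite hornerX => ->.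
  have -> : (0 - c%:P * (('X - 1) * ('X - 1))).[0] = - c by rewrite sub0r -!polyC1 !(hornerD, hornerN, hornerM, hornerX, hornerC); ring.
  by move/eqP; rewrite oppr_eq0 (negbTE c0).
- by rewrite sg.
- by rewrite sg.
- by rewrite rev.
Qed.

End LevelCurves.

(** * The pencils on the five boundary surfaces *)

Section Pencils.
Variables (C : numClosedFieldType) (k0 k1 kinf : C).
Hypothesis hgen : generic_parameters k0 k1 kinf.
Local Notation K := (KV C).
Local Notation t := (vt C).
Local Notation q := (vq C).
Local Notation p := (vp C).
Local Notation X := (XV k0 k1 kinf).
Local Notation c0 := (const k0).
Local Notation c1 := (const (k1 - 1)).
Local Notation k := (const k1).
Local Notation r := (const (rho k0 k1 kinf)).
Local Notation R := (vR C).
Local Notation T := (vT C).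
Local Notation S := (vS C).
Local Notation A := (vA C).
Local Notation P1 := (P1 C).
Local Notation P0 := (P0 C).
Local Notation Pinf := (Pinf C).
Local Notation P10 := (P10 C).
Local Notation two := (2%:R : K).
Let hX := XV_derivation k0 k1 kinf.
Let Xt := XV_t k0 k1 kinf.
Let Xq := XV_q k0 k1 kinf.
Let Xp := XV_p k0 k1 kinf.
Let t0 := vt_neq0 C.
Let q0 := vq_neq0 C.
Let q1 := vq1_neq0 C.

Lemma pencil_in_chart genus (x y z : K) (J : jac x y z != 0)
    (theta h0 w1 lv mv nv dv h : K) (l m n0 n1 : {poly C}) wt v (bad : seq C) :
  theta * X x = x * h0 -> regular [tuple x; y; z] h0 ->
  regular [tuple x; y; z] (theta * X z) ->
  theta * X y = w1 -> polyval [tuple x; y; z] wt w1 v -> wt o0 = 0 -> v != 0 ->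
  evp (@const C) y l = lv -> evp (@const C) y m = mv ->
  evp (@const C) y n0 = nv -> evp (@const C) y n1 = dv ->
  theta * X ((lv * z ^+ 2 + mv * z + nv) / dv) = x * h -> regular [tuple x; y; z] h ->
  l != 0 -> n1 != 0 ->
  (forall c, c \notin bad -> irreducible_curve_of_genus genus
     (emb l * 'X_i1 ^+ 2 + emb m * 'X_i1 + emb (n0 - c%:P * n1))) ->
  pencil_of_genus k0 k1 kinf genus [tuple x; y; z].
Proof.
pose E := [tuple x; y; z]; move=> h1 h2 h3 h4 h5 h6 h7 e1 e2 e3 e4 h8 h9 l0 n10 irr.
have R1 : regular E (theta * X y).
  exists w1, 1, wt, v, 1; split=> //; [exact: polyval_1 | exact: oner_neq0 |].
  by rewrite divr1.
have J' : jac_of E != 0 by rewrite jac_tuple.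
exact: (pencil_criterion J' h1 h2 R1 h3 h4 h5 h6 h7 e1 e2 e3 e4 h8 h9 l0 n10 irr).
Qed.

Lemma regular_fraction (E : coords C) (num den f : K) w v v' :
  f = num / den -> w o0 = 0 -> v' != 0 -> polyval E w den v' ->
  polyval E w num v -> regular E f.
Proof. by move=> h5 h3 h4 h2 h1; exists num, den, w, v, v'. Qed.

Lemma regular_polynomial (E : coords C) (f : K) w v :
  polyval E w f v -> w o0 = 0 -> regular E f.
Proof.
move=> h1 h2; exists f, 1, w, v, 1; split=> //; [exact: polyval_1 | exact: oner_neq0 |].
by rewrite divr1.
Qed.

Lemma polyX1_neq0 : ('X - 1) * ('X - 1) != 0 :> {poly C}.
Proof. by rewrite -polyC1 mulf_neq0 // polyXsubC_eq0. Qed.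
Lemma poly1_neq0 : 1 != 0 :> {poly C}. Proof. exact: oner_neq0. Qed.
Lemma polyX_neq0 : 'X != 0 :> {poly C}. Proof. by rewrite polyX_eq0. Qed.

Ltac evp_compute := by rewrite !(evpB, evpD, evpN, evpM, evpX, evpC, evp1, evp0).
Lemma polyval_pt3 (x y z : K) a b c :
  [/\ polyval [tuple x; y; z] (pt3 a b c) x a,
      polyval [tuple x; y; z] (pt3 a b c) y b
    & polyval [tuple x; y; z] (pt3 a b c) z c].
Proof.
split.
- exact: (polyval_coord [tuple x; y; z] (pt3 a b c) o0).
- exact: (polyval_coord [tuple x; y; z] (pt3 a b c) o1).
- exact: (polyval_coord [tuple x; y; z] (pt3 a b c) o2).
Qed.

Lemma pencil_A0 : pencil_of_conics k0 k1 kinf (surf_A0 C).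
Proof.
have [k00 kinf0] := hgen.
have J : jac t q P0 != 0 by rewrite jac_swap oppr_eq0 jacV_q_t.
have e0 : t * X t = t * 1 by rewrite Xt.
have e1 : t * X q = two * (q - 1) ^+ 2 * P0
    - (c0 * (q - 1) ^+ 2 + c1 * q * (q - 1) - t * q) := X_q_P0 t0 q1 Xq.
have e2 : t * X P0 = (- (q ^+ 2 - 1) * P0 ^+ 2
    + (c0 * (q ^+ 2 - 1) + c1 * q ^+ 2) * P0 - r * q ^+ 2) / q.
  exact: (X_P0 t0 q0 q1 hX Xq Xp).
have e3 : t * X (((q - 1) * (q - 1) * P0 ^+ 2
    + (- ((q - 1) * (c0 * (q - 1) + c1 * q))) * P0 + r * q * (q - 1)) / q) =
  t * (((q ^+ 2 - 1) * P0 ^+ 2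
    - (c0 * (q ^+ 2 - 1) + c1 * q ^+ 2) * P0 + r * q ^+ 2) / q).
  exact: (X_integral_A0 t0 q0 q1 hX Xq Xp).
have r0 := regular_polynomial (polyval_1 [tuple t; q; P0] (pt3 0 0 0)) (erefl _).
(* The point $q=1$ keeps the denominator $q$ nonzero; at the origin $tXq=-\kappa_0\neq0$, so the
   restricted field is not zero. *)
have [a1 a2 a3] := polyval_pt3 t q P0 0 1 0; have [b1 b2 b3] := polyval_pt3 t q P0 0 0 0.
have r2 : regular [tuple t; q; P0] (t * X P0).
  by eapply (regular_fraction e2 (w := pt3 0 1 0) (erefl _) (oner_neq0 C) a2); polyval_compute.
have r3 : regular [tuple t; q; P0] (((q ^+ 2 - 1) * P0 ^+ 2
    - (c0 * (q ^+ 2 - 1) + c1 * q ^+ 2) * P0 + r * q ^+ 2) / q).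
  by eapply (regular_fraction (erefl _) (w := pt3 0 1 0) (erefl _) (oner_neq0 C) a2); polyval_compute.
have v1 : polyval [tuple t; q; P0] (pt3 0 0 0) (two * (q - 1) ^+ 2 * P0
    - (c0 * (q - 1) ^+ 2 + c1 * q * (q - 1) - t * q)) (- k0).
  by eapply polyval_eq; [polyval_compute | ring].
have nk0 : - k0 != 0 by rewrite oppr_eq0.
have H := pencil_in_chart J e0 r0 r2 e1 v1 (erefl _) nk0.
have E1 : evp (@const C) q (('X - 1) * ('X - 1)) = (q - 1) * (q - 1) by evp_compute.
have E2 : evp (@const C) q (- (('X - 1) * (k0%:P * ('X - 1) + (k1 - 1)%:P * 'X))) =
  - ((q - 1) * (c0 * (q - 1) + c1 * q)) by evp_compute.
have E3 : evp (@const C) q ((rho k0 k1 kinf)%:P * 'X * ('X - 1)) = r * q * (q - 1).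
  by evp_compute.
have E4 : evp (@const C) q 'X = q by evp_compute.
exact: (H _ _ _ _ _ _ _ _ _ _ _ E1 E2 E3 E4 e3 r3 polyX1_neq0 polyX_neq0
  (conic_A0 (k0 := k0) (k1 := k1) kinf0)).
Qed.

Lemma pencil_B10 : pencil_of_conics k0 k1 kinf (surf_B10 C).
Proof.
have J : jac (vq1 C) A P10 != 0 by rewrite jac_swap oppr_eq0 jacV_A_q1.
have e0 : t * X (vq1 C) = vq1 C * (two * P10 - c0 * (q - 1) - c1 * q + A * q).
  exact: (X_q1 t0 q1 hX Xq).
have e1 : t * X A = A * (1 + c0 * (q - 1) + c1 * q - A * q - two * P10).
  exact: (X_A t0 q1 hX Xt Xq).
have e2 : t * X P10 = (A * P10 * q + (q - 1) *
    (P10 ^+ 2 + c0 * P10 - r * q ^+ 2 + A * P10 * q)) / q.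
  exact: (X_P10 t0 q0 q1 hX Xq Xp).
have e3 : t * X ((1 * P10 ^+ 2 + (A - k) * P10 + 0) / 1) =
  vq1 C * (((two * P10 + A - k) * (P10 ^+ 2 + c0 * P10 - r * q ^+ 2 + A * P10 * q)
    + P10 * A * (c0 + c1 - A) * q) / q).
  exact: (X_integral_B10 t0 q0 q1 hX Xt Xq Xp).
(* At $q=1$, $A=1$ this value of $P^1_0$ makes the speed of $A$ equal to 1. *)
have [a1 a2 a3] := polyval_pt3 (vq1 C) A P10 0 1 ((k1 - 2%:R) / 2%:R).
have a4 : polyval [tuple vq1 C; A; P10] (pt3 0 1 ((k1 - 2%:R) / 2%:R)) q 1.
  have -> : q = 1 + vq1 C := vq_vq1 C.
  by eapply polyval_eq; [polyval_compute | ring].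
have r0 : regular [tuple vq1 C; A; P10] (two * P10 - c0 * (q - 1) - c1 * q + A * q).
  by eapply (regular_polynomial (w := pt3 0 1 ((k1 - 2%:R) / 2%:R))); [polyval_compute |].
have r2 : regular [tuple vq1 C; A; P10] (t * X P10).
  by eapply (regular_fraction e2 (w := pt3 0 1 _) (erefl _) (oner_neq0 C) a4); polyval_compute.
have r3 : regular [tuple vq1 C; A; P10]
  (((two * P10 + A - k) * (P10 ^+ 2 + c0 * P10 - r * q ^+ 2 + A * P10 * q)
    + P10 * A * (c0 + c1 - A) * q) / q).
  by eapply (regular_fraction (erefl _) (w := pt3 0 1 _) (erefl _) (oner_neq0 C) a4); polyval_compute.
have v1 : polyval [tuple vq1 C; A; P10] (pt3 0 1 ((k1 - 2%:R) / 2%:R))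
    (A * (1 + c0 * (q - 1) + c1 * q - A * q - two * P10)) 1.
  by eapply polyval_eq; [polyval_compute | field].
have H := pencil_in_chart J e0 r0 r2 e1 v1 (erefl _) (oner_neq0 C).
have E1 : evp (@const C) A 1 = 1 by evp_compute.
have E2 : evp (@const C) A ('X - k1%:P) = A - k by evp_compute.
have E3 : evp (@const C) A 0 = 0 by evp_compute.
exact: (H _ _ _ _ _ _ _ _ _ _ _ E1 E2 E3 E1 e3 r3 poly1_neq0 poly1_neq0
  (@conic_B10 C k1)).
Qed.

Lemma one_X_T : 1 * X T = T * - T.
Proof. by rewrite mul1r; apply: (X_T t0 hX Xt). Qed.

Lemma pencil_B0inf : pencil_of_conics k0 k1 kinf (surf_B0inf C).
Proof.
have [k00 _] := hgen.
have J : jac T R P0 != 0 by rewrite jac_swap oppr_eq0 jacV_R_T.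
have e1 : 1 * X R = R * T - c0 * (R * T - 1) ^+ 2
    - c1 * (R * T) * (R * T - 1) + R + two * (R * T - 1) ^+ 2 * P0.
  exact: (X_R' t0 q1 hX Xt Xq).
have e2 : 1 * X P0 = (- ((R * T) ^+ 2 - 1) * P0 ^+ 2
    + (c0 * ((R * T) ^+ 2 - 1) + c1 * (R * T) ^+ 2) * P0 - r * (R * T) ^+ 2) / R.
  exact: (X_P0_R t0 q0 q1 hX Xq Xp).
have e3 : 1 * X ((1 * P0 ^+ 2 + (R - c0) * P0 + 0) / R) =
  T * ((R * T * (- P0 ^+ 2 + (c0 + c1) * P0 - r) * (two * P0 - c0 + R)
    - (1 - c0 * (R * T - two) - c1 * (R * T - 1)
       + two * (R * T - two) * P0) * (P0 ^+ 2 - c0 * P0)) / R).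
  exact: (X_integral_B0inf t0 q0 q1 hX Xt Xq Xp).
have [a1 a2 a3] := polyval_pt3 T R P0 0 1 0; have [b1 b2 b3] := polyval_pt3 T R P0 0 0 0.
have r0 : regular [tuple T; R; P0] (- T).
  by eapply (regular_polynomial (w := pt3 0 1 0)); [polyval_compute |].
have r2 : regular [tuple T; R; P0] (1 * X P0).
  by eapply (regular_fraction e2 (w := pt3 0 1 0) (erefl _) (oner_neq0 C) a2); polyval_compute.
have r3 : regular [tuple T; R; P0]
  ((R * T * (- P0 ^+ 2 + (c0 + c1) * P0 - r) * (two * P0 - c0 + R)
    - (1 - c0 * (R * T - two) - c1 * (R * T - 1)
       + two * (R * T - two) * P0) * (P0 ^+ 2 - c0 * P0)) / R).
  by eapply (regular_fraction (erefl _) (w := pt3 0 1 0) (erefl _) (oner_neq0 C) a2); polyval_compute.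
have v1 : polyval [tuple T; R; P0] (pt3 0 0 0) (R * T - c0 * (R * T - 1) ^+ 2
    - c1 * (R * T) * (R * T - 1) + R + two * (R * T - 1) ^+ 2 * P0) (- k0).
  by eapply polyval_eq; [polyval_compute | ring].
have nk0 : - k0 != 0 by rewrite oppr_eq0.
have H := pencil_in_chart J one_X_T r0 r2 e1 v1 (erefl _) nk0.
have E1 : evp (@const C) R 1 = 1 by evp_compute.
have E2 : evp (@const C) R ('X - k0%:P) = R - c0 by evp_compute.
have E3 : evp (@const C) R 0 = 0 by evp_compute.
have E4 : evp (@const C) R 'X = R by evp_compute.
exact: (H _ _ _ _ _ _ _ _ _ _ _ E1 E2 E3 E4 e3 r3 poly1_neq0 polyX_neq0
  (@conic_B0inf C k0)).
Qed.

Lemma pencil_Binfinf : pencil_of_conics k0 k1 kinf (surf_Binfinf C).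
Proof.
have [_ kinf0] := hgen.
have J : jac T S Pinf != 0 by rewrite jac_swap oppr_eq0 jacV_S_T.
have e1 : 1 * X S = S * T + c0 * (1 - S * T) ^+ 2 + c1 * (1 - S * T) - S
    - two * (1 - S * T) ^+ 2 * Pinf.
  exact: (X_S' t0 q0 q1 hX Xt Xq).
have e2 : 1 * X Pinf = (- (1 - (S * T) ^+ 2) * Pinf ^+ 2
    + (c0 * (1 - (S * T) ^+ 2) + c1) * Pinf - r) / S.
  exact: (X_P0_S t0 q0 q1 hX Xq Xp).
have e3 : 1 * X ((1 * Pinf ^+ 2 + (S - (c0 + c1)) * Pinf + r) / S) =
  T * ((S * T * (Pinf ^+ 2 - c0 * Pinf) * (two * Pinf - (c0 + c1) + S)
    - (1 + c0 * (S * T - two) - c1 - two * (S * T - two) * Pinf)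
      * (Pinf ^+ 2 - (c0 + c1) * Pinf + r)) / S).
  exact: (X_integral_Binf t0 q0 q1 hX Xt Xq Xp).
have [a1 a2 a3] := polyval_pt3 T S Pinf 0 1 0.
(* At $T=P^\infty=0$ the speed of $S$ is $\kappa_0+\kappa_1-1-S$, equal to 1 at $S=b$. *)
have [b eb] : exists b, b = k0 + (k1 - 1) - 1 by eexists.
have [b1 b2 b3] := polyval_pt3 T S Pinf 0 b 0.
have r0 : regular [tuple T; S; Pinf] (- T).
  by eapply (regular_polynomial (w := pt3 0 1 0)); [polyval_compute |].
have r2 : regular [tuple T; S; Pinf] (1 * X Pinf).
  by eapply (regular_fraction e2 (w := pt3 0 1 0) (erefl _) (oner_neq0 C) a2); polyval_compute.
have r3 : regular [tuple T; S; Pinf]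
  ((S * T * (Pinf ^+ 2 - c0 * Pinf) * (two * Pinf - (c0 + c1) + S)
    - (1 + c0 * (S * T - two) - c1 - two * (S * T - two) * Pinf)
      * (Pinf ^+ 2 - (c0 + c1) * Pinf + r)) / S).
  by eapply (regular_fraction (erefl _) (w := pt3 0 1 0) (erefl _) (oner_neq0 C) a2); polyval_compute.
have v1 : polyval [tuple T; S; Pinf] (pt3 0 b 0)
   (S * T + c0 * (1 - S * T) ^+ 2 + c1 * (1 - S * T) - S
    - two * (1 - S * T) ^+ 2 * Pinf) 1.
  by eapply polyval_eq; [polyval_compute | rewrite eb; ring].
have H := pencil_in_chart J one_X_T r0 r2 e1 v1 (erefl _) (oner_neq0 C).
have E1 : evp (@const C) S 1 = 1 by evp_compute.
have E2 : evp (@const C) S ('X - (k0 + (k1 - 1))%:P) = S - (c0 + c1).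
  by rewrite evpB evpX evpC rmorphD.
have E3 : evp (@const C) S (rho k0 k1 kinf)%:P = r by evp_compute.
have E4 : evp (@const C) S 'X = S by evp_compute.
exact: (H _ _ _ _ _ _ _ _ _ _ _ E1 E2 E3 E4 e3 r3 poly1_neq0 polyX_neq0
  (@conic_Binf C k0 k1 kinf)).
Qed.

Lemma pencil_Ainf : pencil_of_genus_one_curves k0 k1 kinf (surf_Ainf C).
Proof.
have J := jacV_T_q C.
have e1 : 1 * X q = q - T * (c0 * (q - 1) ^+ 2 + c1 * q * (q - 1)) + two * q * P1.
  exact: (X_q_P1' t0 q0 Xq).
have e2 : 1 * X P1 = ((q + 1) * (P1 ^+ 2 + P1) - (q - 1) * T * k * P1
    - r * T ^+ 2 * (q - 1) ^+ 3) / (q - 1).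
  exact: (X_P1 t0 q0 q1 hX Xt Xq Xp).
have e3 : 1 * X ((q * P1 ^+ 2 + q * P1 + 0) / ((q - 1) * (q - 1))) =
  T * (((P1 ^+ 2 + P1) * (q + 1) * (c0 * (q - 1) + c1 * q)
    - q * (two * P1 + 1) * (k * P1 + r * T * (q - 1) ^+ 2)) / ((q - 1) * (q - 1))).
  exact: (X_integral_Ainf t0 q0 q1 hX Xt Xq Xp).
(* At $q=1$ the speed of $q$ is 1, while $q=0$ keeps the denominators in $q-1$ nonzero. *)
have [a1 a2 a3] := polyval_pt3 T q P1 0 1 0; have [b1 b2 b3] := polyval_pt3 T q P1 0 0 0.
have r0 : regular [tuple T; q; P1] (- T).
  by eapply (regular_polynomial (w := pt3 0 1 0)); [polyval_compute |].
have d1 : polyval [tuple T; q; P1] (pt3 0 0 0) (q - 1) (-1).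
  by eapply polyval_eq; [polyval_compute | ring].
have n1 : -1 != 0 :> C by rewrite oppr_eq0 oner_neq0.
have d2 : polyval [tuple T; q; P1] (pt3 0 0 0) ((q - 1) * (q - 1)) 1.
  by eapply polyval_eq; [polyval_compute | ring].
have r2 : regular [tuple T; q; P1] (1 * X P1).
  by eapply (regular_fraction e2 (w := pt3 0 0 0) (erefl _) n1 d1); polyval_compute.
have r3 : regular [tuple T; q; P1]
  (((P1 ^+ 2 + P1) * (q + 1) * (c0 * (q - 1) + c1 * q)
    - q * (two * P1 + 1) * (k * P1 + r * T * (q - 1) ^+ 2)) / ((q - 1) * (q - 1))).
  by eapply (regular_fraction (erefl _) (w := pt3 0 0 0) (erefl _) (oner_neq0 C) d2); polyval_compute.
have v1 : polyval [tuple T; q; P1] (pt3 0 1 0)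
    (q - T * (c0 * (q - 1) ^+ 2 + c1 * q * (q - 1)) + two * q * P1) 1.
  by eapply polyval_eq; [polyval_compute | ring].
have H := pencil_in_chart J one_X_T r0 r2 e1 v1 (erefl _) (oner_neq0 C).
have E1 : evp (@const C) q 'X = q by evp_compute.
have E3 : evp (@const C) q 0 = 0 by evp_compute.
have E4 : evp (@const C) q (('X - 1) * ('X - 1)) = (q - 1) * (q - 1) by evp_compute.
exact: (H _ _ _ _ _ _ _ _ _ _ _ E1 E1 E3 E4 e3 r3 polyX_neq0 polyX1_neq0
  (@cubic_Ainf C)).
Qed.

End Pencils.

Theorem theorem2 (C : numClosedFieldType) (k0 k1 kinf : C)
    (hgen : generic_parameters k0 k1 kinf) :
  (invariant_zero_set k0 k1 kinf (vt C) /\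
   invariant_zero_set k0 k1 kinf (vT C)) /\
  (pencil_of_conics k0 k1 kinf (surf_A0 C) /\
   pencil_of_conics k0 k1 kinf (surf_B10 C)) /\
  (pencil_of_conics k0 k1 kinf (surf_B0inf C) /\
   pencil_of_conics k0 k1 kinf (surf_Binfinf C) /\
   pencil_of_genus_one_curves k0 k1 kinf (surf_Ainf C)).
Proof.
split; first exact: invariant_fibres.
split; first by split; [exact: pencil_A0 | exact: pencil_B10].
split; first exact: pencil_B0inf.
by split; [exact: pencil_Binfinf | exact: pencil_Ainf].
Qed.
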